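(* Let $H$ be an $N\times N$ Wigner matrix, let $v\in\mathbb{C}^N$ be a fixed (deterministic) unit vector, let $T\ge 2$ be a fixed constant, and set $G_t := H + it\,vv^*$. For any $\varepsilon,\zeta>0$, with high probability (with respect to the randomness of $H$), for every $t\in(0,T)$ all eigenvalues of $G_t$ lie in $\mathscr{E}_{t,\varepsilon}\cup\mathscr{R}_\zeta$, where $$\mathscr{E}_{t,\varepsilon} := \left\{ z=E+i\eta\in\mathbb{C} : E^2 + (\eta - t^* )^2 < \frac{N^{\varepsilon}}{N\eta},\ |E|<3,\ 0\le \eta < T\right\},\qquad t^* := t-\frac1t,$$ and $$\mathscr{R}_\zeta := \{ z=E+i\eta\in\mathbb{C} : |E|<3,\ 0\le \eta < N^{-1+\zeta}\}.$$
   Context: A Wigner matrix is an $N\times N$ Hermitian random matrix $H=(h_{ij})$ whose entries $h_{ij}$, $i\le j$, are independent; the off-diagonal entries are identically distributed with a continuous distribution on $\mathbb{C}$ and the diagonal entries are identically distributed with a continuous distribution on $\mathbb{R}$; $\mathbb{E}h_{ij}=0$, $\mathbb{E}|h_{ij}|^2=1/N$, and $\mathbb{E}|\sqrt N h_{ij}|^p\le C_p$ for every $p$, with constants $C_p$ independent of $N$. A sequence of events $(A_N)_{N\ge1}$ holds with high probability if for every $D>0$, $\mathbb{P}(A_N^c)<N^{-D}$ for all sufficiently large $N$. *)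

(* Defs.v *)
From HB Require Import structures.
From mathcomp Require Import all_boot all_order all_algebra.
From mathcomp Require Import all_classical all_reals all_analysis.
From mathcomp Require Import complex.
Set Implicit Arguments. Unset Strict Implicit. Unset Printing Implicit Defensive.
Import Order.TTheory GRing.Theory Num.Theory.
Local Open Scope classical_set_scope.
Local Open Scope ring_scope.
Local Open Scope complex_scope.

Definition cabs (R : rcfType) (z : R[i]) : R :=
  Num.sqrt (complex.Re z ^+ 2 + complex.Im z ^+ 2).

(* the complex number seen as a point of R^2 (for measurability / laws) *)
Definition c2p (R : rcfType) (z : R[i]) : (R * R)%type :=
  (complex.Re z, complex.Im z).

Definition adjmx (R : rcfType) m n (A : 'M[R[i]]_(m, n)) : 'M[R[i]]_(n, m) :=
  \matrix_(i, j) conjc (A j i).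

Definition wigner (R : realType) (d : measure_display) (Omega : measurableType d)
    (P : probability Omega R) (Cp : nat -> R) (N : nat)
    (H : Omega -> 'M[R[i]]_N) : Prop :=
  [/\
      (forall w (i j : 'I_N), H w j i = conjc (H w i j)) /\
      (forall i j : 'I_N, measurable_fun setT (fun w => c2p (H w i j))),
      (forall A : 'I_N -> 'I_N -> set (R * R)%type,
          (forall i j, measurable (A i j)) ->
          P (\bigcap_(k in [set k : 'I_N * 'I_N | (k.1 <= k.2)%N])
               [set w | c2p (H w k.1 k.2) \in A k.1 k.2]) =
          (\prod_(k : 'I_N * 'I_N | (k.1 <= k.2)%N)
               P [set w | c2p (H w k.1 k.2) \in A k.1 k.2])%E),
      ((forall (i j k l : 'I_N), (i < j)%N -> (k < l)%N ->
          forall A : set (R * R)%type, measurable A ->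
          P [set w | c2p (H w i j) \in A] = P [set w | c2p (H w k l) \in A])
      /\ (forall (i j : 'I_N), (i < j)%N -> forall z : R[i],
          P [set w | H w i j = z] = 0%E)),
      (* diagonal entries (real by hermiticity) identically distributed, continuous law on R *)
      ((forall (i k : 'I_N) (A : set R), measurable A ->
          P [set w | complex.Re (H w i i) \in A] = P [set w | complex.Re (H w k k) \in A])
      /\ (forall (i : 'I_N) (x : R), P [set w | complex.Re (H w i i) = x] = 0%E)) &
      (forall i j : 'I_N,
         [/\ P.-integrable setT (fun w => (complex.Re (H w i j))%:E),
             P.-integrable setT (fun w => (complex.Im (H w i j))%:E) /\
             (\int[P]_w (complex.Re (H w i j))%:E = 0)%E,
             (\int[P]_w (complex.Im (H w i j))%:E = 0)%E,
             (\int[P]_w ((cabs (H w i j)) ^+ 2)%:E = (N%:R)^-1%:E)%E &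
             forall p : nat,
               (\int[P]_w ((Num.sqrt N%:R * cabs (H w i j)) ^+ p)%:E <= (Cp p)%:E)%E])].

Definition Gt (R : rcfType) N (H : 'M[R[i]]_N) (v : 'cV[R[i]]_N) (t : R) : 'M[R[i]]_N :=
  H + ((t%:C * 'i) *: (v *m adjmx v)).

Definition tstar (R : realType) (t : R) : R := t - t^-1.

Definition setE (R : realType) (N : nat) (T t eps : R) : set R[i] :=
  [set z | (complex.Re z) ^+ 2 + (complex.Im z - tstar t) ^+ 2
             < (N%:R `^ eps) / (N%:R * complex.Im z)
           /\ `|complex.Re z| < 3 /\ 0 <= complex.Im z /\ complex.Im z < T].

Definition setR (R : realType) (N : nat) (zeta : R) : set R[i] :=
  [set z | `|complex.Re z| < 3 /\ 0 <= complex.Im z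
           /\ complex.Im z < N%:R `^ (-1 + zeta)].

(* Main.v *)
(* An eigenvalue z of G_t = H + it vv^* in the upper half plane satisfies
   <v, (H - z)^-1 v> = i/t.  Let m be the normalized trace of the resolvent and, for a
   unit vector x, X_x = 1 + (z + m) <x, (H - z)^-1 x>.  The average of X_{e_k} over k is
   1 + zm + m^2, so if all the X_x are small, both this equation and the eigenvalue equation
   hold approximately; together they put z close to i(t - 1/t).

   High moments of X_x are bounded by replacing one entry of H at a time by an independent
   copy: since E h_ij = 0, E h_ij F(H) is computed to third order in the increment, and the
   second-order terms cancel up to O((N Im z)^(-1/2)).  This needs a priori bounds on the
   resolvent, which are propagated from Im z >= 1 down to Im z = N^(-1+zeta) in steps
   Im z -> Im z / N^delta: one step costs at most a factor N^delta, and the smallness of X_x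
   brings the bound back to a constant.  The semicircle law itself is never needed.

   The norm of H is bounded by counting walks weighted by the moments of truncated entries. *)
Require Import Defs.
From HB Require Import structures.
From mathcomp Require Import all_boot all_order all_algebra.
From mathcomp Require Import all_classical all_reals all_analysis.
From mathcomp Require Import complex ring lra zify.
From mathcomp Require Import measurable_realfun.
Set Implicit Arguments. Unset Strict Implicit. Unset Printing Implicit Defensive.
Import Order.TTheory GRing.Theory Num.Theory numFieldNormedType.Exports.
Local Open Scope classical_set_scope.
Local Open Scope ring_scope.

(** * Complex numbers and resolvents *)

(** All exceptional events concern H alone: its norm, and X_v and X_{e_k} for Im z >= N^(-1+zeta).
    One event therefore serves every t in (0,T). No stability analysis of m^2 + zm + 1 = 0 is
    needed, since the eigenvalue equation supplies a second relation: it turns X_v = 0 into z + m =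
    it, and then 1 + zm + m^2 = 0 is linear in z.

    The law of an entry need not be smooth, and E h_ij^2 is arbitrary. If h' is an independent copy
    of h_ij, the matrix with h' in place of h_ij has the law of H, while E h' F(H) = 0; hence only
    the change of F counts, and E |h'|^2 and E h'^2 multiply two different derivatives of F. The
    leading part of the first cancels m <v, (H - z)^-1 v>. The second has no partner; summed over i
    against v it becomes a resolvent form in a vector that depends on j, so a priori bounds are
    needed for general vectors of the unit ball and not only for v and the basis.

    The error N^(61 dl) (N Im z)^(-1/2), squared, gives the radius in [setE]; dl is small against
    zeta and eps. *)

Section ComplexModulus.
Local Open Scope complex_scope.
Variable R : rcfType.
Implicit Types x y z : R[i].

Lemma cabsE z : cabs z = ComplexField.Normc.normc z.
Proof. by case: z. Qed.

Lemma cabs_ge0 z : 0 <= cabs z.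
Proof. exact: sqrtr_ge0. Qed.

Lemma cabsM x y : cabs (x * y) = cabs x * cabs y.
Proof. by rewrite !cabsE ComplexField.Normc.normcM. Qed.

Lemma cabsD x y : cabs (x + y) <= cabs x + cabs y.
Proof. by rewrite !cabsE; exact: le_normcD. Qed.

Lemma cabsN x : cabs (- x) = cabs x.
Proof. by rewrite !cabsE; exact: normcN. Qed.

Lemma cabsB x y : cabs (x - y) <= cabs x + cabs y.
Proof. by rewrite -(cabsN y) cabsD. Qed.

Lemma cabs0 : cabs (0 : R[i]) = 0.
Proof. by rewrite cabsE ComplexField.Normc.normc0. Qed.

Lemma cabs1 : cabs (1 : R[i]) = 1.
Proof. by rewrite cabsE ComplexField.Normc.normc1. Qed.

Lemma cabsV x : cabs x^-1 = (cabs x)^-1.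
Proof. by rewrite !cabsE ComplexField.Normc.normcV. Qed.

Lemma cabsX x n : cabs (x ^+ n) = cabs x ^+ n.
Proof. by elim: n => [|n IH]; rewrite ?expr0 ?cabs1// !exprS cabsM IH. Qed.

Lemma cabsJ x : cabs (conjc x) = cabs x.
Proof. by case: x => a b; rewrite /cabs /= sqrrN. Qed.

Lemma cabs_eq0 x : (cabs x == 0) = (x == 0).
Proof.
apply/eqP/eqP => [|->]; last exact: cabs0.
by rewrite cabsE; exact: ComplexField.Normc.eq0_normc.
Qed.

Lemma cabs_gt0 x : (0 < cabs x) = (x != 0).
Proof. by rewrite lt_neqAle cabs_ge0 andbT eq_sym cabs_eq0. Qed.

Lemma cabs_real (a : R) : cabs a%:C = `|a|.
Proof. by rewrite /cabs /= expr0n /= addr0 sqrtr_sqr. Qed.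

Lemma cabs_i : cabs ('i : R[i]) = 1.
Proof. by rewrite /cabs /= expr0n /= add0r expr1n sqrtr1. Qed.

Lemma cabs_nat n : cabs (n%:R : R[i]) = n%:R.
Proof. by rewrite -[n%:R](rmorph_nat (real_complex R)) cabs_real normr_nat. Qed.

Lemma cabs_sqr z : cabs z ^+ 2 = complex.Re z ^+ 2 + complex.Im z ^+ 2.
Proof. by rewrite /cabs sqr_sqrtr// addr_ge0 ?sqr_ge0. Qed.

Lemma cabs_mulJ z : z * conjc z = (cabs z ^+ 2)%:C.
Proof. by rewrite cabs_sqr; case: z => a b; rewrite /real_complex_def; simpc; apply/eqP; rewrite eq_complex /=; apply/andP; split; apply/eqP; ring. Qed.

Lemma Re_le_cabs z : `|complex.Re z| <= cabs z.
Proof.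
by rewrite -(ger0_norm (cabs_ge0 z)) -ler_sqr ?nnegrE// !real_normK ?num_real// cabs_sqr lerDl sqr_ge0.
Qed.

Lemma Im_le_cabs z : `|complex.Im z| <= cabs z.
Proof.
by rewrite -(ger0_norm (cabs_ge0 z)) -ler_sqr ?nnegrE// !real_normK ?num_real// cabs_sqr lerDr sqr_ge0.
Qed.

Lemma cabs_le_ReIm z : cabs z <= `|complex.Re z| + `|complex.Im z|.
Proof.
rewrite -ler_sqr ?nnegrE ?cabs_ge0 ?addr_ge0 ?normr_ge0// cabs_sqr sqrrD !real_normK ?num_real//.
by rewrite addrAC lerDl mulrn_wge0// mulr_ge0.
Qed.

Lemma cabs_sum (I : Type) (r : seq I) (P : pred I) (F : I -> R[i]) :
  cabs (\sum_(i <- r | P i) F i) <= \sum_(i <- r | P i) cabs (F i).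
Proof.
elim/big_rec2: _ => [|i y1 y2 _ le]; first by rewrite cabs0.
by rewrite (le_trans (cabsD _ _))// lerD2l.
Qed.

Lemma cabs_sub_le x y : cabs x <= cabs y + cabs (x - y).
Proof. by rewrite -{1}(subrK y x) addrC; exact: cabsD. Qed.

Lemma cabs_div_nat (n : nat) x : cabs (x / n%:R) = cabs x / n%:R.
Proof. by rewrite cabsM cabsV cabs_nat. Qed.

Lemma cReD x y : complex.Re (x + y) = complex.Re x + complex.Re y.
Proof. by case: x; case: y. Qed.

Lemma cImD x y : complex.Im (x + y) = complex.Im x + complex.Im y.
Proof. by case: x; case: y. Qed.

Lemma cReN x : complex.Re (- x) = - complex.Re x.
Proof. by case: x. Qed.

Lemma cImN x : complex.Im (- x) = - complex.Im x.
Proof. by case: x. Qed.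

Lemma cReM x y : complex.Re (x * y) =
  complex.Re x * complex.Re y - complex.Im x * complex.Im y.
Proof. by case: x; case: y. Qed.

Lemma cImM x y : complex.Im (x * y) =
  complex.Re x * complex.Im y + complex.Im x * complex.Re y.
Proof. by case: x; case: y. Qed.

Lemma cReJ x : complex.Re (conjc x) = complex.Re x.
Proof. by case: x. Qed.

Lemma cImJ x : complex.Im (conjc x) = - complex.Im x.
Proof. by case: x. Qed.

Lemma complex_ext x y : complex.Re x = complex.Re y -> complex.Im x = complex.Im y -> x = y.
Proof. by case: x => a b; case: y => c d /= -> ->. Qed.

End ComplexModulus.

(** * Cauchy-Schwarz for finite real sums *)

Section RealSums.
Variable R : rcfType.

(** Lagrange's identity writes the difference as half a double sum of squares. *)
Lemma sum_cauchy_schwarz (I : finType) (a b : I -> R) :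
  (\sum_i a i * b i) ^+ 2 <= (\sum_i a i ^+ 2) * (\sum_i b i ^+ 2).
Proof.
rewrite -subr_ge0.
have -> : (\sum_i a i ^+ 2) * (\sum_i b i ^+ 2) - (\sum_i a i * b i) ^+ 2 =
   2^-1 * \sum_i \sum_j (a i * b j - a j * b i) ^+ 2.
  have E1 : (\sum_i a i ^+ 2) * (\sum_i b i ^+ 2) = \sum_i \sum_j a i ^+ 2 * b j ^+ 2.
    by rewrite mulr_suml; apply: eq_bigr => i _; rewrite mulr_sumr.
  have E2 : (\sum_i a i ^+ 2) * (\sum_i b i ^+ 2) = \sum_i \sum_j a j ^+ 2 * b i ^+ 2.
    by rewrite E1 exchange_big.
  have E3 : (\sum_i a i * b i) ^+ 2 = \sum_i \sum_j (a i * b i) * (a j * b j).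
    by rewrite expr2 mulr_suml; apply: eq_bigr => i _; rewrite mulr_sumr.
  have -> : \sum_i \sum_j (a i * b j - a j * b i) ^+ 2 =
     \sum_i \sum_j a i ^+ 2 * b j ^+ 2 + \sum_i \sum_j a j ^+ 2 * b i ^+ 2
      - 2 * \sum_i \sum_j (a i * b i) * (a j * b j).
    rewrite mulr_sumr -big_split /= -sumrB; apply: eq_bigr => i _.
    rewrite mulr_sumr -big_split /= -sumrB; apply: eq_bigr => j _.
    by ring.
  by rewrite -E1 -E2 -E3; field.
by rewrite mulr_ge0 ?invr_ge0// sumr_ge0// => i _; rewrite sumr_ge0// => j _; rewrite sqr_ge0.
Qed.

Lemma sum_cauchy_schwarz_sqrt (I : finType) (a b : I -> R) :
  \sum_i a i * b i <= Num.sqrt (\sum_i a i ^+ 2) * Num.sqrt (\sum_i b i ^+ 2).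
Proof.
rewrite -sqrtrM ?sumr_ge0// => [|i _]; last by rewrite sqr_ge0.
apply: le_trans (ler_norm _) _; rewrite -sqrtr_sqr ler_sqrt ?sum_cauchy_schwarz//.
by apply: mulr_ge0; apply: sumr_ge0 => i _; rewrite sqr_ge0.
Qed.

Lemma sum_le_sqrt_card (n : nat) (a : 'I_n -> R) :
  \sum_i a i <= Num.sqrt n%:R * Num.sqrt (\sum_i a i ^+ 2).
Proof.
rewrite (le_trans _ (le_trans (sum_cauchy_schwarz_sqrt (fun=> 1) a) _))//.
  by rewrite le_eqVlt; apply/orP; left; apply/eqP/eq_bigr => i _; rewrite mul1r.
by rewrite expr1n sumr_const card_ord.
Qed.

End RealSums.

(** * The Hermitian inner product on columns *)

Section InnerProduct.
Local Open Scope complex_scope.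
Variable R : rcfType.
Variable N : nat.
Implicit Types x y u : 'cV[R[i]]_N.
Implicit Types A M : 'M[R[i]]_N.

Definition dotc x y : R[i] := \sum_k conjc (x k ord0) * y k ord0.

Definition nrm2 x : R := \sum_k cabs (x k ord0) ^+ 2.

Definition hermitian A : Prop := forall i j, A j i = conjc (A i j).

Lemma nrm2_ge0 x : 0 <= nrm2 x.
Proof. by apply: sumr_ge0 => k _; rewrite sqr_ge0. Qed.

Lemma dotcDr x y u : dotc x (y + u) = dotc x y + dotc x u.
Proof. by rewrite /dotc -big_split; apply: eq_bigr => k _; rewrite mxE mulrDr. Qed.

Lemma dotcZr x (c : R[i]) y : dotc x (c *: y) = c * dotc x y.
Proof. by rewrite /dotc mulr_sumr; apply: eq_bigr => k _; rewrite mxE mulrCA. Qed.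

Lemma dotcNr x y : dotc x (- y) = - dotc x y.
Proof. by rewrite -scaleN1r dotcZr mulN1r. Qed.

Lemma dotcBr x y u : dotc x (y - u) = dotc x y - dotc x u.
Proof. by rewrite dotcDr dotcNr. Qed.

Lemma dotc_conj x y : conjc (dotc x y) = dotc y x.
Proof.
rewrite /dotc rmorph_sum; apply: eq_bigr => k _.
by rewrite rmorphM /= conjcK mulrC.
Qed.

Lemma dotcDl x y u : dotc (x + y) u = dotc x u + dotc y u.
Proof. by rewrite -dotc_conj dotcDr rmorphD /= !dotc_conj. Qed.

Lemma dotcZl x (c : R[i]) y : dotc (c *: x) y = conjc c * dotc x y.
Proof. by rewrite -dotc_conj dotcZr rmorphM /= dotc_conj. Qed.

Lemma dotcxx x : dotc x x = (nrm2 x)%:C.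
Proof.
rewrite /dotc /nrm2 rmorph_sum; apply: eq_bigr => k _.
by rewrite mulrC cabs_mulJ.
Qed.

Lemma dotc_adj x M y : dotc x (M *m y) = dotc (adjmx M *m x) y.
Proof.
rewrite /dotc.
under eq_bigr do rewrite mxE mulr_sumr.
rewrite exchange_big; apply: eq_bigr => k _ /=.
rewrite mxE rmorph_sum mulr_suml; apply: eq_bigr => j _.
by rewrite rmorphM /= !mxE conjcK mulrCA mulrA.
Qed.

Lemma dotc_cauchy_schwarz x y : cabs (dotc x y) <= Num.sqrt (nrm2 x) * Num.sqrt (nrm2 y).
Proof.
apply: le_trans (cabs_sum _ _ _) _.
under eq_bigr do rewrite cabsM cabsJ.
exact: sum_cauchy_schwarz_sqrt.
Qed.

Lemma adjmx_herm A : hermitian A -> adjmx A = A.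
Proof. by move=> hA; apply/matrixP => i j; rewrite mxE -hA. Qed.

Definition ebase k : 'cV[R[i]]_N := delta_mx k ord0.

Lemma ebaseE k j : ebase k j ord0 = (j == k)%:R.
Proof. by rewrite mxE eqxx andbT. Qed.

Lemma dotc_ebase k y : dotc (ebase k) y = y k ord0.
Proof.
rewrite /dotc (bigD1 k)//= ebaseE eqxx conjc1 mul1r big1 ?addr0// => j jk.
by rewrite ebaseE (negbTE jk) conjc0 mul0r.
Qed.

Lemma nrm2_ebase k : nrm2 (ebase k) = 1.
Proof.
rewrite /nrm2 (bigD1 k)//= ebaseE eqxx cabs1 expr1n big1 ?addr0// => j jk.
by rewrite ebaseE (negbTE jk) cabs0 expr0n.
Qed.

Lemma nrm2_eq0 x : nrm2 x = 0 -> x = 0.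
Proof.
move=> /eqP; rewrite psumr_eq0 => [/allP /= h|k _]; last by rewrite sqr_ge0.
apply/matrixP => k j; rewrite (ord1 j) mxE.
by have := h k (mem_index_enum _); rewrite sqrf_eq0 cabs_eq0 => /eqP.
Qed.

Lemma nrm2Z (c : R[i]) x : nrm2 (c *: x) = cabs c ^+ 2 * nrm2 x.
Proof. by rewrite /nrm2 mulr_sumr; apply: eq_bigr => k _; rewrite mxE cabsM exprMn. Qed.

Lemma cV_decomp y : y = \sum_k y k ord0 *: ebase k.
Proof.
apply/matrixP => i j; rewrite (ord1 j) summxE (bigD1 i)//= !mxE !eqxx mulr1 big1 ?addr0//.
by move=> k ki; rewrite !mxE eq_sym (negbTE ki) mulr0.
Qed.

End InnerProduct.

(* Adjugate formula, so that entries are measurable in A; it is 0 when A - z is singular. *)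
HB.lock Definition res (R : rcfType) (N : nat) (A : 'M[R[i]]_N) (z : R[i]) : 'M[R[i]]_N :=
  (\det (A - z%:M))^-1 *: \adj (A - z%:M).

(** * Resolvent identities and the Ward identity *)

Section Resolvent.
Local Open Scope complex_scope.
Variable R : rcfType.
Variable N : nat.
Implicit Types x y u v : 'cV[R[i]]_N.
Implicit Types A B : 'M[R[i]]_N.
Implicit Types z : R[i].

Definition qf A z x y : R[i] := dotc x (res A z *m y).

(** A kernel vector x of A - z would make <x, A x> equal both to z |x|^2 and to its conjugate. *)
Lemma hermitian_det_neq0 A z : hermitian A -> complex.Im z != 0 -> \det (A - z%:M) != 0.
Proof.
move=> hA z0; apply/negP => /eqP d0.
have /eqP/det0P [w w0 wA] : \det (A - z%:M)^T = 0 by rewrite det_tr.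
have {wA} wA : (A - z%:M) *m w^T = 0 by rewrite -[_ *m _]trmxK trmx_mul trmxK wA trmx0.
set x := w^T in wA.
have Ax : A *m x = z *: x.
  by apply/eqP; rewrite -subr_eq0 -mul_scalar_mx -mulmxBl wA.
have e1 : dotc x (A *m x) = z * (nrm2 x)%:C by rewrite Ax dotcZr dotcxx.
have e2 : dotc x (A *m x) = conjc z * (nrm2 x)%:C.
  by rewrite dotc_adj adjmx_herm// Ax dotcZl dotcxx.
have n0 : nrm2 x != 0.
  apply: contra w0 => /eqP /nrm2_eq0 x0; by rewrite -[w]trmxK -/x x0 trmx0.
have : z * (nrm2 x)%:C = conjc z * (nrm2 x)%:C by rewrite -e1 -e2.
move=> /(congr1 (@complex.Im R)); rewrite !cImM /= !mulr0 !add0r cImJ => /(mulIf n0) /eqP.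
by rewrite -addr_eq0 -mulr2n mulrn_eq0 /= (negbTE z0).
Qed.

Lemma mul_res A z : hermitian A -> complex.Im z != 0 -> (A - z%:M) *m res A z = 1%:M.
Proof.
move=> hA z0; rewrite res.unlock -scalemxAr mul_mx_adj scale_scalar_mx mulVf//.
exact: hermitian_det_neq0.
Qed.

Lemma res_mul A z : hermitian A -> complex.Im z != 0 -> res A z *m (A - z%:M) = 1%:M.
Proof.
move=> hA z0; rewrite res.unlock -scalemxAl mul_adj_mx scale_scalar_mx mulVf//.
exact: hermitian_det_neq0.
Qed.

Lemma adjmx_mul m n p (C : 'M[R[i]]_(m, n)) (D : 'M[R[i]]_(n, p)) :
  adjmx (C *m D) = adjmx D *m adjmx C.
Proof.
apply/matrixP => i j; rewrite !mxE rmorph_sum; apply: eq_bigr => k _.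
by rewrite !mxE rmorphM /= mulrC.
Qed.

Lemma adjmxK m n (C : 'M[R[i]]_(m, n)) : adjmx (adjmx C) = C.
Proof. by apply/matrixP => i j; rewrite !mxE conjcK. Qed.

Lemma adjmx1 : adjmx (1%:M : 'M[R[i]]_N) = 1%:M.
Proof. by apply/matrixP => i j; rewrite !mxE eq_sym conjc_nat. Qed.

Lemma adjmx_sub_scalar A z : hermitian A -> adjmx (A - z%:M) = A - (conjc z)%:M.
Proof.
move=> hA; apply/matrixP => i j; rewrite !mxE rmorphB rmorphMn /= -hA.
by congr (_ - _ *+ _); rewrite eq_sym.
Qed.

Lemma res_adj A z : hermitian A -> complex.Im z != 0 -> adjmx (res A z) = res A (conjc z).
Proof.
move=> hA z0.
have zb0 : complex.Im (conjc z) != 0 by rewrite cImJ oppr_eq0.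
have h : adjmx (res A z) *m (A - (conjc z)%:M) = 1%:M.
  by rewrite -adjmx_sub_scalar// -adjmx_mul mul_res// adjmx1.
by rewrite -[LHS]mulmx1 -(mul_res hA zb0) mulmxA h mul1mx.
Qed.

(** Ward identity: with u = G y one has y = (A - z) u, and <u, A u> is real. Every gain of a factor
    1/(N Im z) below comes from it. *)
Lemma ward_r A z y : hermitian A -> complex.Im z != 0 ->
  complex.Im (qf A z y y) = complex.Im z * nrm2 (res A z *m y).
Proof.
move=> hA z0; rewrite /qf; set u := res A z *m y.
have yu : y = A *m u - z *: u.
  by rewrite -mul_scalar_mx -mulmxBl /u mulmxA mul_res// mul1mx.
have Aureal : complex.Im (dotc u (A *m u)) = 0.
  have e : conjc (dotc u (A *m u)) = dotc u (A *m u).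
    by rewrite dotc_conj [RHS]dotc_adj adjmx_herm.
  move: e => /(congr1 (@complex.Im R)); rewrite cImJ => /eqP.
  by rewrite eq_sym -addr_eq0 -mulr2n mulrn_eq0 /= => /eqP.
rewrite -(dotc_conj u y) {1}yu dotcBr dotcZr dotcxx cImJ cImD cImN Aureal cImM /= mulr0 !add0r opprK.
by [].
Qed.

(** The adjoint of the resolvent is the resolvent at the conjugate point, where [ward_r] applies. *)
Lemma ward_l A z y : hermitian A -> complex.Im z != 0 ->
  complex.Im (qf A z y y) = complex.Im z * nrm2 (adjmx (res A z) *m y).
Proof.
move=> hA z0; rewrite res_adj//.
have zb0 : complex.Im (conjc z) != 0 by rewrite cImJ oppr_eq0.
have := ward_r y hA zb0; rewrite cImJ mulNr.
suff -> : qf A (conjc z) y y = conjc (qf A z y y) by rewrite cImJ => /oppr_inj.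
by rewrite /qf -res_adj// dotc_conj [LHS]dotc_adj adjmxK.
Qed.

(** The Ward identity gives Im z |G y|^2 <= |y| |G y|, hence |G y| <= |y| / Im z. *)
Lemma qf_le A z x y : hermitian A -> 0 < complex.Im z ->
  cabs (qf A z x y) <= Num.sqrt (nrm2 x) * Num.sqrt (nrm2 y) / complex.Im z.
Proof.
move=> hA z0; have z0' : complex.Im z != 0 by rewrite gt_eqF.
apply: le_trans (dotc_cauchy_schwarz _ _) _; rewrite -mulrA ler_wpM2l ?sqrtr_ge0//.
set s := Num.sqrt (nrm2 (res A z *m y)).
have h1 : complex.Im z * s ^+ 2 <= Num.sqrt (nrm2 y) * s.
  rewrite sqr_sqrtr ?nrm2_ge0// -ward_r//.
  apply: le_trans (dotc_cauchy_schwarz _ _).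
  by apply: le_trans (Im_le_cabs _); exact: ler_norm.
rewrite ler_pdivlMr//.
have [->|s0] := eqVneq s 0; first by rewrite mul0r sqrtr_ge0.
have sp : 0 < s by rewrite lt_neqAle eq_sym s0 sqrtr_ge0.
by rewrite -(ler_pM2r sp) -mulrA mulrC (le_trans _ h1)// expr2 mulrA.
Qed.

(** Cauchy-Schwarz between G* x and G y, then the Ward identity on either side: G^2 costs a single
    factor 1/Im z. *)
Lemma qf_resr_le A z x y : hermitian A -> 0 < complex.Im z ->
  cabs (dotc x (res A z *m (res A z *m y))) <=
  Num.sqrt (complex.Im (qf A z x x)) * Num.sqrt (complex.Im (qf A z y y)) / complex.Im z.
Proof.
move=> hA z0; have z0' : complex.Im z != 0 by rewrite gt_eqF.
rewrite dotc_adj; apply: le_trans (dotc_cauchy_schwarz _ _) _.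
rewrite (ward_l x)// (ward_r y)// !sqrtrM ?(ltW z0)//.
rewrite mulrACA -expr2 sqr_sqrtr ?(ltW z0)// mulrAC divff// mul1r //.
Qed.

Lemma Im_qf_le A z x : complex.Im (qf A z x x) <= cabs (qf A z x x).
Proof. by apply: le_trans (Im_le_cabs _); exact: ler_norm. Qed.

Lemma res_sub_z A z z' : hermitian A -> complex.Im z != 0 -> complex.Im z' != 0 ->
  res A z - res A z' = (z - z') *: (res A z *m res A z').
Proof.
move=> hA z0 z0'.
have -> : res A z - res A z' = res A z *m ((A - z'%:M) - (A - z%:M)) *m res A z'.
  rewrite mulmxBr mulmxBl res_mul// mul1mx.
  by rewrite -mulmxA mul_res// mulmx1.
have -> : A - z'%:M - (A - z%:M) = (z - z')%:M.
  by rewrite opprB addrC addrA subrK raddfB.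
by rewrite mul_mx_scalar -scalemxAl.
Qed.

Lemma res_sub_A A B z : hermitian A -> hermitian B -> complex.Im z != 0 ->
  res B z = res A z - res A z *m (B - A) *m res B z.
Proof.
move=> hA hB z0.
have -> : B - A = (B - z%:M) - (A - z%:M) by rewrite opprB addrA subrK.
by rewrite mulmxBr mulmxBl res_mul// -mulmxA mul_res// mulmx1 mul1mx opprB addrC subrK.
Qed.

Lemma res_sub_A' A B z : hermitian A -> hermitian B -> complex.Im z != 0 ->
  res B z = res A z - res B z *m (B - A) *m res A z.
Proof.
move=> hA hB z0.
have -> : B - A = (B - z%:M) - (A - z%:M) by rewrite opprB addrA subrK.
by rewrite mulmxBr mulmxBl res_mul// -mulmxA mul_res// mulmx1 mul1mx opprB addrC subrK.
Qed.

(** The two outer resolvents are those of [A]; [B] occurs only between two copies of B - A. When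
    these live on the rows and columns i and j, only a 2 by 2 block of the new resolvent has to be
    controlled. *)
Lemma res_expand A B z : hermitian A -> hermitian B -> complex.Im z != 0 ->
  res B z = res A z - res A z *m (B - A) *m res A z
    + res A z *m (B - A) *m res B z *m (B - A) *m res A z.
Proof.
move=> hA hB z0; rewrite {1}(res_sub_A hA hB z0) {1}(res_sub_A' hA hB z0).
by rewrite mulmxBr opprB !mulmxA addrA addrAC.
Qed.

Lemma qf_res_mul A z v : hermitian A -> complex.Im z != 0 ->
  dotc v (A *m (res A z *m v)) = (nrm2 v)%:C + z * qf A z v v.
Proof.
move=> hA z0.
have -> : A *m (res A z *m v) = v + z *: (res A z *m v).
  apply/eqP; rewrite -subr_eq -mul_scalar_mx -mulmxBl mulmxA mul_res// mul1mx //.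
by rewrite dotcDr dotcZr dotcxx.
Qed.

End Resolvent.

(** * Measurability and moments *)

Section Measurability.
Variables (d : measure_display) (T : measurableType d) (R : realType).
Implicit Types f g : T -> R.
Implicit Types F G : T -> R[i].

Definition cmeas F := measurable_fun setT (fun x => complex.Re (F x)) /\
  measurable_fun setT (fun x => complex.Im (F x)).

(** The inverse is continuous off 0, and at 0 it takes its conventional value on a measurable
    point. *)
Lemma measurable_invr : measurable_fun [set: R] (@GRing.inv R).
Proof.
have -> : [set: R] = [set x : R | x != 0] `|` [set 0].
  by apply/seteqP; split => x _ //=; case: (eqVneq x 0) => h; [right|left].
have oD : open [set x : R | x != 0].
  have -> : [set x : R | x != 0] = ~` [set 0].
    by apply/seteqP; split => x /=; [move=> /eqP|move=> h; apply/eqP].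
  by apply: closed_openC; exact: closed_eq.
apply/measurable_funU => //; first exact: measurable_realfun.open_measurable.
split; last exact: measurable_fun_set1.
apply: open_continuous_measurable_fun => // x.
by rewrite inE /=; exact: inv_continuous.
Qed.

Lemma cmeas_cst c : cmeas (fun=> c).
Proof. by split; exact: measurable_cst. Qed.

Lemma cmeasD F G : cmeas F -> cmeas G -> cmeas (fun x => F x + G x).
Proof.
move=> [f1 f2] [g1 g2]; split.
  by under eq_fun do rewrite cReD; exact: measurable_funD.
by under eq_fun do rewrite cImD; exact: measurable_funD.
Qed.

Lemma cmeasN F : cmeas F -> cmeas (fun x => - F x).
Proof.
move=> [f1 f2]; split.
  by under eq_fun do rewrite cReN; exact: measurable_funN.
by under eq_fun do rewrite cImN; exact: measurable_funN.
Qed.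

Lemma cmeasB F G : cmeas F -> cmeas G -> cmeas (fun x => F x - G x).
Proof. by move=> hF hG; apply: cmeasD => //; exact: cmeasN. Qed.

Lemma cmeasJ F : cmeas F -> cmeas (fun x => conjc (F x)).
Proof.
move=> [f1 f2]; split; first by under eq_fun do rewrite cReJ.
by under eq_fun do rewrite cImJ; exact: measurable_funN.
Qed.

Lemma cmeasM F G : cmeas F -> cmeas G -> cmeas (fun x => F x * G x).
Proof.
move=> [f1 f2] [g1 g2]; split.
  by under eq_fun do rewrite cReM; apply: measurable_funB; exact: measurable_funM.
by under eq_fun do rewrite cImM; apply: measurable_funD; exact: measurable_funM.
Qed.

Lemma measurable_cabs F : cmeas F -> measurable_fun setT (fun x => cabs (F x)).
Proof.
move=> [f1 f2]; rewrite /cabs.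
apply: (@measurableT_comp _ _ _ _ _ _ (@Num.sqrt R)).
  by apply: continuous_measurable_fun; exact: sqrt_continuous.
by apply: measurable_funD; exact: measurable_funX.
Qed.

Lemma cmeasV F : cmeas F -> cmeas (fun x => (F x)^-1).
Proof.
move=> mF; have mn := measurable_cabs mF; case: (mF) => f1 f2.
have mi : measurable_fun setT (fun x => (cabs (F x) ^+ 2)^-1).
  by apply: (measurableT_comp measurable_invr); exact: measurable_funX.
split.
  have -> : (fun x => complex.Re (F x)^-1) = (fun x => complex.Re (F x) * (cabs (F x) ^+ 2)^-1).
    by apply/funext => x; rewrite cabs_sqr; case: (F x).
  exact: measurable_funM.
have -> : (fun x => complex.Im (F x)^-1) = (fun x => - (complex.Im (F x) * (cabs (F x) ^+ 2)^-1)).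
  by apply/funext => x; rewrite cabs_sqr; case: (F x).
by apply: measurable_funN; exact: measurable_funM.
Qed.

Lemma cmeas_sum (I : Type) (s : seq I) (P : pred I) (F : I -> T -> R[i]) :
  (forall i, cmeas (F i)) -> cmeas (fun x => \sum_(i <- s | P i) F i x).
Proof.
move=> mF; elim: s => [|i s IH].
  by under eq_fun do rewrite big_nil; exact: cmeas_cst.
under eq_fun do rewrite big_cons.
by case: (P i) => //; exact: cmeasD.
Qed.

Lemma cmeas_prod (I : Type) (s : seq I) (P : pred I) (F : I -> T -> R[i]) :
  (forall i, cmeas (F i)) -> cmeas (fun x => \prod_(i <- s | P i) F i x).
Proof.
move=> mF; elim: s => [|i s IH].
  by under eq_fun do rewrite big_nil; exact: cmeas_cst.
under eq_fun do rewrite big_cons.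
by case: (P i) => //; exact: cmeasM.
Qed.

Lemma cmeasX F n : cmeas F -> cmeas (fun x => F x ^+ n).
Proof.
move=> mF; elim: n => [|n IH]; first by under eq_fun do rewrite expr0; exact: cmeas_cst.
by under eq_fun do rewrite exprS; exact: cmeasM.
Qed.

Lemma cmeas_real f : measurable_fun setT f -> cmeas (fun x => (f x)%:C%C).
Proof. by move=> mf; split => //=; exact: measurable_cst. Qed.

Lemma cmeas_det n (F : T -> 'M[R[i]]_n) : (forall i j, cmeas (fun x => F x i j)) ->
  cmeas (fun x => \det (F x)).
Proof.
move=> mF; apply: cmeas_sum => s.
by apply: cmeasM; [exact: cmeas_cst|exact: cmeas_prod].
Qed.

Lemma cmeas_adj n (F : T -> 'M[R[i]]_n) i j : (forall i j, cmeas (fun x => F x i j)) ->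
  cmeas (fun x => (\adj (F x)) i j).
Proof.
move=> mF; under eq_fun do rewrite mxE /cofactor.
apply: cmeasM; first exact: cmeas_cst.
by apply: cmeas_det => k l; under eq_fun do rewrite !mxE.
Qed.

Lemma cmeas_res n (F : T -> 'M[R[i]]_n) z i j : (forall i j, cmeas (fun x => F x i j)) ->
  cmeas (fun x => res (F x) z i j).
Proof.
move=> mF; rewrite res.unlock; under eq_fun do rewrite mxE.
have mFz k l : cmeas (fun x => (F x - z%:M) k l).
  by under eq_fun do rewrite !mxE; apply: cmeasB => //; exact: cmeas_cst.
by apply: cmeasM; [apply: cmeasV; exact: cmeas_det|exact: cmeas_adj].
Qed.

Lemma cmeas_qf n (F : T -> 'M[R[i]]_n) z x y : (forall i j, cmeas (fun w => F w i j)) ->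
  cmeas (fun w => qf (F w) z x y).
Proof.
move=> mF; apply: cmeas_sum => i; apply: cmeasM; first exact: cmeas_cst.
under eq_fun do rewrite mxE; apply: cmeas_sum => j.
by apply: cmeasM; [exact: cmeas_res|exact: cmeas_cst].
Qed.

End Measurability.

Lemma cmeas_comp (d d' : measure_display) (T : measurableType d) (T' : measurableType d')
   (R : realType) (phi : T -> T') (F : T' -> R[i]) :
  measurable_fun setT phi -> cmeas F -> cmeas (F \o phi).
Proof. by move=> mphi [f1 f2]; split; [exact: (measurableT_comp f1 mphi)|exact: (measurableT_comp f2 mphi)]. Qed.

(** * Expectations of variables with all moments *)

Section Expectation.
Variables (d : measure_display) (T : measurableType d) (R : realType).
Variable mu : {measure set T -> \bar R}.
Hypothesis mu1 : mu setT = 1%E.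
Implicit Types f g : T -> R.
Implicit Types F G : T -> R[i].

Definition EE f : R := fine (\int[mu]_x (f x)%:E).

(* Finiteness of all moments makes every random variable below integrable, and is stable
   under sums and products. *)
Definition rnice f := measurable_fun setT f /\
  forall n, mu.-integrable setT (fun x => (`|f x| ^+ n)%:E).

Definition cnice F := cmeas F /\ rnice (fun x => cabs (F x)).

Definition cE F : R[i] := Complex (EE (fun x => complex.Re (F x))) (EE (fun x => complex.Im (F x))).

Lemma rnice_dom f g : measurable_fun setT f -> rnice g ->
  (forall x, `|f x| <= `|g x|) -> rnice f.
Proof.
move=> mf [mg hg] fg; split => // n.
apply: le_integrable (hg n) => //.
  by apply/measurable_EFinP; apply: measurable_funX; apply: measurableT_comp.
move=> x _; rewrite !abse_EFin lee_fin !normrX !normr_id.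
by apply: lerXn2r; rewrite ?nnegrE ?normr_ge0.
Qed.

Lemma int_cst (c : R) : mu.-integrable setT (fun=> c%:E).
Proof.
apply/integrableP; split; first exact/measurable_EFinP.
by rewrite integral_cst// mu1 mule1 ltry.
Qed.

Lemma rnice_cst (c : R) : rnice (fun=> c).
Proof. by split => [|n]; [exact: measurable_cst|exact: int_cst]. Qed.

Lemma rnice_bounded f (c : R) : measurable_fun setT f -> (forall x, `|f x| <= c) -> rnice f.
Proof.
move=> mf fc; apply: (rnice_dom mf (rnice_cst c)) => x.
by rewrite (le_trans (fc x))// ler_norm.
Qed.

Lemma rnice_integrable f : rnice f -> mu.-integrable setT (fun x => (f x)%:E).
Proof.
move=> [mf hf]; apply: le_integrable (hf 1%N) => //; first exact/measurable_EFinP.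
by move=> x _; rewrite !abse_EFin lee_fin expr1 normr_id.
Qed.

(** Moments of a product are dominated through |f g|^n <= |f|^(2n) + |g|^(2n). *)
Lemma rniceM f g : rnice f -> rnice g -> rnice (fun x => f x * g x).
Proof.
move=> [mf hf] [mg hg]; split => [|n]; first exact: measurable_funM.
apply: (@le_integrable _ _ _ _ _ _ _
   ((fun x => (`|f x| ^+ (n * 2))%:E) \+ (fun x => (`|g x| ^+ (n * 2))%:E))) => //.
- by apply/measurable_EFinP; apply: measurable_funX; apply: measurableT_comp => //; exact: measurable_funM.
- move=> x _ /=; rewrite -?EFinD ?abse_EFin lee_fin normrX normr_id; apply: le_trans (ler_norm _).
  rewrite normrM exprMn !exprM; set a := _ ^+ n; set b := `|g x| ^+ n.
  have a0 : 0 <= a by rewrite exprn_ge0.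
  have b0 : 0 <= b by rewrite exprn_ge0.
  nra.
- by apply: integrableD.
Qed.

Lemma expr_addr_le (a b : R) n : 0 <= a -> 0 <= b ->
  (a + b) ^+ n <= 2 ^+ n * (a ^+ n + b ^+ n).
Proof.
move=> a0 b0.
have h c : 0 <= c -> a <= c -> b <= c -> (a + b) ^+ n <= 2 ^+ n * c ^+ n.
  move=> c0 ac bc; rewrite -exprMn; apply: lerXn2r; rewrite ?nnegrE ?addr_ge0 ?mulr_ge0//.
  by rewrite mulr2n mulrDl mul1r lerD.
have [ab|/ltW ab] := leP a b.
  by rewrite (le_trans (h b _ _ _))// ler_wpM2l ?exprn_ge0// lerDr exprn_ge0.
by rewrite (le_trans (h a _ _ _))// ler_wpM2l ?exprn_ge0// lerDl exprn_ge0.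
Qed.

Lemma rniceD f g : rnice f -> rnice g -> rnice (fun x => f x + g x).
Proof.
move=> [mf hf] [mg hg]; split => [|n]; first exact: measurable_funD.
apply: (@le_integrable _ _ _ _ _ _ _
   (fun x => (2 ^+ n)%:E * ((`|f x| ^+ n)%:E + (`|g x| ^+ n)%:E))%E) => //.
- by apply/measurable_EFinP; apply: measurable_funX; apply: measurableT_comp => //; exact: measurable_funD.
- move=> x _ /=; rewrite -?EFinD -?EFinM ?abse_EFin lee_fin normrX normr_id; apply: le_trans (ler_norm _).
  apply: le_trans (expr_addr_le _ _ _) => //.
  by apply: lerXn2r; rewrite ?nnegrE ?addr_ge0// ler_normD.
- by apply: integrableZl => //; exact: integrableD.
Qed.

Lemma rnice_sum (I : Type) (s : seq I) (P : pred I) (f : I -> T -> R) :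
  (forall i, rnice (f i)) -> rnice (fun x => \sum_(i <- s | P i) f i x).
Proof.
move=> mF; elim: s => [|i s IH].
  by under eq_fun do rewrite big_nil; exact: rnice_cst.
under eq_fun do rewrite big_cons.
by case: (P i) => //; exact: rniceD.
Qed.

Lemma rniceX f n : rnice f -> rnice (fun x => f x ^+ n).
Proof.
move=> mF; elim: n => [|n IH]; first by under eq_fun do rewrite expr0; exact: rnice_cst.
by under eq_fun do rewrite exprS; exact: rniceM.
Qed.

Lemma rnice_indic (A : set T) : measurable A -> rnice (\1_A).
Proof.
move=> mA; apply: (@rnice_bounded _ 1); first exact: measurable_indic.
by move=> x; rewrite indicE; case: (_ \in _); rewrite ?normr1 ?normr0.
Qed.

Lemma EED f g : rnice f -> rnice g -> EE (fun x => f x + g x) = EE f + EE g.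
Proof. by move=> hf hg; apply: RintegralD => //; exact: rnice_integrable. Qed.

Lemma EEZ f c : rnice f -> EE (fun x => c * f x) = c * EE f.
Proof. by move=> hf; apply: RintegralZl => //; exact: rnice_integrable. Qed.

Lemma EE_cst c : EE (fun=> c) = c.
Proof. by rewrite /EE integral_cst// mu1 mule1. Qed.

Lemma EEN f : rnice f -> EE (fun x => - f x) = - EE f.
Proof. by move=> hf; under [in LHS]eq_fun do rewrite -mulN1r; rewrite EEZ// mulN1r. Qed.

Lemma rniceN f : rnice f -> rnice (fun x => - f x).
Proof. by move=> hf; under eq_fun do rewrite -mulN1r; apply: rniceM => //; exact: rnice_cst. Qed.

Lemma EE_le f g : rnice f -> rnice g -> (forall x, f x <= g x) -> EE f <= EE g.
Proof. by move=> hf hg fg; apply: le_Rintegral => //; exact: rnice_integrable. Qed.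

Lemma EE_ge0 f : (forall x, 0 <= f x) -> 0 <= EE f.
Proof. by move=> f0; exact: Rintegral_ge0. Qed.

Lemma EE_sum (I : Type) (s : seq I) (P : pred I) (f : I -> T -> R) :
  (forall i, rnice (f i)) ->
  EE (fun x => \sum_(i <- s | P i) f i x) = \sum_(i <- s | P i) EE (f i).
Proof.
move=> mF; elim: s => [|i s IH].
  by under eq_fun do rewrite big_nil; rewrite big_nil EE_cst.
under eq_fun do rewrite big_cons.
rewrite big_cons; case: (P i) => //; rewrite EED ?IH//; exact: rnice_sum.
Qed.

Lemma EE_indic (A : set T) : measurable A -> EE (\1_A) = fine (mu A).
Proof. by move=> mA; rewrite /EE integral_indic// setIT. Qed.

Lemma fine_EE f : rnice f -> (\int[mu]_x (f x)%:E = (EE f)%:E)%E.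
Proof. by move=> hf; rewrite /EE fineK//; apply: integrable_fin_num => //; exact: rnice_integrable. Qed.

Lemma markov_EE f (A : set T) (c : R) : 0 < c -> rnice f -> (forall x, 0 <= f x) ->
  measurable A -> (forall x, A x -> c <= f x) -> fine (mu A) <= c^-1 * EE f.
Proof.
move=> c0 hf f0 mA Af; rewrite -EE_indic// -EEZ//.
apply: EE_le => [||x]; first exact: rnice_indic.
  by apply: rniceM => //; exact: rnice_cst.
rewrite indicE; case: (boolP (x \in A)) => [/[!inE] /Af h|_] /=; last first.
  by rewrite mulr_ge0// invr_ge0 ltW.
by rewrite mulrC ler_pdivlMr// mul1r.
Qed.

Lemma rnice_Re F : cnice F -> rnice (fun x => complex.Re (F x)).
Proof.
move=> [[m1 m2] hF]; apply: (rnice_dom m1 hF) => x.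
by rewrite (ger0_norm (cabs_ge0 _)) Re_le_cabs.
Qed.

Lemma rnice_Im F : cnice F -> rnice (fun x => complex.Im (F x)).
Proof.
move=> [[m1 m2] hF]; apply: (rnice_dom m2 hF) => x.
by rewrite (ger0_norm (cabs_ge0 _)) Im_le_cabs.
Qed.

Lemma rnice_cabs F : cnice F -> rnice (fun x => cabs (F x)).
Proof. by case. Qed.

Lemma cnice_dom F f : cmeas F -> rnice f -> (forall x, cabs (F x) <= `|f x|) -> cnice F.
Proof.
move=> mF hf h; split => //; apply: (rnice_dom (measurable_cabs mF) hf) => x.
by rewrite (ger0_norm (cabs_ge0 _)).
Qed.

Lemma cnice_cst c : cnice (fun=> c).
Proof. by split; [exact: cmeas_cst|exact: rnice_cst]. Qed.

Lemma cnice_bounded F (c : R) : cmeas F -> (forall x, cabs (F x) <= c) -> cnice F.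
Proof.
move=> mF h; apply: (cnice_dom mF (rnice_cst c)) => x.
by rewrite (le_trans (h x))// ler_norm.
Qed.

Lemma cniceD F G : cnice F -> cnice G -> cnice (fun x => F x + G x).
Proof.
move=> [mF hF] [mG hG]; apply: (cnice_dom (cmeasD mF mG) (rniceD hF hG)) => x.
by rewrite (le_trans (cabsD _ _))// ler_norm.
Qed.

Lemma cniceM F G : cnice F -> cnice G -> cnice (fun x => F x * G x).
Proof.
move=> [mF hF] [mG hG]; apply: (cnice_dom (cmeasM mF mG) (rniceM hF hG)) => x.
by rewrite cabsM ler_norm.
Qed.

Lemma cniceN F : cnice F -> cnice (fun x => - F x).
Proof.
move=> [mF hF]; apply: (cnice_dom (cmeasN mF) hF) => x.
by rewrite cabsN ler_norm.
Qed.

Lemma cniceB F G : cnice F -> cnice G -> cnice (fun x => F x - G x).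
Proof. by move=> hF hG; apply: cniceD => //; exact: cniceN. Qed.

Lemma cniceJ F : cnice F -> cnice (fun x => conjc (F x)).
Proof.
move=> [mF hF]; apply: (cnice_dom (cmeasJ mF) hF) => x.
by rewrite cabsJ ler_norm.
Qed.

Lemma cnice_sum (I : Type) (s : seq I) (P : pred I) (F : I -> T -> R[i]) :
  (forall i, cnice (F i)) -> cnice (fun x => \sum_(i <- s | P i) F i x).
Proof.
move=> mF; elim: s => [|i s IH].
  by under eq_fun do rewrite big_nil; exact: cnice_cst.
under eq_fun do rewrite big_cons.
by case: (P i) => //; exact: cniceD.
Qed.

Lemma cniceX F n : cnice F -> cnice (fun x => F x ^+ n).
Proof.
move=> mF; elim: n => [|n IH]; first by under eq_fun do rewrite expr0; exact: cnice_cst.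
by under eq_fun do rewrite exprS; exact: cniceM.
Qed.

Lemma cED F G : cnice F -> cnice G -> cE (fun x => F x + G x) = cE F + cE G.
Proof.
move=> hF hG; apply: complex_ext; rewrite ?cReD ?cImD /=.
  by under eq_fun do rewrite cReD; rewrite EED//; exact: rnice_Re.
by under eq_fun do rewrite cImD; rewrite EED//; exact: rnice_Im.
Qed.

Lemma cEZ F c : cnice F -> cE (fun x => c * F x) = c * cE F.
Proof.
move=> hF; have hr := rnice_Re hF; have hi := rnice_Im hF.
have hZ (a : R) f : rnice f -> rnice (fun x => a * f x).
  by move=> hf; apply: rniceM => //; exact: rnice_cst.
apply: complex_ext; rewrite ?cReM ?cImM /=.
  under eq_fun do rewrite cReM.
  by rewrite EED ?EEN ?EEZ//; [exact: hZ|exact: hZ|apply: rniceN; exact: hZ].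
under eq_fun do rewrite cImM.
by rewrite EED ?EEZ//; exact: hZ.
Qed.

Lemma cEB F G : cnice F -> cnice G -> cE (fun x => F x - G x) = cE F - cE G.
Proof.
move=> hF hG; rewrite (cED hF (cniceN hG)); congr (_ + _).
have -> : (fun x => - G x) = (fun x => -1 * G x) by apply/funext => x; rewrite mulN1r.
by rewrite cEZ// mulN1r.
Qed.

Lemma cE_cst c : cE (fun=> c) = c.
Proof. by rewrite /cE !EE_cst; case: c. Qed.

Lemma cE_sum (I : Type) (s : seq I) (P : pred I) (F : I -> T -> R[i]) :
  (forall i, cnice (F i)) ->
  cE (fun x => \sum_(i <- s | P i) F i x) = \sum_(i <- s | P i) cE (F i).
Proof.
move=> mF; elim: s => [|i s IH].
  by under eq_fun do rewrite big_nil; rewrite big_nil cE_cst.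
under eq_fun do rewrite big_cons.
by rewrite big_cons; case: (P i) => //; rewrite cED ?IH//; exact: cnice_sum.
Qed.

Lemma cE_real f : cE (fun x => (f x)%:C%C) = (EE f)%:C%C.
Proof. by apply: complex_ext => //=; rewrite EE_cst. Qed.

(** Rotate by the phase of c = E F: |c|^2 is the expectation of Re (conj c F), which is at most |c|
    |F|. *)
Lemma cabs_cE F : cnice F -> cabs (cE F) <= EE (fun x => cabs (F x)).
Proof.
move=> hF; set c := cE F; have hE : 0 <= EE (fun x => cabs (F x)) by apply: EE_ge0 => x; exact: cabs_ge0.
case: (eqVneq c 0) => [->|c0]; first by rewrite cabs0.
have cp : 0 < cabs c by rewrite cabs_gt0.
have hcF : cnice (fun x => conjc c * F x) by exact: (cniceM (cnice_cst _) hF).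
rewrite -(ler_pM2l cp).
have -> : cabs c * cabs c = EE (fun x => complex.Re (conjc c * F x)).
  have : complex.Re (cE (fun x => conjc c * F x)) = cabs c ^+ 2.
    by rewrite cEZ// -/c mulrC cabs_mulJ.
  by rewrite expr2 => <-.
rewrite -EEZ; last exact: (rnice_cabs hF).
apply: EE_le; [exact: rnice_Re|by apply: rniceM; [exact: rnice_cst|exact: (rnice_cabs hF)]|].
move=> x; rewrite (le_trans (ler_norm _))// (le_trans (Re_le_cabs _))//.
by rewrite cabsM cabsJ.
Qed.

End Expectation.

(** * Resampling one entry *)

Section MatrixSpace.
Variables (R : realType) (N : nat).

(** A fresh name for the matrix type, to carry the sigma-algebra generated by rectangles in the
    entries; the law of H is then a measure on [mspace]. *)
Definition cmat := 'M[R[i]]_N.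
HB.instance Definition _ := Choice.on cmat.
HB.instance Definition _ := isPointed.Build cmat (0 : 'M[R[i]]_N).

Definition mrect (S : 'I_N -> 'I_N -> set (R * R)%type) : set cmat :=
  [set A | forall i j, S i j (c2p ((A : 'M[R[i]]_N) i j))].

Definition mrects : set (set cmat) :=
  [set X | exists2 S, (forall i j, measurable (S i j)) & X = mrect S].

Definition mspace := g_sigma_algebraType mrects.

Lemma mrects_setI : setI_closed mrects.
Proof.
move=> _ _ [S mS ->] [S' mS' ->]; exists (fun i j => S i j `&` S' i j).
  by move=> i j; exact: measurableI.
by apply/seteqP; split => [A [h1 h2] i j|A h]; [split|split => i j; case: (h i j)].
Qed.

Lemma mrects_setT : mrects setT.
Proof. by exists (fun _ _ => setT) => //; apply/seteqP. Qed.

Lemma c2p_meas (d : measure_display) (T : measurableType d) (F : T -> R[i]) :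
  measurable_fun setT (fun w => c2p (F w)) <-> cmeas F.
Proof. by split => [/measurable_fun_pairP|h]; [|apply/measurable_fun_pairP]. Qed.

Lemma measurable_mspace (d : measure_display) (T : measurableType d) (F : T -> mspace) :
  (forall i j, cmeas (fun w => (F w : 'M[R[i]]_N) i j)) -> measurable_fun setT F.
Proof.
move=> mF; apply: (@measurability _ _ T mspace setT F mrects) => // _ [_ [S mS ->] <-].
rewrite setTI.
have -> : F @^-1` mrect S =
  \bigcap_(k in [set: 'I_N * 'I_N]) [set w | S k.1 k.2 (c2p ((F w : 'M[R[i]]_N) k.1 k.2))].
  by apply/seteqP; split => [w h [i j] _ /=|w h i j]; [exact: h|exact: (h (i, j))].
apply: fin_bigcap_measurable; first exact: finite_finset.
move=> [i j] _ /=; have /c2p_meas h := mF i j.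
by rewrite -[X in measurable X]setTI; exact: h.
Qed.

Lemma cmeas_entry i j : cmeas (fun A : mspace => (A : 'M[R[i]]_N) i j).
Proof.
apply/c2p_meas => _ Y mY; rewrite setTI; apply: sub_sigma_algebra.
exists (fun k l => if (k == i) && (l == j) then Y else setT).
  by move=> k l; case: ifP => // _; exact: measurableT.
apply/seteqP; split => [A /= h k l|A /= h].
  by case: ifP => // /andP[/eqP -> /eqP ->].
by have := h i j; rewrite !eqxx.
Qed.

Definition repl (A : 'M[R[i]]_N) (i j : 'I_N) (t : R[i]) : 'M[R[i]]_N :=
  \matrix_(k, l) if (k == i) && (l == j) then t
     else if (k == j) && (l == i) then conjc t else A k l.

Lemma repl_herm A i j t : hermitian A -> (i = j -> conjc t = t) -> hermitian (repl A i j t).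
Proof.
move=> hA ht k l; rewrite !mxE [X in if X then _ else _]andbC.
rewrite [X in if _ then _ else if X then _ else _]andbC.
case: (boolP ((k == i) && (l == j))) => [/andP[/eqP -> /eqP ->]|_].
  case: (boolP ((i == j) && (j == i))) => [/andP[/eqP ij _]|_] //.
  by rewrite ht.
by case: ifP => _; rewrite ?conjcK// hA.
Qed.

Definition entry_indep (d : measure_display) (T : measurableType d) (P : probability T R)
    (H : T -> 'M[R[i]]_N) :=
  forall A : 'I_N -> 'I_N -> set (R * R)%type, (forall i j, measurable (A i j)) ->
    P (\bigcap_(k in [set k : 'I_N * 'I_N | (k.1 <= k.2)%N])
         [set w | c2p (H w k.1 k.2) \in A k.1 k.2]) =
    (\prod_(k : 'I_N * 'I_N | (k.1 <= k.2)%N) P [set w | c2p (H w k.1 k.2) \in A k.1 k.2])%E.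

End MatrixSpace.

(** * Replacing one entry preserves the law of H *)

Section Resampling.
Variables (R : realType) (N : nat) (d : measure_display) (T : measurableType d).
Variables (P : probability T R) (H : T -> 'M[R[i]]_N).
Hypothesis Hh : forall w, hermitian (H w).
Hypothesis Hm : forall i j, cmeas (fun w => H w i j).
Hypothesis Hi : entry_indep P H.

Local Notation PP := (P \x P)%E.

(** On the product space the second coordinate supplies the independent copy of one entry, the first
    all the others. *)
Definition Hrepl i j (w : T * T) : 'M[R[i]]_N := repl (H w.1) i j (H w.2 i j).

Lemma Hrepl_herm i j w : hermitian (Hrepl i j w).
Proof. by apply: repl_herm => [|->]; [exact: Hh|rewrite -Hh]. Qed.

Lemma cmeas_H : measurable_fun setT (H : T -> mspace R N).
Proof. exact: measurable_mspace. Qed.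

Lemma cmeas_fst (F : T -> R[i]) : cmeas F -> cmeas (fun w : T * T => F w.1).
Proof. by move=> mF; apply: (cmeas_comp _ mF); exact: measurable_fst. Qed.

Lemma cmeas_snd (F : T -> R[i]) : cmeas F -> cmeas (fun w : T * T => F w.2).
Proof. by move=> mF; apply: (cmeas_comp _ mF); exact: measurable_snd. Qed.

Lemma cmeas_Hrepl_entry i j k l : cmeas (fun w => Hrepl i j w k l).
Proof.
under eq_fun do rewrite mxE.
case: (_ && _); first exact: (cmeas_snd (Hm i j)).
case: (_ && _); last exact: (cmeas_fst (Hm k l)).
by apply: cmeasJ; exact: (cmeas_snd (Hm i j)).
Qed.

Lemma cmeas_Hrepl i j : measurable_fun setT (Hrepl i j : T * T -> mspace R N).
Proof. by apply: measurable_mspace => k l; exact: cmeas_Hrepl_entry. Qed.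

Definition conjp (p : (R * R)%type) : (R * R)%type := (p.1, - p.2).

Lemma measurable_conjp : measurable_fun setT conjp.
Proof.
apply/measurable_fun_pairP; split; first exact: measurable_fst.
apply: measurable_funN; exact: measurable_snd.
Qed.

(** Independence is only given for the upper triangle, so the condition on the entry (l, k) is
    moved, conjugated, to (k, l). *)
Definition symrect (S : 'I_N -> 'I_N -> set (R * R)%type) k l := S k l `&` conjp @^-1` (S l k).

Lemma measurable_symrect S : (forall k l, measurable (S k l)) -> forall k l, measurable (symrect S k l).
Proof.
move=> mS k l; apply: measurableI => //.
by rewrite -[X in measurable X]setTI; exact: measurable_conjp.
Qed.

Lemma mrect_symrect S (A : 'M[R[i]]_N) : hermitian A ->
  mrect S A <-> forall k l : 'I_N, (k <= l)%N -> symrect S k l (c2p (A k l)).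
Proof.
move=> hA; split => [h k l _|h k l].
  split; first exact: h.
  by have := h l k; rewrite hA; case: (A k l).
have [/h[]//|/ltnW/h[_]] := leqP k l.
by rewrite /= (hA l k); case: (A l k) => a b /=; rewrite /conjp /c2p /=.
Qed.

Lemma measurable_entry_set k l (B : set (R * R)%type) : measurable B ->
  measurable [set w | B (c2p (H w k l))].
Proof.
move=> mB; have /c2p_meas h := Hm k l.
by rewrite -[X in measurable X]setTI; exact: h.
Qed.

Lemma prob_symrect (B : 'I_N -> 'I_N -> set (R * R)%type) : (forall k l, measurable (B k l)) ->
  P [set w | forall k l : 'I_N, (k <= l)%N -> B k l (c2p (H w k l))] =
  (\prod_(k : 'I_N * 'I_N | (k.1 <= k.2)%N) P [set w | B k.1 k.2 (c2p (H w k.1 k.2))])%E.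
Proof.
move=> mB; have := Hi mB.
have -> : (\bigcap_(k in [set k : 'I_N * 'I_N | (k.1 <= k.2)%N])
         [set w | c2p (H w k.1 k.2) \in B k.1 k.2]) =
   [set w | forall k l : 'I_N, (k <= l)%N -> B k l (c2p (H w k l))].
  apply/seteqP; split => [w h k l kl|w h [k l] kl]; last by rewrite /= inE; exact: h.
  by have := h (k, l) kl; rewrite /= inE.
move=> ->; apply: eq_bigr => k _; congr (P _).
by apply/seteqP; split => w /=; rewrite inE.
Qed.

Lemma measurable_symset (B : 'I_N -> 'I_N -> set (R * R)%type) : (forall k l, measurable (B k l)) ->
  measurable [set w | forall k l : 'I_N, (k <= l)%N -> B k l (c2p (H w k l))].
Proof.
move=> mB.
have -> : [set w | forall k l : 'I_N, (k <= l)%N -> B k l (c2p (H w k l))] =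
   \bigcap_(k in [set k : 'I_N * 'I_N | (k.1 <= k.2)%N]) [set w | B k.1 k.2 (c2p (H w k.1 k.2))].
  by apply/seteqP; split => [w h [k l] kl|w h k l kl]; [exact: h|exact: (h (k, l))].
apply: fin_bigcap_measurable; first exact: finite_finset.
by move=> [k l] _; exact: measurable_entry_set.
Qed.

Lemma Hrepl_upper i j w (k l : 'I_N) : (k <= l)%N ->
  Hrepl i j w k l = if ((k == i) && (l == j)) || ((k == j) && (l == i))
                    then H w.2 k l else H w.1 k l.
Proof.
move=> kl; rewrite mxE.
case: (boolP ((k == i) && (l == j))) => [/andP[/eqP -> /eqP ->]//|_] /=.
by case: ifP => // /andP[/eqP -> /eqP ->]; rewrite -Hh.
Qed.

(** The preimage of a rectangle is a product set: the first coordinate bears the conditions on the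
    unchanged entries, the second the condition on the new one. Independence factors both
    probabilities into the same product. *)
Lemma law_Hrepl i j (S : 'I_N -> 'I_N -> set (R * R)%type) : (forall k l, measurable (S k l)) ->
  PP (Hrepl i j @^-1` mrect S) = P (H @^-1` mrect S).
Proof.
move=> mS; pose B := symrect S; have mB := measurable_symrect mS.
(* The position of the replaced entry in the upper triangle. *)
pose i0 := if (i <= j)%N then i else j; pose j0 := if (i <= j)%N then j else i.
have ij0 : (i0 <= j0)%N by rewrite /i0 /j0; case ij: (i <= j)%N => //; rewrite ltnW// ltnNge ij.
have up (k l : 'I_N) : (k <= l)%N -> 
   ((k == i) && (l == j)) || ((k == j) && (l == i)) = ((k == i0) && (l == j0)).
  move=> kl; rewrite /i0 /j0; case ij: (i <= j)%N.
    case: (boolP ((k == j) && (l == i))) => [/andP[/eqP kj /eqP li]|]; rewrite ?orbF//.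
    have e : i = j by apply: val_inj; apply/eqP; rewrite eqn_leq ij -kj -li kl.
    by rewrite kj li e eqxx.
  case: (boolP ((k == i) && (l == j))) => [/andP[/eqP ki /eqP lj]|]; rewrite ?orFb//.
  by move: kl; rewrite ki lj ij.
(* [B'] forgets the condition on the replaced entry, whose factor becomes the probability of
   [setT]. *)
pose B' k l := if (k == i0) && (l == j0) then setT else B k l.
have mB' k l : measurable (B' k l) by rewrite /B'; case: ifP => // _; exact: measurableT.
have -> : H @^-1` mrect S = [set w | forall k l : 'I_N, (k <= l)%N -> B k l (c2p (H w k l))].
  by apply/seteqP; split => w /=; rewrite mrect_symrect.
have -> : Hrepl i j @^-1` mrect S =
   [set w | forall k l : 'I_N, (k <= l)%N -> B' k l (c2p (H w k l))] `*` [set w | B i0 j0 (c2p (H w i0 j0))].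
  apply/seteqP; split => [w /=|w /= [h1 h2]].
    rewrite mrect_symrect; last exact: Hrepl_herm.
    move=> h; split => [k l kl|]; last first.
      by have := h _ _ ij0; rewrite Hrepl_upper// up// !eqxx.
    have := h _ _ kl; rewrite Hrepl_upper// up// /B'; case: ifP => //.
  rewrite mrect_symrect; last exact: Hrepl_herm.
  move=> k l kl; rewrite Hrepl_upper// up//; case: ifP => [/andP[/eqP -> /eqP ->]//|e].
  by have := h1 _ _ kl; rewrite /B' e.
set X1 := [set w | forall k l : 'I_N, (k <= l)%N -> B' k l (c2p (H w k l))].
set X2 := [set w | B i0 j0 (c2p (H w i0 j0))].
have -> : PP (X1 `*` X2) = (P X1 * P X2)%E.
  by apply: product_measure1E; [exact: measurable_symset|exact: measurable_entry_set].
rewrite {}/X1 {}/X2.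
rewrite (prob_symrect mB) (prob_symrect mB') (bigD1 (i0, j0))// [in RHS](bigD1 (i0, j0))//.
have PT : P [set w | B' (i0, j0).1 (i0, j0).2 (c2p (H w (i0, j0).1 (i0, j0).2))] = 1%E.
  rewrite -[RHS](@probability_setT _ _ _ P); congr (P _).
  by apply/seteqP; split => // w _ /=; rewrite /B' !eqxx.
rewrite PT /= mul1e muleC; congr (_ * _)%E.
apply: eq_bigr => -[k l] /= /andP[_]; rewrite xpair_eqE => /negbTE e.
by rewrite /B' e.
Qed.

Lemma PP_setT : PP setT = 1%E.
Proof.
have -> : PP setT = (P setT * P setT)%E by rewrite -setXTT; apply: product_measure1E.
by rewrite !probability_setT mul1e.
Qed.

(** Rectangles are stable under intersection and generate the sigma-algebra, so equality of the two
    laws on them extends to all measurable sets. *)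
Lemma law_Hrepl_meas i j (X : set (mspace R N)) : measurable X ->
  PP (Hrepl i j @^-1` X) = P (H @^-1` X).
Proof.
pose m1 := measure_function_pushforward__canonical__measure_function_Measure PP (cmeas_Hrepl i j).
pose m2 := measure_function_pushforward__canonical__measure_function_Measure P cmeas_H.
move=> mX; suff : m1 X = m2 X by [].
have cov : \bigcup_(k : nat) (fun=> [set: mspace R N]) k = setT.
  by apply/seteqP; split => // x _; exists 0%N.
have fin (k : nat) : (m1 ((fun=> [set: mspace R N]) k) < +oo)%E.
  by rewrite /m1 /= /pushforward preimage_setT PP_setT ltry.
have eqR A : @mrects R N A -> m1 A = m2 A by move=> [S mS ->]; exact: law_Hrepl.
exact: (@measure_unique _ R (mspace R N) (@mrects R N) (fun=> setT) erefl (@mrects_setI R N)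
  (fun=> @mrects_setT R N) cov m1 m2 eqR fin X mX).
Qed.

Lemma integral_Hrepl_eq i j (f : mspace R N -> \bar R) :
  (\int[pushforward PP (Hrepl i j : T * T -> mspace R N)]_A f A =
   \int[pushforward P (H : T -> mspace R N)]_A f A)%E.
Proof.
pose m1 := measure_function_pushforward__canonical__measure_function_Measure PP (cmeas_Hrepl i j).
pose m2 := measure_function_pushforward__canonical__measure_function_Measure P cmeas_H.
by apply: (@eq_measure_integral _ _ _ setT m2 m1) => A mA _; exact: law_Hrepl_meas.
Qed.

Lemma integral_Hrepl_ge0 i j (f : mspace R N -> \bar R) : measurable_fun setT f ->
  (forall A, (0 <= f A)%E) -> (\int[PP]_w f (Hrepl i j w) = \int[P]_w f (H w))%E.
Proof.
move=> mf f0.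
have e1 := ge0_integral_pushforward (cmeas_Hrepl i j) PP measurableT mf (fun x _ => f0 x).
have e2 := ge0_integral_pushforward cmeas_H P measurableT mf (fun x _ => f0 x).
by rewrite preimage_setT in e1; rewrite preimage_setT in e2; rewrite -e1 -e2 integral_Hrepl_eq.
Qed.

Lemma rnice_Hrepl i j (f : mspace R N -> R) : measurable_fun setT f ->
  rnice P (fun w => f (H w)) -> rnice PP (fun w => f (Hrepl i j w)).
Proof.
move=> mf [_ hf]; split => [|n].
  exact: (measurableT_comp mf (cmeas_Hrepl i j)).
have mg : measurable_fun setT (fun A : mspace R N => (`|f A| ^+ n)%:E).
  by apply/measurable_EFinP; apply: measurable_funX; exact: measurableT_comp.
apply/integrableP; split.
  exact: (measurableT_comp mg (cmeas_Hrepl i j)).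
have /integrableP[_] := hf n.
under eq_integral do rewrite abse_EFin normrX normr_id.
under [in X in _ -> X]eq_integral do rewrite abse_EFin normrX normr_id.
by rewrite (integral_Hrepl_ge0 i j mg)// => A; rewrite lee_fin exprn_ge0.
Qed.

Lemma EE_Hrepl i j (f : mspace R N -> R) : measurable_fun setT f ->
  rnice P (fun w => f (H w)) -> EE PP (fun w => f (Hrepl i j w)) = EE P (fun w => f (H w)).
Proof.
move=> mf hf; have hg := rnice_Hrepl i j mf hf.
have mg : measurable_fun setT (fun A : mspace R N => (f A)%:E) by exact/measurable_EFinP.
have e1 := integral_pushforward (cmeas_Hrepl i j) mg (mu := PP) (D := setT).
have e2 := integral_pushforward cmeas_H mg (mu := P) (D := setT).
rewrite preimage_setT in e1; rewrite preimage_setT in e2.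
rewrite /EE -[in LHS]e1 ?integral_Hrepl_eq ?[in LHS]e2//; exact: rnice_integrable.
Qed.

Lemma cnice_Hrepl i j (F : mspace R N -> R[i]) : cmeas F ->
  cnice P (fun w => F (H w)) -> cnice PP (fun w => F (Hrepl i j w)).
Proof.
move=> mF [_ hF]; split; first exact: (cmeas_comp (cmeas_Hrepl i j) mF).
exact: (rnice_Hrepl i j (measurable_cabs mF)).
Qed.

Lemma cE_Hrepl i j (F : mspace R N -> R[i]) : cmeas F ->
  cnice P (fun w => F (H w)) -> cE PP (fun w => F (Hrepl i j w)) = cE P (fun w => F (H w)).
Proof.
move=> mF hF; apply: complex_ext => /=.
  by apply: (EE_Hrepl i j (f := fun A => complex.Re (F A))); [case: mF|exact: rnice_Re].
by apply: (EE_Hrepl i j (f := fun A => complex.Im (F A))); [case: mF|exact: rnice_Im].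
Qed.

End Resampling.

(** * Independence of the two coordinates *)

Section ProductSpace.
Variables (R : realType) (d : measure_display) (T : measurableType d) (P : probability T R).
Local Notation PP := (P \x P)%E.
Let P1 := probability_setT P.
Let PP1 : PP setT = 1%E := PP_setT P.

Lemma integrable_prod (f g : T -> R) : rnice P f -> rnice P g ->
  PP.-integrable setT (fun w => (f w.1 * g w.2)%:E).
Proof.
move=> [mf hf] [mg hg].
have mfg : measurable_fun setT (fun w : T * T => (f w.1 * g w.2)%:E).
  by apply/measurable_EFinP; apply: measurable_funM; apply: measurableT_comp.
apply/integrable12ltyP; first exact: mfg.
have intg : (\int[P]_y (`|g y|)%:E)%E \is a fin_num.
  by apply: integrable_fin_num => //; have := hg 1%N; apply: eq_integrable => // x _; rewrite expr1.
have e x : (\int[P]_y `|(f (x, y).1 * g (x, y).2)%:E| = (`|f x|)%:E * \int[P]_y (`|g y|)%:E)%E.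
  under eq_integral do rewrite /= normrM EFinM.
  by rewrite ge0_integralZl//; apply/measurable_EFinP; exact: measurableT_comp.
under eq_integral do rewrite e.
rewrite ge0_integralZr//; first last.
- by apply: integral_ge0 => x _; rewrite lee_fin.
- by apply/measurable_EFinP; exact: measurableT_comp.
rewrite -(fineK intg).
have intf : (\int[P]_y (`|f y|)%:E)%E \is a fin_num.
  by apply: integrable_fin_num => //; have := hf 1%N; apply: eq_integrable => // x _; rewrite expr1.
by rewrite -(fineK intf) -EFinM ltry.
Qed.

Lemma rnice_fst (f : T -> R) : rnice P f -> rnice PP (fun w => f w.1).
Proof.
move=> [mf hf]; split => [|n]; first by apply: measurableT_comp.
have h : rnice P (fun x => `|f x| ^+ n).
  split; first by apply: measurable_funX; exact: measurableT_comp.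
  move=> k; have := hf (n * k)%N; apply: eq_integrable => // x _.
  by rewrite normrX normr_id exprM.
have := integrable_prod h (rnice_cst P1 1).
by apply: eq_integrable => // w _; rewrite mulr1.
Qed.

Lemma rnice_snd (f : T -> R) : rnice P f -> rnice PP (fun w => f w.2).
Proof.
move=> [mf hf]; split => [|n]; first by apply: measurableT_comp.
have h : rnice P (fun x => `|f x| ^+ n).
  split; first by apply: measurable_funX; exact: measurableT_comp.
  move=> k; have := hf (n * k)%N; apply: eq_integrable => // x _.
  by rewrite normrX normr_id exprM.
have := integrable_prod (rnice_cst P1 1) h.
by apply: eq_integrable => // w _; rewrite mul1r.
Qed.

Lemma EE_prod (f g : T -> R) : rnice P f -> rnice P g ->
  EE PP (fun w => f w.1 * g w.2) = EE P f * EE P g.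
Proof.
move=> hf hg; rewrite /EE -integral12_prod_meas1; last exact: integrable_prod.
have e x : (\int[P]_y (f x * g y)%:E = (EE P g)%:E * (f x)%:E)%E.
  by rewrite -(fine_EE hg) muleC -integralZl//; exact: rnice_integrable.
have -> : (\int[P]_x fubini_F P (fun z : T * T => (f z.1 * g z.2)%:E) x =
    \int[P]_x ((EE P g)%:E * (f x)%:E))%E.
  by apply: eq_integral => x _; exact: e.
rewrite integralZl//; last exact: rnice_integrable.
by rewrite (fine_EE hf) -EFinM /= mulrC.
Qed.

Lemma cnice_fst (F : T -> R[i]) : cnice P F -> cnice PP (fun w => F w.1).
Proof.
move=> [mF hF]; split; last exact: (rnice_fst hF).
exact: (cmeas_fst mF).
Qed.

Lemma cnice_snd (F : T -> R[i]) : cnice P F -> cnice PP (fun w => F w.2).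
Proof.
move=> [mF hF]; split; last exact: (rnice_snd hF).
exact: (cmeas_snd mF).
Qed.

Lemma cE_prod (F G : T -> R[i]) : cnice P F -> cnice P G ->
  cE PP (fun w => F w.1 * G w.2) = cE P F * cE P G.
Proof.
move=> hF hG.
have rF := rnice_Re hF; have iF := rnice_Im hF.
have rG := rnice_Re hG; have iG := rnice_Im hG.
have h f g : rnice P f -> rnice P g -> rnice PP (fun w => f w.1 * g w.2).
  by move=> hf hg; apply: rniceM; [exact: (rnice_fst hf)|exact: (rnice_snd hg)].
have h1 := h _ _ rF rG; have h2 := h _ _ iF iG.
have h3 := h _ _ rF iG; have h4 := h _ _ iF rG; have h5 := rniceN PP1 h2.
apply: complex_ext; rewrite ?cReM ?cImM.
  transitivity (EE PP (fun w => complex.Re (F w.1) * complex.Re (G w.2)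
     + - (complex.Im (F w.1) * complex.Im (G w.2)))).
    by congr EE; apply/funext => w /=; rewrite cReM.
  by rewrite (EED h1 h5) (EEN h2) (EE_prod rF rG) (EE_prod iF iG).
transitivity (EE PP (fun w => complex.Re (F w.1) * complex.Im (G w.2)
     + complex.Im (F w.1) * complex.Re (G w.2))).
  by congr EE; apply/funext => w /=; rewrite cImM.
by rewrite (EED h3 h4) (EE_prod rF iG) (EE_prod iF rG).
Qed.

End ProductSpace.

(** * Perturbation of one entry *)

Section Perturbation.
Local Open Scope complex_scope.
Variable R : rcfType.
Variable N : nat.
Implicit Types x y u v : 'cV[R[i]]_N.
Implicit Types A B : 'M[R[i]]_N.
Implicit Types z : R[i].
Local Notation e_ := (@ebase R N).

(** The form of G^2. It arises from the derivative of m: the trace of G E_ab G is the (b, a) entry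
    of G^2. *)
Definition rf A z x y : R[i] := dotc x (res A z *m (res A z *m y)).

Definition mst A z : R[i] := (\sum_k qf A z (e_ k) (e_ k)) / N%:R.

(* With |v| = 1, the self-consistent equation for G_vv says that this is small. *)
Definition Xst A z v : R[i] := (nrm2 v)%:C + (z + mst A z) * qf A z v v.

Lemma qfDr A z x y u : qf A z x (y + u) = qf A z x y + qf A z x u.
Proof. by rewrite /qf mulmxDr dotcDr. Qed.

Lemma qfDl A z x y u : qf A z (x + y) u = qf A z x u + qf A z y u.
Proof. by rewrite /qf dotcDl. Qed.

Lemma qfZr A z x c y : qf A z x (c *: y) = c * qf A z x y.
Proof. by rewrite /qf -scalemxAr dotcZr. Qed.

Lemma qfZl A z x c y : qf A z (c *: x) y = conjc c * qf A z x y.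
Proof. by rewrite /qf dotcZl. Qed.

Lemma qf_e A z k y : qf A z (e_ k) y = (res A z *m y) k ord0.
Proof. by rewrite /qf dotc_ebase. Qed.

Lemma qf_sumr A z x (I : Type) (s : seq I) (P : pred I) (F : I -> 'cV[R[i]]_N) :
  qf A z x (\sum_(k <- s | P k) F k) = \sum_(k <- s | P k) qf A z x (F k).
Proof.
elim/big_rec2: _ => [|k y1 y2 _ <-]; last by rewrite qfDr.
by rewrite /qf mulmx0 /dotc big1// => k _; rewrite mxE mulr0.
Qed.

Lemma qf_suml A z y (I : Type) (s : seq I) (P : pred I) (F : I -> 'cV[R[i]]_N) :
  qf A z (\sum_(k <- s | P k) F k) y = \sum_(k <- s | P k) qf A z (F k) y.
Proof.
elim/big_rec2: _ => [|k y1 y2 _ <-]; last by rewrite qfDl.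
by rewrite /qf /dotc big1// => k _; rewrite mxE conjc0 mul0r.
Qed.

Lemma qf_coordr A z x y : qf A z x y = \sum_k y k ord0 * qf A z x (e_ k).
Proof. by rewrite {1}(cV_decomp y) qf_sumr; apply: eq_bigr => k _; rewrite qfZr. Qed.

Lemma qf_coordl A z x y : qf A z x y = \sum_k conjc (x k ord0) * qf A z (e_ k) y.
Proof. by rewrite {1}(cV_decomp x) qf_suml; apply: eq_bigr => k _; rewrite qfZl. Qed.

Lemma rf_sum A z x y : rf A z x y = \sum_k qf A z x (e_ k) * qf A z (e_ k) y.
Proof.
rewrite -[rf A z x y]/(qf A z x (res A z *m y)) qf_coordr; apply: eq_bigr => k _.
by rewrite mulrC qf_e.
Qed.

Lemma rf_coordl A z x y : rf A z x y = \sum_k conjc (x k ord0) * rf A z (e_ k) y.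
Proof. by rewrite -[LHS]/(qf A z x (res A z *m y)) qf_coordl. Qed.

Lemma rf_coordr A z x y : rf A z x y = \sum_k y k ord0 * rf A z x (e_ k).
Proof.
rewrite rf_sum; under eq_bigr do rewrite (qf_coordr _ _ _ y) mulr_sumr.
rewrite exchange_big; apply: eq_bigr => l _ /=; rewrite rf_sum mulr_sumr.
by apply: eq_bigr => k _; rewrite mulrCA.
Qed.

Lemma delta_mul i j (y : 'cV[R[i]]_N) : delta_mx i j *m y = y j ord0 *: e_ i.
Proof.
apply/matrixP => k l; rewrite (ord1 l) mxE (bigD1 j)// big1 => [|m mj]; last first.
  by rewrite mxE (negbTE mj) andbF mul0r.
by rewrite /= addr0 [RHS]mxE ebaseE mxE eqxx andbT mulrC.
Qed.

Lemma sum_second_order (g g' ki kj ik jk : 'I_N -> R[i]) (t t' ii ij ji jj : R[i]) :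
  (forall k, g' k = g k - (t * (ki k * jk k) + t' * (kj k * ik k))
     + (t * (ki k * (t * (ji * jk k) + t' * (jj * ik k)))
        + t' * (kj k * (t * (ii * jk k) + t' * (ij * ik k))))) ->
  \sum_k g' k = \sum_k g k
    - (t * (\sum_k jk k * ki k) + t' * (\sum_k ik k * kj k))
    + (t * (t * (ji * (\sum_k jk k * ki k)) + t' * (jj * (\sum_k ik k * ki k)))
       + t' * (t * (ii * (\sum_k jk k * kj k)) + t' * (ij * (\sum_k ik k * kj k)))).
Proof.
move=> h; rewrite !mulr_sumr -!big_split /= !mulr_sumr -!big_split /= -sumrB -big_split /=.
by apply: eq_bigr => k _; rewrite h; ring.
Qed.

Section Pair.
Variables (A B : 'M[R[i]]_N) (z : R[i]) (i j : 'I_N) (t t' : R[i]).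
Hypotheses (hA : hermitian A) (hB : hermitian B) (z0 : complex.Im z != 0).
(** In the application t' is the conjugate of t off the diagonal and 0 on it, since a diagonal entry
    is one position and not two. *)
Hypothesis BA : B - A = t *: delta_mx i j + t' *: delta_mx j i.
Local Notation q := (qf A z).
Local Notation q' := (qf B z).

Lemma qf_delta A' x w : dotc x (res A' z *m ((B - A) *m w)) =
  t * (qf A' z x (e_ i) * w j ord0) + t' * (qf A' z x (e_ j) * w i ord0).
Proof.
rewrite BA /qf; move: (res A' z) => M.
rewrite mulmxDl -!scalemxAl !delta_mul !scalerA mulmxDr -!scalemxAr dotcDr !dotcZr -!mulrA.
by congr (_ * _ + _ * _); rewrite mulrC.
Qed.

(** Exact, with the new resolvent on both sides: for x and y among e_i and e_j it is a linear system
    for the 2 by 2 block of the new resolvent. *)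
Lemma qf_expand1 x y : q' x y =
  q x y - (t * (q x (e_ i) * q' (e_ j) y) + t' * (q x (e_ j) * q' (e_ i) y)).
Proof.
by rewrite {1}/qf (res_sub_A hA hB z0) mulmxBl dotcBr -!mulmxA qf_delta !qf_e.
Qed.

(** The new resolvent survives only in the block of indices i and j; all other factors belong to
    [A]. *)
Lemma qf_expand2 x y : q' x y = q x y
  - (t * (q x (e_ i) * q (e_ j) y) + t' * (q x (e_ j) * q (e_ i) y))
  + (t * (q x (e_ i) * (t * (q' (e_ j) (e_ i) * q (e_ j) y) + t' * (q' (e_ j) (e_ j) * q (e_ i) y)))
   + t' * (q x (e_ j) * (t * (q' (e_ i) (e_ i) * q (e_ j) y) + t' * (q' (e_ i) (e_ j) * q (e_ i) y)))).
Proof.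
have E k : qf B z (e_ k) ((B - A) *m (res A z *m y)) =
    t * (q' (e_ k) (e_ i) * q (e_ j) y) + t' * (q' (e_ k) (e_ j) * q (e_ i) y).
  by rewrite {1}/qf qf_delta -!qf_e.
rewrite {1}/qf (res_expand hA hB z0) mulmxDl mulmxBl dotcDr dotcBr -!mulmxA !qf_delta -!qf_e.
by rewrite !E.
Qed.

Lemma mst_expand : mst B z = mst A z
  - (t * rf A z (e_ j) (e_ i) + t' * rf A z (e_ i) (e_ j)) / N%:R
  + (t * (t * (q' (e_ j) (e_ i) * rf A z (e_ j) (e_ i)) + t' * (q' (e_ j) (e_ j) * rf A z (e_ i) (e_ i)))
   + t' * (t * (q' (e_ i) (e_ i) * rf A z (e_ j) (e_ j)) + t' * (q' (e_ i) (e_ j) * rf A z (e_ i) (e_ j))))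
    / N%:R.
Proof.
rewrite /mst -mulrBl -mulrDl; congr (_ / _); rewrite !rf_sum.
by apply: sum_second_order => k; rewrite qf_expand2.
Qed.

End Pair.

(* Gateaux derivative of Xst in the (non-Hermitian) direction E_ab. *)
Definition dX A z v a b : R[i] :=
  - ((z + mst A z) * (qf A z v (e_ a) * qf A z (e_ b) v) + rf A z (e_ b) (e_ a) / N%:R * qf A z v v).

End Perturbation.

(** * Taylor bounds for powers of X and its conjugate *)

Section PowerTaylor.
Variable R : rcfType.
Implicit Types (x y d : R[i]) (M : R).

Lemma cabs_expr_sub x y M n : cabs x <= M -> cabs y <= M ->
  cabs (y ^+ n.+1 - x ^+ n.+1) <= n.+1%:R * M ^+ n * cabs (y - x).
Proof.
move=> xM yM; have M0 : 0 <= M := le_trans (cabs_ge0 _) xM.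
elim: n => [|n IH]; first by rewrite !expr1 expr0 mulr1 mul1r.
have -> : y ^+ n.+2 - x ^+ n.+2 = y * (y ^+ n.+1 - x ^+ n.+1) + (y - x) * x ^+ n.+1.
  by rewrite [y ^+ n.+2]exprS [x ^+ n.+2]exprS; ring.
apply: le_trans (cabsD _ _) _; rewrite !cabsM cabsX.
have h1 : cabs y * cabs (y ^+ n.+1 - x ^+ n.+1) <= M * (n.+1%:R * M ^+ n * cabs (y - x)).
  by apply: ler_pM => //; exact: cabs_ge0.
have h2 : cabs (y - x) * cabs x ^+ n.+1 <= cabs (y - x) * M ^+ n.+1.
  by apply: ler_wpM2l; [exact: cabs_ge0|apply: lerXn2r; rewrite ?nnegrE ?cabs_ge0].
apply: le_trans (lerD h1 h2) _; rewrite le_eqVlt; apply/orP; left; apply/eqP.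
by rewrite -!natr1 exprS; ring.
Qed.

Lemma cabs_expr_taylor x y M n : cabs x <= M -> cabs y <= M ->
  cabs (y ^+ n.+2 - x ^+ n.+2 - n.+2%:R * x ^+ n.+1 * (y - x)) <=
  n.+2%:R ^+ 2 * M ^+ n * cabs (y - x) ^+ 2.
Proof.
move=> xM yM; have M0 : 0 <= M := le_trans (cabs_ge0 _) xM.
elim: n => [|n IH].
  have -> : y ^+ 2 - x ^+ 2 - 2 * x ^+ 1 * (y - x) = (y - x) ^+ 2 by ring.
  by rewrite cabsX expr0 mulr1 ler_peMl ?sqr_ge0//; lra.
have -> : y ^+ n.+3 - x ^+ n.+3 - n.+3%:R * x ^+ n.+2 * (y - x) =
   y * (y ^+ n.+2 - x ^+ n.+2 - n.+2%:R * x ^+ n.+1 * (y - x)) + n.+2%:R * x ^+ n.+1 * (y - x) ^+ 2.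
  rewrite [y ^+ n.+3]exprS [x ^+ n.+3]exprS [x ^+ n.+2]exprS.
  by rewrite -!natr1; ring.
apply: le_trans (cabsD _ _) _; rewrite !cabsM !cabsX cabs_nat.
have h1 := ler_pM (cabs_ge0 _) (cabs_ge0 _) yM IH.
have h2 : n.+2%:R * cabs x ^+ n.+1 * cabs (y - x) ^+ 2 <= n.+2%:R * M ^+ n.+1 * cabs (y - x) ^+ 2.
  rewrite ler_wpM2r ?sqr_ge0// ler_wpM2l//.
  by apply: lerXn2r; rewrite ?nnegrE ?cabs_ge0.
apply: le_trans (lerD h1 h2) _.
have -> : M * (n.+2%:R ^+ 2 * M ^+ n * cabs (y - x) ^+ 2) + n.+2%:R * M ^+ n.+1 * cabs (y - x) ^+ 2
  = (n.+2%:R ^+ 2 + n.+2%:R) * (M ^+ n.+1 * cabs (y - x) ^+ 2) by rewrite [M ^+ n.+1]exprS; ring.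
have hn : n.+2%:R ^+ 2 + n.+2%:R <= n.+3%:R ^+ 2 :> R.
  by rewrite -natrX -natrD -natrX ler_nat; clear; nia.
rewrite -(mulrA (n.+3%:R ^+ 2)); apply: ler_wpM2r => //.
by rewrite mulr_ge0 ?exprn_ge0 ?sqr_ge0 ?cabs_ge0.
Qed.

(** Chosen so that x times it is |x|^(2p+6), while it stays polynomial in x and its conjugate. Both
    exponents are at least 2, so that second-order Taylor bounds apply to each factor. *)
Definition Wfun p x : R[i] := x ^+ p.+2 * conjc x ^+ p.+3.

(** The differential of [Wfun p] at x. Because of the conjugate it is only real-linear in d. *)
Definition dWfun p x d : R[i] :=
  p.+2%:R * x ^+ p.+1 * conjc x ^+ p.+3 * d + p.+3%:R * x ^+ p.+2 * conjc x ^+ p.+2 * conjc d.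

Lemma dWfunD p x d d' : dWfun p x (d + d') = dWfun p x d + dWfun p x d'.
Proof. by rewrite /dWfun rmorphD /=; ring. Qed.

Lemma mul_Wfun p x : x * Wfun p x = (cabs x ^+ (2 * p + 6))%:C%C.
Proof.
have -> : x * Wfun p x = (x * conjc x) ^+ p.+3 by rewrite /Wfun mulrA -exprS -exprMn.
by rewrite cabs_mulJ -rmorphXn -exprM; congr ((_ ^+ _)%:C%C); lia.
Qed.

Lemma cabs_Wfun p x : cabs (Wfun p x) = cabs x ^+ (2 * p + 5).
Proof. by rewrite cabsM !cabsX cabsJ -exprD; congr (_ ^+ _); lia. Qed.

Lemma cabs_mul3 a b x : cabs (a * b * x) = cabs a * cabs b * cabs x.
Proof. by rewrite cabsM (cabsM a). Qed.

Lemma cabs_mul4 a b x y : cabs (a * b * x * y) = cabs a * (cabs b * cabs x) * cabs y.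
Proof. by rewrite cabsM -(mulrA a) (cabsM a) (cabsM b). Qed.

Lemma cabs_dWfun p x d M : cabs x <= M ->
  cabs (dWfun p x d) <= (2 * p + 6)%:R * M ^+ (2 * p + 4) * cabs d.
Proof.
move=> xM; have M0 : 0 <= M := le_trans (cabs_ge0 _) xM.
apply: le_trans (cabsD _ _) _; rewrite !cabs_mul4 4!cabsX !cabsJ !cabs_nat -!exprD.
have -> : (p.+1 + p.+3 = 2 * p + 4)%N by clear; lia.
have -> : (p.+2 + p.+2 = 2 * p + 4)%N by clear; lia.
rewrite -!mulrDl ler_wpM2r ?cabs_ge0//.
apply: ler_pM.
- by rewrite -natrD ler0n.
- by rewrite exprn_ge0 ?cabs_ge0.
- by rewrite -natrD ler_nat; clear; lia.
- by apply: lerXn2r; rewrite ?nnegrE ?cabs_ge0.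
Qed.

Lemma Wfun_diff p x y M : cabs x <= M -> cabs y <= M ->
  cabs (Wfun p y - Wfun p x) <= (2 * p + 6)%:R * M ^+ (2 * p + 4) * cabs (y - x).
Proof.
move=> xM yM; have M0 : 0 <= M := le_trans (cabs_ge0 _) xM.
have -> : Wfun p y - Wfun p x = (y ^+ p.+2 - x ^+ p.+2) * conjc y ^+ p.+3 +
   x ^+ p.+2 * (conjc y ^+ p.+3 - conjc x ^+ p.+3) by rewrite /Wfun; ring.
apply: le_trans (cabsD _ _) _.
rewrite (cabsM (y ^+ p.+2 - x ^+ p.+2)) (cabsM (x ^+ p.+2)) 2!cabsX cabsJ.
have xJ : cabs (conjc x) <= M by rewrite cabsJ.
have yJ : cabs (conjc y) <= M by rewrite cabsJ.
have h1 := cabs_expr_sub p.+1 xM yM.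
have h2 := cabs_expr_sub p.+2 xJ yJ.
rewrite -rmorphB cabsJ in h2.
have e1 : cabs y ^+ p.+3 <= M ^+ p.+3 by apply: lerXn2r; rewrite ?nnegrE ?cabs_ge0.
have e2 : cabs x ^+ p.+2 <= M ^+ p.+2 by apply: lerXn2r; rewrite ?nnegrE ?cabs_ge0.
have k1 := ler_pM (cabs_ge0 _) (exprn_ge0 _ (cabs_ge0 _)) h1 e1.
have k2 := ler_pM (exprn_ge0 _ (cabs_ge0 _)) (cabs_ge0 _) e2 h2.
apply: le_trans (lerD k1 k2) _.
have -> : p.+2%:R * M ^+ p.+1 * cabs (y - x) * M ^+ p.+3 + M ^+ p.+2 * (p.+3%:R * M ^+ p.+2 * cabs (y - x))
  = (p.+2%:R + p.+3%:R) * M ^+ (2 * p + 4) * cabs (y - x).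
  have -> : (2 * p + 4 = p.+1 + p.+3)%N by clear; lia.
  by rewrite exprD !exprS; ring.
rewrite ler_wpM2r ?cabs_ge0// ler_wpM2r ?exprn_ge0//.
by rewrite -natrD ler_nat; clear; lia.
Qed.

(** Only the part x1 of the increment, linear in the change of the entry, is kept in the
    differential; x2 is already of second order and goes to the error. *)
Lemma Wfun_taylor p x y x1 x2 M : cabs x <= M -> cabs y <= M -> y - x = x1 + x2 ->
  cabs (Wfun p y - Wfun p x - dWfun p x x1) <=
  (2 * p + 6)%:R * M ^+ (2 * p + 4) * cabs x2
  + (2 * p + 6)%:R ^+ 2 * M ^+ (2 * p + 3) * cabs (y - x) ^+ 2.
Proof.
move=> xM yM yx; have M0 : 0 <= M := le_trans (cabs_ge0 _) xM.
have xJ : cabs (conjc x) <= M by rewrite cabsJ.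
have yJ : cabs (conjc y) <= M by rewrite cabsJ.
have -> : Wfun p y - Wfun p x - dWfun p x x1 =
   dWfun p x x2 + (Wfun p y - Wfun p x - dWfun p x (y - x)) by rewrite yx dWfunD; ring.
apply: le_trans (cabsD _ _) _; apply: lerD; first exact: cabs_dWfun.
have -> : Wfun p y - Wfun p x - dWfun p x (y - x) =
   (y ^+ p.+2 - x ^+ p.+2 - p.+2%:R * x ^+ p.+1 * (y - x)) * conjc y ^+ p.+3
   + (p.+2%:R * x ^+ p.+1 * (y - x)) * (conjc y ^+ p.+3 - conjc x ^+ p.+3)
   + x ^+ p.+2 * (conjc y ^+ p.+3 - conjc x ^+ p.+3
       - p.+3%:R * conjc x ^+ p.+2 * (conjc y - conjc x)).
  by rewrite /Wfun /dWfun rmorphB /=; ring.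
have h1 := cabs_expr_taylor p xM yM.
have h2 := cabs_expr_sub p.+2 xJ yJ.
have h3 := cabs_expr_taylor p.+1 xJ yJ.
have eJ : cabs (conjc y - conjc x) = cabs (y - x) by rewrite -rmorphB cabsJ.
rewrite eJ in h2 h3.
have pw k (w : R[i]) : cabs w <= M -> cabs w ^+ k <= M ^+ k.
  by move=> wM; apply: lerXn2r; rewrite ?nnegrE ?cabs_ge0.
have ge k (w : R[i]) : 0 <= cabs w ^+ k by rewrite exprn_ge0 ?cabs_ge0.
have k1 := ler_pM (cabs_ge0 _) (ge p.+3 _) h1 (pw p.+3 _ yJ).
have k2 : cabs (p.+2%:R * x ^+ p.+1 * (y - x)) <= p.+2%:R * M ^+ p.+1 * cabs (y - x).
  by rewrite cabs_mul3 cabs_nat cabsX ler_wpM2r ?cabs_ge0// ler_wpM2l// pw.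
have k3 := ler_pM (cabs_ge0 _) (cabs_ge0 _) k2 h2.
have k4 := ler_pM (ge p.+2 _) (cabs_ge0 _) (pw p.+2 _ xM) h3.
apply: le_trans (cabsD _ _) _.
apply: (@le_trans _ _ ((p.+2%:R ^+ 2 * M ^+ p * cabs (y - x) ^+ 2 * M ^+ p.+3)
  + (p.+2%:R * M ^+ p.+1 * cabs (y - x) * (p.+3%:R * M ^+ p.+2 * cabs (y - x)))
  + M ^+ p.+2 * (p.+3%:R ^+ 2 * M ^+ p.+1 * cabs (y - x) ^+ 2))).
  apply: lerD; first (apply: le_trans (cabsD _ _) _; apply: lerD).
  - by rewrite cabsM cabsX.
  - by rewrite cabsM.
  - by rewrite cabsM cabsX.
have -> : p.+2%:R ^+ 2 * M ^+ p * cabs (y - x) ^+ 2 * M ^+ p.+3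
  + p.+2%:R * M ^+ p.+1 * cabs (y - x) * (p.+3%:R * M ^+ p.+2 * cabs (y - x))
  + M ^+ p.+2 * (p.+3%:R ^+ 2 * M ^+ p.+1 * cabs (y - x) ^+ 2)
  = (p.+2%:R ^+ 2 + p.+2%:R * p.+3%:R + p.+3%:R ^+ 2) * M ^+ (2 * p + 3) * cabs (y - x) ^+ 2.
  have -> : (2 * p + 3 = p + p.+3)%N by clear; lia.
  by rewrite exprD !exprS; ring.
rewrite ler_wpM2r ?sqr_ge0// ler_wpM2r ?exprn_ge0//.
by rewrite -!natrX -natrM -!natrD ler_nat; clear; nia.
Qed.

End PowerTaylor.

Section SecondOrderAlgebra.
Variable R : rcfType.
Implicit Types (x y t : R[i]).

Lemma cabs_ler_pM x y (a b : R) : cabs x <= a -> cabs y <= b -> cabs (x * y) <= a * b.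
Proof. by move=> xa yb; rewrite cabsM; apply: ler_pM => //; exact: cabs_ge0. Qed.

Lemma cabs_lerD x y (a b : R) : cabs x <= a -> cabs y <= b -> cabs (x + y) <= a + b.
Proof. by move=> xa yb; apply: le_trans (cabsD _ _) _; exact: lerD. Qed.

Lemma cabs_lerB x y (a b : R) : cabs x <= a -> cabs y <= b -> cabs (x - y) <= a + b.
Proof. by move=> xa yb; apply: le_trans (cabsB _ _) _; exact: lerD. Qed.

Lemma first_order_le (s : R) t t' x1 y1 x2 y2 : cabs t <= s -> cabs t' <= s ->
  cabs (t * (x1 * y1) + t' * (x2 * y2)) <= s * (cabs x1 * cabs y1 + cabs x2 * cabs y2).
Proof.
by move=> ts ts'; rewrite mulrDr; apply: cabs_lerD; apply: cabs_ler_pM => //; rewrite cabsM.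
Qed.

Lemma second_order_le (s c : R) t t' x1 y1 x2 y2 k1 k2 k3 k4 :
  cabs t <= s -> cabs t' <= s ->
  cabs k1 <= c -> cabs k2 <= c -> cabs k3 <= c -> cabs k4 <= c ->
  cabs (t * (x1 * (t * (k1 * y1) + t' * (k2 * y2))) + t' * (x2 * (t * (k3 * y1) + t' * (k4 * y2))))
   <= c * s ^+ 2 * ((cabs x1 + cabs x2) * (cabs y1 + cabs y2)).
Proof.
move=> ts ts' h1 h2 h3 h4.
have h k k' : cabs k <= c -> cabs k' <= c ->
    cabs (t * (k * y1) + t' * (k' * y2)) <= s * (c * (cabs y1 + cabs y2)).
  by move=> hk hk'; rewrite (mulrDr c) mulrDr; apply: cabs_lerD; apply: cabs_ler_pM => //; exact: cabs_ler_pM.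
have -> : c * s ^+ 2 * ((cabs x1 + cabs x2) * (cabs y1 + cabs y2)) =
  s * (cabs x1 * (s * (c * (cabs y1 + cabs y2)))) + s * (cabs x2 * (s * (c * (cabs y1 + cabs y2)))) by ring.
by apply: cabs_lerD; apply: cabs_ler_pM => //; apply: cabs_ler_pM => //; exact: h.
Qed.

End SecondOrderAlgebra.

(** * Sizes of the terms created by changing one entry *)

Section PairRealBounds.
Variable R : rcfType.
Variables (Gam n h : R).
Hypotheses (Gam100 : 100 <= Gam) (n_gt0 : 0 < n) (h_gt0 : 0 < h) (nh : n <= h) (hGam : h <= Gam)
  (Gamn : Gam ^+ 3 * n <= 1).

Let G0 : 0 < Gam. Proof. by apply: lt_le_trans Gam100. Qed.
Let G1 : 1 <= Gam. Proof. by apply: le_trans Gam100; rewrite ler1n. Qed.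
Let n0 := ltW n_gt0.

Lemma GamX a b : (a <= b)%N -> Gam ^+ a <= Gam ^+ b.
Proof. by move=> ab; apply: ler_weXn2l. Qed.

Lemma Gam_c1 c a : c <= 100 -> c * Gam ^+ a <= Gam ^+ a.+1.
Proof. by move=> c100; rewrite exprS ler_wpM2r ?exprn_ge0 ?(ltW G0)// (le_trans c100). Qed.

Lemma Gam_c2 c a : c <= 10000 -> c * Gam ^+ a <= Gam ^+ a.+2.
Proof.
move=> c100; rewrite !exprS mulrA ler_wpM2r ?exprn_ge0 ?(ltW G0)// (le_trans c100)//.
by have := Gam100; nra.
Qed.

Lemma Gam2n : Gam ^+ 2 * n <= 100^-1.
Proof.
have : 100 * (Gam ^+ 2 * n) <= 1.
  apply: le_trans Gamn; rewrite mulrA ler_wpM2r//; exact: Gam_c1.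
by lra.
Qed.

Lemma n_le : n <= 100^-1.
Proof. by apply: le_trans Gam2n; rewrite ler_peMl// exprn_ege1. Qed.

(** bi and bj stand for the resolvent entries between v and e_i, e_j, and nu for 1/(N Im z). The
    products bi bj and the squares are kept as such: they are small after summation, although each
    factor is only bounded by 2 Gam. *)
Variables (nu Q1 Q2 bi bj : R).
Hypotheses (nu0 : 0 <= nu) (nu1 : nu <= 1) (bi0 : 0 <= bi) (bj0 : 0 <= bj)
  (biG : bi <= 2 * Gam) (bjG : bj <= 2 * Gam).
Hypotheses (Q1E : Q1 = bi * bj) (Q2E : Q2 = bi ^+ 2 + bj ^+ 2).

Let Q10 : 0 <= Q1. Proof. by rewrite Q1E mulr_ge0. Qed.
Let Q20 : 0 <= Q2. Proof. by rewrite Q2E addr_ge0 ?sqr_ge0. Qed.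
Let Q12 : 2 * Q1 <= Q2. Proof. by rewrite Q1E Q2E; have := sqr_ge0 (bi - bj); nra. Qed.

(** Bound for the increment of an entry, the old and the new one being at most Gam n each. *)
Let s := 2 * Gam * n.

Lemma x1_real_le (zm g g1 m1 : R) : 0 <= g1 -> 0 <= m1 ->
  zm <= 2 * Gam -> g <= Gam -> g1 <= s * Q1 -> m1 <= 2 * s * Gam * nu ->
  zm * g1 + m1 * g <= Gam ^+ 4 * n * (Q1 + nu).
Proof.
move=> g10 m10 zmG gG g1s m1s.
have h1 : zm * g1 <= 2 * Gam * (s * Q1).
  by apply: le_trans (ler_wpM2l _ g1s); [rewrite ler_wpM2r|rewrite mulr_ge0// ltW].
have h2 : m1 * g <= 2 * s * Gam * nu * Gam.
  by apply: le_trans (ler_wpM2r _ m1s); [rewrite ler_wpM2l|rewrite ltW].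
apply: le_trans (lerD h1 h2) _; rewrite mulrDr; apply: lerD.
  have -> : 2 * Gam * (s * Q1) = 4 * Gam ^+ 2 * (n * Q1) by rewrite /s; ring.
  rewrite -(mulrA (Gam ^+ 4)) ler_wpM2r ?mulr_ge0//.
  by apply: le_trans (Gam_c1 2 _) (GamX _); rewrite // ler_nat.
have -> : 2 * s * Gam * nu * Gam = 4 * Gam ^+ 3 * (n * nu) by rewrite /s; ring.
rewrite -(mulrA (Gam ^+ 4)) ler_wpM2r ?mulr_ge0//.
by apply: (Gam_c1 3); rewrite ler_nat.
Qed.

Lemma x2_real_le (zm g g1 m1 g2 m2 : R) : 0 <= g1 -> 0 <= m1 -> 0 <= g2 -> 0 <= m2 ->
  zm <= 2 * Gam -> g <= Gam -> g1 <= s * Q1 -> m1 <= 2 * s * Gam * nu ->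
  g2 <= 16 * Gam * s ^+ 2 * Q2 -> m2 <= 32 * Gam ^+ 2 * s ^+ 2 * nu ->
  zm * g2 + m2 * g + (m2 + m1) * (g2 + g1) <= Gam ^+ 7 * n ^+ 2 * (Q2 + nu).
Proof.
move=> g10 m10 g20 m20 zmG gG g1s m1s g2s m2s.
have k := Gam2n; have k0 : 0 <= Gam ^+ 2 * n by rewrite mulr_ge0 ?exprn_ge0 ?(ltW G0).
have s0 : 0 <= s by rewrite /s !mulr_ge0// ltW.
have h1 : zm * g2 <= 2 * Gam * (16 * Gam * s ^+ 2 * Q2).
  by apply: le_trans (ler_wpM2l _ g2s); [rewrite ler_wpM2r|rewrite mulr_ge0// ltW].
have h2 : m2 * g <= 32 * Gam ^+ 2 * s ^+ 2 * nu * Gam.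
  by apply: le_trans (ler_wpM2r _ m2s); [rewrite ler_wpM2l|rewrite ltW].
have e1 : m2 + m1 <= 3 * s * Gam * nu.
  apply: le_trans (lerD m2s m1s) _.
  have -> : 32 * Gam ^+ 2 * s ^+ 2 * nu + 2 * s * Gam * nu =
     (64 * (Gam ^+ 2 * n) + 2) * (s * Gam * nu) by rewrite /s; ring.
  have -> : 3 * s * Gam * nu = 3 * (s * Gam * nu) by ring.
  rewrite ler_wpM2r//; last by lra.
  by rewrite !mulr_ge0// ltW.
have e2 : g2 + g1 <= s * Q2.
  apply: le_trans (lerD g2s g1s) _.
  have -> : 16 * Gam * s ^+ 2 * Q2 + s * Q1 = s * (32 * (Gam ^+ 2 * n) * Q2 + Q1) by rewrite /s; ring.
  rewrite ler_wpM2l//; have := ler_wpM2r Q20 k; have := Q12; have := Q20; lra.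
have h3 : (m2 + m1) * (g2 + g1) <= 3 * s * Gam * nu * (s * Q2).
  by apply: ler_pM => //; exact: addr_ge0.
apply: le_trans (lerD (lerD h1 h2) h3) _.
have -> : 2 * Gam * (16 * Gam * s ^+ 2 * Q2) + 32 * Gam ^+ 2 * s ^+ 2 * nu * Gam
   + 3 * s * Gam * nu * (s * Q2) =
   n ^+ 2 * (128 * Gam ^+ 4 * Q2 + 128 * Gam ^+ 5 * nu + 12 * Gam ^+ 3 * nu * Q2) by rewrite /s; ring.
have -> : Gam ^+ 7 * n ^+ 2 * (Q2 + nu) = n ^+ 2 * (Gam ^+ 7 * Q2 + Gam ^+ 7 * nu) by ring.
rewrite ler_wpM2l ?exprn_ge0//.
have b1 : 128 * Gam ^+ 4 <= Gam ^+ 6 by apply: Gam_c2; lra.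
have b2 : 128 * Gam ^+ 5 <= Gam ^+ 7 by apply: Gam_c2; lra.
have b3 : 12 * Gam ^+ 3 <= Gam ^+ 6.
  by apply: le_trans (GamX (isT : (4 <= 6)%N)); apply: Gam_c1; lra.
have b4 : 2 * Gam ^+ 6 <= Gam ^+ 7 by apply: Gam_c1; lra.
have c1 : 128 * Gam ^+ 4 * Q2 <= Gam ^+ 6 * Q2 by rewrite ler_wpM2r.
have c2 : 128 * Gam ^+ 5 * nu <= Gam ^+ 7 * nu by rewrite ler_wpM2r.
have c3 : 12 * Gam ^+ 3 * nu * Q2 <= Gam ^+ 6 * Q2.
  rewrite ler_wpM2r// -[leRHS]mulr1; apply: ler_pM => //.
  by rewrite mulr_ge0 ?exprn_ge0// ltW.
have c4 : 2 * Gam ^+ 6 * Q2 <= Gam ^+ 7 * Q2 by rewrite ler_wpM2r.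
lra.
Qed.

Let Y := Q1 + nu + n * Q2.

Let Y0 : 0 <= Y. Proof. by rewrite /Y !addr_ge0// mulr_ge0. Qed.

Lemma xsum_real_le (x1 x2 : R) : x1 <= Gam ^+ 4 * n * (Q1 + nu) -> x2 <= Gam ^+ 7 * n ^+ 2 * (Q2 + nu) ->
  x1 + x2 <= Gam ^+ 7 * n * Y.
Proof.
move=> h1 h2; apply: le_trans (lerD h1 h2) _.
have -> : Gam ^+ 4 * n * (Q1 + nu) + Gam ^+ 7 * n ^+ 2 * (Q2 + nu) =
   n * (Gam ^+ 4 * Q1 + (Gam ^+ 4 + Gam ^+ 7 * n) * nu + Gam ^+ 7 * (n * Q2)) by ring.
have -> : Gam ^+ 7 * n * Y = n * (Gam ^+ 7 * Q1 + Gam ^+ 7 * nu + Gam ^+ 7 * (n * Q2)) by rewrite /Y; ring.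
rewrite ler_wpM2l//.
have a1 : Gam ^+ 4 <= Gam ^+ 7 by exact: GamX.
have a2 : Gam ^+ 7 * n <= Gam ^+ 4.
  have -> : Gam ^+ 7 * n = Gam ^+ 4 * (Gam ^+ 3 * n) by ring.
  by rewrite -[leRHS]mulr1 ler_wpM2l// exprn_ge0// ltW.
have a3 : 2 * Gam ^+ 4 <= Gam ^+ 7.
  by apply: le_trans (GamX (isT : (5 <= 7)%N)); apply: Gam_c1; lra.
have b1 : Gam ^+ 4 * Q1 <= Gam ^+ 7 * Q1 by rewrite ler_wpM2r.
have b2 : (Gam ^+ 4 + Gam ^+ 7 * n) * nu <= Gam ^+ 7 * nu by rewrite ler_wpM2r//; lra.
lra.
Qed.

Lemma Y_le : Y <= Gam ^+ 3.
Proof.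
have nl := n_le.
have q1 : Q1 <= 4 * Gam ^+ 2.
  by rewrite Q1E; have := ler_pM bi0 bj0 biG bjG; nra.
have q2 : Q2 <= 8 * Gam ^+ 2.
  rewrite Q2E; have a : bi ^+ 2 <= (2 * Gam) ^+ 2 by apply: lerXn2r; rewrite ?nnegrE// mulr_ge0// ltW.
  have b : bj ^+ 2 <= (2 * Gam) ^+ 2 by apply: lerXn2r; rewrite ?nnegrE// mulr_ge0// ltW.
  by move: a b; rewrite !exprMn; lra.
have q3 : n * Q2 <= Q2 by rewrite ler_piMl//; lra.
have g3 : 100 * Gam ^+ 2 <= Gam ^+ 3 by exact: Gam_c1.
have g2 : 1 <= Gam ^+ 2 by apply: exprn_ege1.
rewrite /Y; have := nu1; move: (n * Q2) (Gam ^+ 2) (Gam ^+ 3) q1 q2 q3 g3 g2 => a b c q1 q2 q3 g3 g2 nu1'; lra.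
Qed.

(** Each derivative of [Wfun] lowers the power of M by one but brings a factor n = psi h. As psi <=
    M, the factor psi restores the lost power and only h is paid. *)
Lemma remainder_real_le (b b' d1 d2 y x2 W' dW eW M psi P : R) K :
  0 <= b -> 0 <= d1 -> 0 <= d2 -> 0 <= W' -> 0 <= eW -> 0 <= dW -> 0 <= y -> 0 <= x2 -> 0 < psi ->
  psi = n / h -> 0 <= P -> P <= Gam -> psi <= M ->
  b <= bj -> d1 <= Gam ^+ 3 * n * (bi + bj) -> d2 <= Gam ^+ 5 * n ^+ 2 * (bi + bj) ->
  y <= Gam ^+ 7 * n * Y -> x2 <= Gam ^+ 7 * n ^+ 2 * (Q2 + nu) ->
  W' <= M ^+ K.+2 -> dW <= P * M ^+ K.+1 * y ->
  eW <= P * M ^+ K.+1 * x2 + P ^+ 2 * M ^+ K * y ^+ 2 ->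
  d2 * W' + d1 * dW + b * eW <= Gam ^+ 16 * M ^+ K.+2 *
    (n ^+ 2 * (bi + bj) + n * h * (bi + bj) * Y + bj * (n * h * (Q2 + nu) + h ^+ 2 * Y ^+ 2)).
Proof.
move=> b0 d10 d20 W'0 eW0 dW0 y0 x20 psi0 psiE P0 PG psiM bb d1s d2s ys x2s W's dWs eWs.
have M0 : 0 < M by exact: lt_le_trans psiM.
have Gk k : 0 <= Gam ^+ k by rewrite exprn_ge0// ltW.
have hpsi : n = psi * h by rewrite psiE divfK// gt_eqF.
have MK : M ^+ K.+1 * psi <= M ^+ K.+2 by rewrite [M ^+ K.+2]exprSr ler_wpM2l// exprn_ge0// ltW.
have MK2 : M ^+ K * psi ^+ 2 <= M ^+ K.+2.
  have -> : M ^+ K.+2 = M ^+ K * M ^+ 2 by rewrite -exprD addn2.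
  apply: ler_wpM2l; first by rewrite exprn_ge0// ltW.
  by apply: lerXn2r; rewrite ?nnegrE// ltW.
have MKge : 0 <= M ^+ K.+2 by rewrite exprn_ge0// ltW.
have y2 : y ^+ 2 <= (Gam ^+ 7 * n * Y) ^+ 2.
  by apply: lerXn2r => //; rewrite nnegrE// mulr_ge0// mulr_ge0.
have bij0 : 0 <= bi + bj by exact: addr_ge0.
have Qn0 : 0 <= Q2 + nu by exact: addr_ge0.
have t1 : d2 * W' <= M ^+ K.+2 * (Gam ^+ 5 * (n ^+ 2 * (bi + bj))).
  by apply: le_trans (ler_pM d20 W'0 d2s W's) _; rewrite mulrC -!mulrA.
have t2 : d1 * dW <= M ^+ K.+2 * (Gam ^+ 11 * (n * h * (bi + bj) * Y)).
  have dW2 : dW <= Gam * M ^+ K.+1 * (Gam ^+ 7 * (psi * h) * Y).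
    apply: le_trans dWs _; rewrite -hpsi; apply: ler_pM => //.
      by rewrite mulr_ge0// exprn_ge0// ltW.
    by rewrite ler_wpM2r// exprn_ge0// ltW.
  have dW3 : dW <= M ^+ K.+2 * (Gam ^+ 8 * (h * Y)).
    apply: le_trans dW2 _.
    have -> : Gam * M ^+ K.+1 * (Gam ^+ 7 * (psi * h) * Y) = (M ^+ K.+1 * psi) * (Gam ^+ 8 * (h * Y)).
      by rewrite [Gam ^+ 8]exprS; ring.
    by rewrite ler_wpM2r// !mulr_ge0// ltW.
  apply: le_trans (ler_pM d10 dW0 d1s dW3) _.
  by rewrite le_eqVlt; apply/orP; left; apply/eqP; rewrite (exprD _ 3 8); ring.
have t3 : b * eW <= M ^+ K.+2 * (bj * (Gam ^+ 8 * (n * h * (Q2 + nu)) + Gam ^+ 16 * (h ^+ 2 * Y ^+ 2))).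
  have e1 : P * M ^+ K.+1 * x2 <= M ^+ K.+2 * (Gam ^+ 8 * (n * h * (Q2 + nu))).
    have f1 : P * M ^+ K.+1 * x2 <= Gam * M ^+ K.+1 * (Gam ^+ 7 * (n * (psi * h)) * (Q2 + nu)).
      rewrite -hpsi -expr2; apply: ler_pM => //; first by rewrite mulr_ge0// exprn_ge0// ltW.
      by rewrite ler_wpM2r// exprn_ge0// ltW.
    apply: le_trans f1 _.
    have -> : Gam * M ^+ K.+1 * (Gam ^+ 7 * (n * (psi * h)) * (Q2 + nu)) =
       (M ^+ K.+1 * psi) * (Gam ^+ 8 * (n * h * (Q2 + nu))) by rewrite [Gam ^+ 8]exprS; ring.
    by rewrite ler_wpM2r// !mulr_ge0// ltW.
  have e2 : P ^+ 2 * M ^+ K * y ^+ 2 <= M ^+ K.+2 * (Gam ^+ 16 * (h ^+ 2 * Y ^+ 2)).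
    have f1 : P ^+ 2 * M ^+ K * y ^+ 2 <= Gam ^+ 2 * M ^+ K * (Gam ^+ 7 * (psi * h) * Y) ^+ 2.
      rewrite -hpsi; apply: ler_pM => //; first by rewrite mulr_ge0 ?sqr_ge0// exprn_ge0// ltW.
        by rewrite sqr_ge0.
      rewrite ler_wpM2r ?exprn_ge0 ?(ltW M0)//.
      by apply: lerXn2r; rewrite ?nnegrE// ltW.
    apply: le_trans f1 _.
    have -> : Gam ^+ 2 * M ^+ K * (Gam ^+ 7 * (psi * h) * Y) ^+ 2 =
       (M ^+ K * psi ^+ 2) * (Gam ^+ 16 * (h ^+ 2 * Y ^+ 2)) by rewrite (exprD _ 2 14) (exprM _ 7 2); ring.
    by rewrite ler_wpM2r// !mulr_ge0// ?exprn_ge0// ltW.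
  have e3 := le_trans eWs (lerD e1 e2); rewrite -mulrDr in e3.
  by apply: le_trans (ler_pM b0 eW0 bb e3) _; rewrite mulrCA.
apply: le_trans (lerD (lerD t1 t2) t3) _.
have E10 : 0 <= n ^+ 2 * (bi + bj) by rewrite mulr_ge0 ?exprn_ge0.
have E20 : 0 <= n * h * (bi + bj) * Y by rewrite !mulr_ge0// ltW.
have E30 : 0 <= n * h * (Q2 + nu) by rewrite !mulr_ge0// ltW.
move: (n ^+ 2 * (bi + bj)) (n * h * (bi + bj) * Y) (n * h * (Q2 + nu)) (h ^+ 2 * Y ^+ 2) E10 E20 E30.
move=> E1 E2 E3 E4 E10 E20 E30.
have -> : Gam ^+ 16 * M ^+ K.+2 * (E1 + E2 + bj * (E3 + E4)) =
  M ^+ K.+2 * (Gam ^+ 16 * E1 + Gam ^+ 16 * E2 + bj * (Gam ^+ 16 * E3 + Gam ^+ 16 * E4)) by ring.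
have -> : M ^+ K.+2 * (Gam ^+ 5 * E1) + M ^+ K.+2 * (Gam ^+ 11 * E2)
   + M ^+ K.+2 * (bj * (Gam ^+ 8 * E3 + Gam ^+ 16 * E4)) =
   M ^+ K.+2 * (Gam ^+ 5 * E1 + Gam ^+ 11 * E2 + bj * (Gam ^+ 8 * E3 + Gam ^+ 16 * E4)) by ring.
rewrite ler_wpM2l// lerD// ?lerD//; try by rewrite ler_wpM2r// GamX.
by rewrite ler_wpM2l// lerD2r ler_wpM2r// GamX.
Qed.

End PairRealBounds.

(** * Summing the errors over all entries *)

Section PairSum.
Variable R : rcfType.
Variables (N : nat) (Gam n h psi nu : R) (u b : 'I_N -> R).
Hypotheses (Gam100 : 100 <= Gam) (n_gt0 : 0 < n) (h_gt0 : 0 < h) (nh : n <= h) (hGam : h <= Gam)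
  (n1 : n <= 1) (psiE : psi = n / h) (nuE : nu = psi ^+ 2) (nN : N%:R = n ^- 2).
Hypotheses (u0 : forall i, 0 <= u i) (b0 : forall i, 0 <= b i) (bG : forall i, b i <= 2 * Gam)
  (u2 : \sum_i u i ^+ 2 <= 1) (b2 : \sum_i b i ^+ 2 <= 4 * Gam / h ^+ 2).

Let G0 : 0 < Gam. Proof. by apply: lt_le_trans Gam100. Qed.
Let G1 : 1 <= Gam. Proof. by apply: le_trans Gam100; rewrite ler1n. Qed.
Let S k := \sum_i u i * b i ^+ k.
Let T l := \sum_j b j ^+ l.

Let sqrtN : Num.sqrt N%:R = n^-1.
Proof. by rewrite nN -exprVn sqrtr_sqr ger0_norm// invr_ge0 ltW. Qed.

Let sqrtb : Num.sqrt (\sum_i b i ^+ 2) <= 2 * Gam / h.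
Proof.
have -> : 2 * Gam / h = Num.sqrt ((2 * Gam / h) ^+ 2).
  by rewrite sqrtr_sqr ger0_norm// divr_ge0 ?mulr_ge0// ltW.
rewrite ler_sqrt ?sqr_ge0// (le_trans b2)// expr_div_n ler_wpM2r ?invr_ge0 ?sqr_ge0//.
by have := Gam100; nra.
Qed.

Let S0 : S 0 <= n^-1.
Proof.
rewrite /S; under eq_bigr do rewrite expr0 mulr1.
apply: le_trans (sum_le_sqrt_card _) _; rewrite sqrtN ler_piMr ?invr_ge0 ?(ltW n_gt0)//.
by rewrite -[leRHS]sqrtr1 ler_sqrt.
Qed.

Let S1 : S 1 <= 2 * Gam / h.
Proof.
rewrite /S; under eq_bigr do rewrite expr1.
apply: le_trans (sum_cauchy_schwarz_sqrt _ _) _.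
rewrite -[leRHS]mul1r; apply: ler_pM; rewrite ?sqrtr_ge0//.
by rewrite -[leRHS]sqrtr1 ler_sqrt.
Qed.

Let SS k : S k.+1 <= (2 * Gam) ^+ k * (2 * Gam / h).
Proof.
apply: le_trans (ler_wpM2l _ S1); last by rewrite exprn_ge0// mulr_ge0// ltW.
rewrite /S mulr_sumr; apply: ler_sum => i _; rewrite expr1.
have -> : u i * b i ^+ k.+1 = b i ^+ k * (u i * b i) by rewrite exprSr; ring.
rewrite ler_wpM2r ?mulr_ge0//.
by apply: lerXn2r; rewrite ?nnegrE// mulr_ge0// ltW.
Qed.

Let T0 : T 0 = n ^- 2.
Proof. by rewrite /T; under eq_bigr do rewrite expr0; rewrite sumr_const card_ord nN. Qed.

Let T1 : T 1 <= 2 * Gam / (n * h).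
Proof.
rewrite /T; under eq_bigr do rewrite expr1.
apply: le_trans (sum_le_sqrt_card _) _; rewrite sqrtN.
have -> : 2 * Gam / (n * h) = n^-1 * (2 * Gam / h) by rewrite invfM; ring.
by rewrite ler_wpM2l// invr_ge0 ltW.
Qed.

Let TT l : T l.+2 <= (2 * Gam) ^+ l * (4 * Gam / h ^+ 2).
Proof.
apply: le_trans (ler_wpM2l _ b2); last by rewrite exprn_ge0// mulr_ge0// ltW.
rewrite /T mulr_sumr; apply: ler_sum => i _; rewrite -[l.+2]addn2 exprD.
rewrite ler_wpM2r ?sqr_ge0//.
by apply: lerXn2r; rewrite ?nnegrE// mulr_ge0// ltW.
Qed.

Definition pair_err (bi bj : R) : R :=
  let Q1 := bi * bj in let Q2 := bi ^+ 2 + bj ^+ 2 in let Y := Q1 + nu + n * Q2 in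
  n ^+ 2 * (bi + bj) + n * h * (bi + bj) * Y + bj * (n * h * (Q2 + nu) + h ^+ 2 * Y ^+ 2).

(** Bounds the error by monomials bi^k bj^l, so that each double sum factors into two single
    sums. *)
Lemma pair_err_le bi bj : 0 <= bi -> 0 <= bj -> pair_err bi bj <=
  n ^+ 2 * (bi + bj) + n * h * (2 * (bi ^+ 2 * bj) + bi * bj ^+ 2 + bj ^+ 3)
  + n * h * nu * (bi + 2 * bj) + 2 * n ^+ 2 * h * (bi ^+ 3 + bj ^+ 3)
  + 3 * h ^+ 2 * (bi ^+ 2 * bj ^+ 3 + nu ^+ 2 * bj)
  + 6 * h ^+ 2 * n ^+ 2 * (bi ^+ 4 * bj + bj ^+ 5).
Proof.
move=> i0 j0; rewrite /pair_err.
have cub : (bi + bj) * (bi ^+ 2 + bj ^+ 2) <= 2 * (bi ^+ 3 + bj ^+ 3).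
  rewrite -subr_ge0.
  have -> : 2 * (bi ^+ 3 + bj ^+ 3) - (bi + bj) * (bi ^+ 2 + bj ^+ 2) = (bi + bj) * (bi - bj) ^+ 2 by ring.
  by rewrite mulr_ge0 ?sqr_ge0// addr_ge0.
have sq3 x y w : (x + y + w) ^+ 2 <= 3 * (x ^+ 2 + y ^+ 2 + w ^+ 2) :> R.
  by have := sqr_ge0 (x - y); have := sqr_ge0 (x - w); have := sqr_ge0 (y - w); nra.
have q2 : (bi ^+ 2 + bj ^+ 2) ^+ 2 <= 2 * (bi ^+ 4 + bj ^+ 4).
  rewrite -subr_ge0.
  have -> : 2 * (bi ^+ 4 + bj ^+ 4) - (bi ^+ 2 + bj ^+ 2) ^+ 2 = (bi ^+ 2 - bj ^+ 2) ^+ 2 by ring.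
  exact: sqr_ge0.
have e1 : n * h * (bi + bj) * (bi * bj + nu + n * (bi ^+ 2 + bj ^+ 2)) <=
    n * h * (bi ^+ 2 * bj + bi * bj ^+ 2) + n * h * nu * (bi + bj) + n ^+ 2 * h * (2 * (bi ^+ 3 + bj ^+ 3)).
  have -> : n * h * (bi + bj) * (bi * bj + nu + n * (bi ^+ 2 + bj ^+ 2)) =
    n * h * (bi ^+ 2 * bj + bi * bj ^+ 2) + n * h * nu * (bi + bj)
    + n ^+ 2 * h * ((bi + bj) * (bi ^+ 2 + bj ^+ 2)) by ring.
  by rewrite lerD2l ler_wpM2l// mulr_ge0 ?sqr_ge0// ltW.
have e2 : (bi * bj + nu + n * (bi ^+ 2 + bj ^+ 2)) ^+ 2 <=
   3 * (bi ^+ 2 * bj ^+ 2 + nu ^+ 2) + 6 * n ^+ 2 * (bi ^+ 4 + bj ^+ 4).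
  apply: le_trans (sq3 _ _ _) _.
  have -> : 3 * (bi ^+ 2 * bj ^+ 2 + nu ^+ 2) + 6 * n ^+ 2 * (bi ^+ 4 + bj ^+ 4) =
    3 * ((bi * bj) ^+ 2 + nu ^+ 2 + n ^+ 2 * (2 * (bi ^+ 4 + bj ^+ 4))) by ring.
  by rewrite ler_wpM2l// lerD2l [in leLHS]exprMn ler_wpM2l// sqr_ge0.
have e3 : bj * (h ^+ 2 * (bi * bj + nu + n * (bi ^+ 2 + bj ^+ 2)) ^+ 2) <=
  bj * (h ^+ 2 * (3 * (bi ^+ 2 * bj ^+ 2 + nu ^+ 2) + 6 * n ^+ 2 * (bi ^+ 4 + bj ^+ 4))).
  by rewrite ler_wpM2l// ler_wpM2l// sqr_ge0.
rewrite [bj * (_ + _)]mulrDr.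
apply: le_trans (lerD (lerD (lexx (n ^+ 2 * (bi + bj))) e1) (lerD (lexx _) e3)) _.
by rewrite le_eqVlt; apply/orP; left; apply/eqP; ring.
Qed.

Let sumST k l : \sum_i \sum_j u i * (b i ^+ k * b j ^+ l) = S k * T l.
Proof.
rewrite /S mulr_suml; apply: eq_bigr => i _; rewrite /T mulr_sumr.
by apply: eq_bigr => j _; rewrite mulrA.
Qed.

Let sum_poly : \sum_i \sum_j u i * (n ^+ 2 * (b i + b j) + n * h * (2 * (b i ^+ 2 * b j) + b i * b j ^+ 2 + b j ^+ 3)
  + n * h * nu * (b i + 2 * b j) + 2 * n ^+ 2 * h * (b i ^+ 3 + b j ^+ 3)
  + 3 * h ^+ 2 * (b i ^+ 2 * b j ^+ 3 + nu ^+ 2 * b j)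
  + 6 * h ^+ 2 * n ^+ 2 * (b i ^+ 4 * b j + b j ^+ 5)) =
  n ^+ 2 * (S 1 * T 0 + S 0 * T 1) + n * h * (2 * (S 2 * T 1) + S 1 * T 2 + S 0 * T 3)
  + n * h * nu * (S 1 * T 0 + 2 * (S 0 * T 1)) + 2 * n ^+ 2 * h * (S 3 * T 0 + S 0 * T 3)
  + 3 * h ^+ 2 * (S 2 * T 3 + nu ^+ 2 * (S 0 * T 1))
  + 6 * h ^+ 2 * n ^+ 2 * (S 4 * T 1 + S 0 * T 5).
Proof.
rewrite -!sumST.
have lin (c : R) (f : 'I_N -> 'I_N -> R) : c * (\sum_i \sum_j f i j) = \sum_i \sum_j c * f i j.
  by rewrite mulr_sumr; apply: eq_bigr => i _; rewrite mulr_sumr.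
have add (f g : 'I_N -> 'I_N -> R) : \sum_i \sum_j f i j + \sum_i \sum_j g i j = \sum_i \sum_j (f i j + g i j).
  by rewrite -big_split; apply: eq_bigr => i _; rewrite -big_split.
rewrite !(lin, add); apply: eq_bigr => i _; apply: eq_bigr => j _.
by rewrite !expr0 !expr1; ring.
Qed.

(** The sum over N^2 pairs is only of order 1/h: the weights u have norm at most 1 and the b's have
    square sum of order h^-2, so Cauchy-Schwarz applies to every factor. The size of the replaced
    entry contributes one more n and makes this n / h = psi. *)
Lemma sum_pair_err : \sum_i \sum_j u i * pair_err (b i) (b j) <= Gam ^+ 12 / h.
Proof.
apply: (@le_trans _ _ (\sum_i \sum_j u i * (n ^+ 2 * (b i + b j) + n * h * (2 * (b i ^+ 2 * b j) + b i * b j ^+ 2 + b j ^+ 3)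
  + n * h * nu * (b i + 2 * b j) + 2 * n ^+ 2 * h * (b i ^+ 3 + b j ^+ 3)
  + 3 * h ^+ 2 * (b i ^+ 2 * b j ^+ 3 + nu ^+ 2 * b j)
  + 6 * h ^+ 2 * n ^+ 2 * (b i ^+ 4 * b j + b j ^+ 5)))).
  by apply: ler_sum => i _; apply: ler_sum => j _; rewrite ler_wpM2l// pair_err_le.
rewrite sum_poly ler_pdivlMr//.
have hn : h != 0 by rewrite gt_eqF.
have nn : n != 0 by rewrite gt_eqF.
(* Each sum is divided by its natural size; what remains of n and h then combines into psi, n, h or
   n h, all bounded by 1 or by Gam. *)
pose s k := S k.+1 * h; pose t l := T l.+2 * h ^+ 2; pose s0 := S 0 * n; pose t1 := T 1 * (n * h).
have SE k : S k.+1 = s k / h by rewrite /s mulfK.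
have TE l : T l.+2 = t l / h ^+ 2 by rewrite /t mulfK// expf_neq0.
have S0E : S 0 = s0 / n by rewrite /s0 mulfK.
have T1E : T 1 = t1 / (n * h) by rewrite /t1 mulfK// mulf_neq0.
have nE : n = psi * h by rewrite psiE divfK.
have psi0 : 0 < psi by rewrite psiE divr_gt0.
have psi1 : psi <= 1 by rewrite psiE ler_pdivrMr// mul1r.
have psin : psi != 0 by rewrite gt_eqF.
have Gp : Gam ^+ 5 >= 32 * Gam ^+ 4 by rewrite [Gam ^+ 5]exprS ler_wpM2r ?exprn_ge0 ?(ltW G0)//; have := Gam100; lra.
(* Bounds every normalised sum: the numerical constants are at most 32 and the powers of Gam at most
   4. *)
pose G := Gam ^+ 5.
have G_1 : 1 <= G by exact: exprn_ege1.
have G_0 : 0 <= G by lra.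
have Gpow k c : (k <= 4)%N -> 0 <= c -> c <= 32 -> c * Gam ^+ k <= G.
  move=> k4 c0 c32; apply: le_trans Gp; apply: ler_pM; rewrite ?exprn_ge0 ?(ltW G0)//.
  exact: ler_weXn2l.
have s00 : 0 <= s0 by rewrite mulr_ge0 ?(ltW n_gt0)// sumr_ge0// => i _; rewrite mulr_ge0// exprn_ge0.
have t10 : 0 <= t1 by rewrite mulr_ge0 ?mulr_ge0 ?(ltW n_gt0) ?(ltW h_gt0)// sumr_ge0// => i _; rewrite exprn_ge0.
have sk0 k : 0 <= s k by rewrite mulr_ge0 ?(ltW h_gt0)// sumr_ge0// => i _; rewrite mulr_ge0// exprn_ge0.
have tk0 k : 0 <= t k by rewrite mulr_ge0 ?sqr_ge0// sumr_ge0// => i _; rewrite exprn_ge0.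
have s0le : s0 <= 1 by rewrite /s0 -ler_pdivlMr// mul1r.
have t1le : t1 <= G.
  have : t1 <= 2 * Gam ^+ 1 by rewrite /t1 -ler_pdivlMr ?mulr_gt0// expr1.
  by move/le_trans; apply; apply: Gpow => //; lra.
have sle k : (k <= 3)%N -> s k <= G.
  move=> k3.
  have : s k <= (2 ^+ k * 2) * Gam ^+ k.+1.
    rewrite /s -ler_pdivlMr//; apply: le_trans (SS k) _; rewrite exprMn exprS.
    by rewrite le_eqVlt; apply/orP; left; apply/eqP; ring.
  have c32 : 2 ^+ k * 2 <= 32 :> R.
    by case: k k3 => [|[|[|[|]]]]// _; rewrite ?exprS ?expr0; lra.
  by move/le_trans; apply; apply: Gpow => //; rewrite mulr_ge0// exprn_ge0.
have tle l : (l <= 3)%N -> t l <= G.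
  move=> k3.
  have : t l <= (2 ^+ l * 4) * Gam ^+ l.+1.
    rewrite /t -ler_pdivlMr ?exprn_gt0//; apply: le_trans (TT l) _; rewrite exprMn [Gam ^+ l.+1]exprS.
    by rewrite le_eqVlt; apply/orP; left; apply/eqP; ring.
  have c32 : 2 ^+ l * 4 <= 32 :> R.
    by case: l k3 => [|[|[|[|]]]]// _; rewrite ?exprS ?expr0; lra.
  by move/le_trans; apply; apply: Gpow => //; rewrite mulr_ge0// exprn_ge0.
have -> : (n ^+ 2 * (S 1 * T 0 + S 0 * T 1) + n * h * (2 * (S 2 * T 1) + S 1 * T 2 + S 0 * T 3)
  + n * h * nu * (S 1 * T 0 + 2 * (S 0 * T 1)) + 2 * n ^+ 2 * h * (S 3 * T 0 + S 0 * T 3)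
  + 3 * h ^+ 2 * (S 2 * T 3 + nu ^+ 2 * (S 0 * T 1))
  + 6 * h ^+ 2 * n ^+ 2 * (S 4 * T 1 + S 0 * T 5)) * h =
  s 0%N + s0 * t1 + 2 * (s 1%N * t1) + psi * (s 0%N * t 0%N) + s0 * t 1%N + psi * (s 0%N + 2 * (s0 * t1))
  + 2 * h * s 2%N + 2 * n * (s0 * t 1%N) + 3 * (s 1%N * t 1%N) + 3 * psi ^+ 2 * (s0 * t1)
  + 6 * n * h * (s 3%N * t1) + 6 * n * h * (s0 * t 3%N).
  rewrite T0 !SE !TE S0E T1E nuE; move: (s 0%N) (s 1%N) (s 2%N) (s 3%N) (t 0%N) (t 1%N) (t 3%N) (s0) (t1).
  move: psin hn; rewrite nE; move: (psi) (h).
  by move=> psi' h' psin hn *; field; rewrite psin hn.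
have B x y : 0 <= x -> 0 <= y -> x <= G -> y <= G -> x * y <= G ^+ 2.
  by move=> x0 y0 xG yG; rewrite expr2; apply: ler_pM.
have GG2 : G <= G ^+ 2 by rewrite expr2 ler_peMl.
have sG : s0 <= G by lra.
have h0' := ltW h_gt0; have n0' := ltW n_gt0; have psi0' := ltW psi0.
have C c x : 0 <= c -> c <= 1 -> 0 <= x -> x <= G ^+ 2 -> c * x <= G ^+ 2.
  by move=> c0 c1 x0 xG; apply: le_trans xG; rewrite ler_piMl.
have C2 c x : 0 <= c -> c <= Gam -> 0 <= x -> x <= G ^+ 2 -> c * x <= Gam * G ^+ 2.
  by move=> c0 c1 x0 xG; apply: ler_pM.
have m1 := B _ _ s00 t10 sG t1le.
have m2 := B _ _ (sk0 1%N) t10 (sle 1%N isT) t1le.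
have m3 := B _ _ (sk0 0%N) (tk0 0%N) (sle 0%N isT) (tle 0%N isT).
have m4 := B _ _ s00 (tk0 1%N) sG (tle 1%N isT).
have m5 := B _ _ (sk0 1%N) (tk0 1%N) (sle 1%N isT) (tle 1%N isT).
have m6 := B _ _ (sk0 3%N) t10 (sle 3%N isT) t1le.
have m7 := B _ _ s00 (tk0 3%N) sG (tle 3%N isT).
have m0 : s 0%N <= G ^+ 2 by apply: le_trans GG2; exact: (sle 0%N).
have m8 : s 2%N <= G ^+ 2 by apply: le_trans GG2; exact: (sle 2%N).
have p0 (x y : R) : 0 <= x -> 0 <= y -> 0 <= x * y by exact: mulr_ge0.
have psi2 : psi ^+ 2 <= 1 by rewrite expr_le1.
have nhG : n * h <= Gam by apply: le_trans hGam; rewrite ler_piMl.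
have q3 := C _ _ psi0' psi1 (p0 _ _ (sk0 0%N) (tk0 0%N)) m3.
have q4 := C _ _ psi0' psi1 (sk0 0%N) m0.
have q5 := C _ _ psi0' psi1 (p0 _ _ s00 t10) m1.
have q6 := C2 _ _ h0' hGam (sk0 2%N) m8.
have q7 := C _ _ n0' n1 (p0 _ _ s00 (tk0 1%N)) m4.
have q8 := C _ _ (sqr_ge0 psi) psi2 (p0 _ _ s00 t10) m1.
have q9 := C2 _ _ (p0 _ _ n0' h0') nhG (p0 _ _ (sk0 3%N) t10) m6.
have q10 := C2 _ _ (p0 _ _ n0' h0') nhG (p0 _ _ s00 (tk0 3%N)) m7.
have fin : 20 * G ^+ 2 + 14 * (Gam * G ^+ 2) <= Gam ^+ 12.
  have -> : Gam ^+ 12 = Gam ^+ 2 * G ^+ 2 by rewrite /G; ring.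
  have -> : 20 * G ^+ 2 + 14 * (Gam * G ^+ 2) = (20 + 14 * Gam) * G ^+ 2 by ring.
  by rewrite ler_wpM2r ?sqr_ge0//; have := Gam100; nra.
apply: le_trans fin.
move: (sqr_ge0 G) m1 m2 m4 m5 m0 q3 q4 q5 q6 q7 q8 q9 q10.
move: (s 0%N) (s 1%N) (s 2%N) (s 3%N) (t 0%N) (t 1%N) (t 3%N) (s0) (t1) (G ^+ 2) (Gam * G ^+ 2).
move=> a0 a1 a2 a3 c0 c1 c3 d0 d1 g gg; move=> *; lra.
Qed.

End PairSum.

(** * Ring identities and inequalities behind the expansions *)

Section PairAlgebra.

Lemma le_of_eq (R : rcfType) (x y : R) : x = y -> x <= y.
Proof. by move=> ->. Qed.

Lemma block_real (R : rcfType) (G x y : R) : 0 <= x -> 0 <= y -> 0 <= G ->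
  x <= G + 4^-1 * (y + x) -> y <= G + 4^-1 * (y + x) -> x <= 8 * G /\ y <= 8 * G.
Proof. by move=> x0 y0 G0 h1 h2; split; lra. Qed.

Lemma cross_real (R : rcfType) (a b c d : R) : 0 <= a -> 0 <= b -> 0 <= c -> 0 <= d ->
  a * d + b * c <= (a + c) * (b + d).
Proof. by move=> a0 b0 c0 d0; have := mulr_ge0 a0 b0; have := mulr_ge0 c0 d0; lra. Qed.

Lemma dX_split (C : comNzRingType) (t t' zm a b c d r r' Ni g : C) :
  t * - (zm * (a * b) + r * Ni * g) + t' * - (zm * (c * d) + r' * Ni * g) =
  - (zm * (t * (a * b) + t' * (c * d)) + (t * r + t' * r') * Ni * g).
Proof. by ring. Qed.

Lemma X_split (C : comNzRingType) (z m g g1 g2 m1 m2 c : C) :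
  c + (z + (m - m1 + m2)) * (g - g1 + g2) - (c + (z + m) * g) =
  - ((z + m) * g1 + m1 * g) + ((z + m) * g2 + m2 * g + (m2 - m1) * (g2 - g1)).
Proof. by ring. Qed.

Lemma Psi_split (C : comNzRingType) (b d1 d2 W W' dW : C) :
  (b - d1 + d2) * W' - b * W - (b * dW - d1 * W) = d2 * W' - d1 * (W' - W) + b * (W' - W - dW).
Proof. by ring. Qed.

Lemma alpha_beta_split (C : comNzRingType) (t t' b c1 c2 d d' dJ d'J q1 q2 b' W : C) :
  t * (b * (c1 * d + c2 * d'J) - q1 * b * W) + t' * (b * (c1 * d' + c2 * dJ) - q2 * b' * W) =
  b * (c1 * (t * d + t' * d') + c2 * (t * d'J + t' * dJ)) - (t * (q1 * b) + t' * (q2 * b')) * W.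
Proof. by ring. Qed.

Lemma m1_split (C : comNzRingType) (t t' a b Ni : C) :
  (t * a + t' * b) * Ni = t * (a * Ni) + t' * (b * Ni).
Proof. by ring. Qed.

Lemma m2_split (C : comNzRingType) (t t' k1 k2 k3 k4 a b c d Ni : C) :
  (t * (t * (k1 * a) + t' * (k2 * b)) + t' * (t * (k3 * c) + t' * (k4 * d))) * Ni =
  t * (t * (k1 * (a * Ni)) + t' * (k2 * (b * Ni))) + t' * (t * (k3 * (c * Ni)) + t' * (k4 * (d * Ni))).
Proof. by ring. Qed.

Lemma st_real (R : rcfType) (s G x y a b : R) : 0 <= s -> a <= G -> b <= G -> 0 <= x -> 0 <= y ->
  s * (a * x + b * y) <= s * G * (x + y).
Proof. by move=> s0 aG bG x0 y0; rewrite -mulrA ler_wpM2l// mulrDr lerD// ler_wpM2r. Qed.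

Lemma conj_comb (R : rcfType) (t t' a b : R[i]) :
  t' = conjc t \/ a = b /\ t' = 0 /\ conjc t = t ->
  conjc (t * a + t' * b) = t * conjc b + t' * conjc a.
Proof.
rewrite rmorphD !rmorphM /= => -[->|[-> [-> ->]]]; first by rewrite conjcK addrC.
by rewrite !conjc0 !mul0r.
Qed.

Lemma sum_dXl (C : comNzRingType) (I : finType) (c b r : I -> C) (zm a Ni g : C) :
  \sum_i c i * - (zm * (a * b i) + r i * Ni * g) =
  - (zm * (a * (\sum_i c i * b i)) + (\sum_i c i * r i) * Ni * g).
Proof.
rewrite !mulr_sumr !mulr_suml -big_split /= -sumrN.
by apply: eq_bigr => i _; ring.
Qed.

Lemma sum_dXr (C : comNzRingType) (I : finType) (c a r : I -> C) (zm b Ni g : C) :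
  \sum_i c i * - (zm * (a i * b) + r i * Ni * g) =
  - (zm * ((\sum_i c i * a i) * b) + (\sum_i c i * r i) * Ni * g).
Proof.
rewrite !mulr_suml !mulr_sumr -big_split /= -sumrN.
by apply: eq_bigr => i _; ring.
Qed.

Lemma sum_lin_split (C : comNzRingType) (I : finType) (c d e a : I -> C) (y c1 c2 b W : C) :
  \sum_i c i * (y * (c1 * d i + c2 * e i) - b * a i * W) =
  y * (c1 * (\sum_i c i * d i) + c2 * (\sum_i c i * e i)) - b * (\sum_i c i * a i) * W.
Proof.
rewrite !mulr_sumr -big_split /= mulr_sumr mulr_suml -sumrB.
by apply: eq_bigr => i _; ring.
Qed.

Lemma lin_collect (C : comNzRingType) (y c1 c2 a1 a2 b1 b2 k g W q' : C) :
  y * (c1 * a1 + c2 * a2) - k * g * W + (y * (c1 * b1 + c2 * b2) - y * q' * W) =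
  y * (c1 * (a1 + b1) + c2 * (a2 + b2)) - y * q' * W - k * (g * W).
Proof. by ring. Qed.

Lemma sum_bound_term (C : comNzRingType) (b G M4 M5 nu : C) :
  b * (G * M4 * (2 * G ^+ 2 * b + G ^+ 2 * nu + (2 * G ^+ 2 * b + G ^+ 2 * nu)) +
    G * M4 * (2 * G ^+ 2 * b + G ^+ 2 * nu + (2 * G ^+ 2 * b + G ^+ 2 * nu))) + b * G * M5 =
  8 * G ^+ 3 * M4 * b ^+ 2 + 4 * G ^+ 3 * M4 * nu * b + G * M5 * b.
Proof. by ring. Qed.

(** The cancellation that makes the moments small: s Ni is m, g is the form at v, and the average
    over j of the diagonal resolvent entries times g W removes m g W. *)
Lemma cancel_main (C : comNzRingType) (s Ni g W f : C) :
  s * Ni * g * W + (f * Ni - s * (g * W) * Ni) = f * Ni.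
Proof. by ring. Qed.

(** After the cancellation every term has a factor b_j or its square. Compared with N = n^-2, the
    sum of the b_j is of order psi and that of their squares of order psi^2; in the latter case one
    psi is exchanged for M. *)
Lemma main_real (R : rcfType) (Gam n h M M4 nu psi S1 S2 : R) : 100 <= Gam -> 0 < n -> 0 < h ->
  psi = n / h -> psi <= M -> nu <= psi -> 0 <= nu -> 0 <= M4 ->
  S1 <= 2 * Gam / (n * h) -> S2 <= 4 * Gam / h ^+ 2 ->
  8 * Gam ^+ 3 * M4 * S2 + 4 * Gam ^+ 3 * M4 * nu * S1 + Gam * (M4 * M) * S1 <=
  Gam ^+ 5 * psi * (M4 * M) * n ^- 2.
Proof.
move=> Gam100 n0 h0 psiE psiM nupsi nu0 M40 s1 s2.
have G0 : 0 <= Gam by apply: le_trans Gam100.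
have P0 : 0 <= psi := le_trans nu0 nupsi.
have M0 : 0 <= M := le_trans P0 psiM.
have nh0 : 0 <= (n * h)^-1 by rewrite invr_ge0 mulr_ge0// ltW.
have e : Gam ^+ 5 * psi * (M4 * M) * n ^- 2 = Gam ^+ 5 * (M4 * M) * (n * h)^-1.
  by rewrite psiE; field; rewrite !gt_eqF.
have e2 : 4 * Gam / h ^+ 2 = 4 * Gam * psi * (n * h)^-1.
  by rewrite psiE; field; rewrite !gt_eqF.
have G3 : 0 <= Gam ^+ 3 by rewrite exprn_ge0.
have a1 : 8 * Gam ^+ 3 * M4 * S2 <= 32 * Gam ^+ 4 * (M4 * M) * (n * h)^-1.
  apply: (@le_trans _ _ (8 * Gam ^+ 3 * M4 * (4 * Gam * M * (n * h)^-1))).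
    apply: ler_wpM2l; first by rewrite !mulr_ge0.
    rewrite (le_trans s2)// e2; apply: ler_wpM2r => //.
    by apply: ler_wpM2l => //; rewrite mulr_ge0.
  by apply: le_of_eq; ring.
have a2 : 4 * Gam ^+ 3 * M4 * nu * S1 <= 8 * Gam ^+ 4 * (M4 * M) * (n * h)^-1.
  apply: (@le_trans _ _ (4 * Gam ^+ 3 * M4 * nu * (2 * Gam / (n * h)))).
    by apply: ler_wpM2l => //; rewrite !mulr_ge0.
  apply: (@le_trans _ _ (4 * Gam ^+ 3 * M4 * M * (2 * Gam / (n * h)))).
    apply: ler_wpM2r; first by rewrite mulr_ge0// mulr_ge0.
    by apply: ler_wpM2l; [rewrite !mulr_ge0|apply: le_trans psiM].
  by apply: le_of_eq; ring.
have a3 : Gam * (M4 * M) * S1 <= 2 * Gam ^+ 2 * (M4 * M) * (n * h)^-1.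
  apply: (@le_trans _ _ (Gam * (M4 * M) * (2 * Gam / (n * h)))).
    by apply: ler_wpM2l => //; rewrite !mulr_ge0.
  by apply: le_of_eq; ring.
rewrite e; apply: le_trans (lerD (lerD a1 a2) a3) _.
rewrite -!mulrDl; apply: ler_wpM2r => //; apply: ler_wpM2r; first exact: mulr_ge0.
have g4 : Gam ^+ 2 <= Gam ^+ 4 by rewrite ler_weXn2l// (le_trans _ Gam100)// ler1n.
have := exprn_ge0 2 G0; rewrite (exprS Gam 4); move: (Gam ^+ 4) (Gam ^+ 2) g4 => x y xy y0; nra.
Qed.

End PairAlgebra.

(** * Deterministic estimates on the good event *)

Section GoodEvent.
Local Open Scope complex_scope.
Variable R : rcfType.
Variable N : nat.
Implicit Types v : 'cV[R[i]]_N.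
Implicit Types A B : 'M[R[i]]_N.
Implicit Types z : R[i].
Local Notation e_ := (@ebase R N).

(* Derivatives of Psi below along the entries (i, j) and (j, i), the latter moving by the
   conjugate of the increment of the former. *)
Definition alphaF p A z v i j : R[i] :=
  let X := Xst A z v in
  qf A z (e_ j) v * (p.+2%:R * X ^+ p.+1 * conjc X ^+ p.+3 * dX A z v i j
     + p.+3%:R * X ^+ p.+2 * conjc X ^+ p.+2 * conjc (dX A z v j i))
  - qf A z (e_ j) (e_ i) * qf A z (e_ j) v * Wfun p X.

Definition betaF p A z v i j : R[i] :=
  let X := Xst A z v in
  qf A z (e_ j) v * (p.+2%:R * X ^+ p.+1 * conjc X ^+ p.+3 * dX A z v j i
     + p.+3%:R * X ^+ p.+2 * conjc X ^+ p.+2 * conjc (dX A z v i j))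
  - qf A z (e_ j) (e_ j) * qf A z (e_ i) v * Wfun p X.

Definition Psi p A z v j : R[i] := qf A z (e_ j) v * Wfun p (Xst A z v).

Definition bet A z v k : R := cabs (qf A z v (e_ k)) + cabs (qf A z (e_ k) v).

Definition nn_ : R := (Num.sqrt N%:R)^-1.
Definition hh_ z : R := Num.sqrt (complex.Im z).
(** (N Im z)^(-1/2), the size to be proved for X up to small powers of N. *)
Definition psi_ z : R := nn_ / hh_ z.

(* Gam is a small power of N; the lower bound 100 lets it absorb numerical constants. *)
Record regime p z (Gam : R) : Prop := Regime {
  rg_N : (0 < N)%N; rg_im : 0 < complex.Im z; rg_Gam : 100 <= Gam;
  rg_p : (2 * p + 6)%:R <= Gam; rg_nh : nn_ <= hh_ z; rg_hG : hh_ z <= Gam;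
  rg_Gn : Gam ^+ 3 * nn_ <= 1; rg_z : cabs z <= Gam }.

(** A priori bounds for the unperturbed resolvent. The vectors [uu] will be those that carry the
    second moments E h_ij^2 against v. *)
Record good A z v (uu : 'I_N -> 'cV[R[i]]_N) (Gam : R) : Prop := Good {
  gd_ee : forall k l, cabs (qf A z (e_ k) (e_ l)) <= Gam;
  gd_ev : forall k, cabs (qf A z (e_ k) v) <= Gam;
  gd_ve : forall k, cabs (qf A z v (e_ k)) <= Gam;
  gd_vv : cabs (qf A z v v) <= Gam;
  gd_eu : forall k, cabs (qf A z (e_ k) (uu k)) <= Gam;
  gd_uv : forall k, cabs (qf A z (uu k) v) <= Gam;
  gd_vu : forall k, cabs (qf A z v (uu k)) <= Gam;
  gd_uu : forall k, cabs (qf A z (uu k) (uu k)) <= Gam }.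

Section Fixed.
Variables (p : nat) (A : 'M[R[i]]_N) (z : R[i]) (v : 'cV[R[i]]_N).
Variables (uu : 'I_N -> 'cV[R[i]]_N) (Gam : R).
Hypotheses (hA : hermitian A) (rg : regime p z Gam) (gd : good A z v uu Gam).
Hypothesis v1 : nrm2 v <= 1.

Local Notation n := nn_.
Local Notation h := (hh_ z).
Local Notation psi := (psi_ z).
Local Notation nu := (psi ^+ 2).
Local Notation q := (qf A z).
Local Notation X := (Xst A z v).
Local Notation K := (2 * p + 3)%N.

Let im0 := rg_im rg.
Let z0 : complex.Im z != 0. Proof. by rewrite gt_eqF. Qed.
Let N0 : (0 : R) < N%:R. Proof. by rewrite ltr0n; case: rg. Qed.
Let n_gt0 : 0 < n. Proof. by rewrite invr_gt0 sqrtr_gt0. Qed.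
Let h_gt0 : 0 < h. Proof. by rewrite sqrtr_gt0. Qed.
Let psi_gt0 : 0 < psi. Proof. exact: divr_gt0. Qed.
Let psi1 : psi <= 1. Proof. by rewrite ler_pdivrMr// mul1r; case: rg. Qed.
Let Gam100 := rg_Gam rg.
Let Gam0 : 0 < Gam. Proof. by apply: lt_le_trans Gam100. Qed.
Let Gam1 : 1 <= Gam. Proof. by apply: le_trans Gam100; rewrite ler1n. Qed.
Let nN : N%:R = n ^- 2.
Proof. by rewrite /nn_ exprVn invrK sqr_sqrtr// ltW. Qed.
Let n1 : n <= 1.
Proof. by rewrite invf_le1 ?sqrtr_gt0// -[leLHS]sqrtr1 ler_sqrt// ler1n; case: rg. Qed.
Let h2 : h ^+ 2 = complex.Im z. Proof. by rewrite sqr_sqrtr// ltW. Qed.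
Let NV : N%:R^-1 = n ^+ 2. Proof. by rewrite nN invrK. Qed.
Let nuE : nu = n ^+ 2 / h ^+ 2. Proof. by rewrite /psi_ expr_div_n. Qed.
Let nu0 : 0 <= nu. Proof. exact: sqr_ge0. Qed.
Let nu1 : nu <= 1. Proof. by rewrite expr_le1// ltW. Qed.
Let Gk k : 0 <= Gam ^+ k. Proof. by rewrite exprn_ge0// ltW. Qed.

Let b0 k : 0 <= bet A z v k. Proof. by rewrite addr_ge0 ?cabs_ge0. Qed.

Let bG k : bet A z v k <= 2 * Gam.
Proof. by rewrite mulr2n mulrDl !mul1r lerD//; [exact: (gd_ve gd)|exact: (gd_ev gd)]. Qed.

Let evb k : cabs (q (e_ k) v) <= bet A z v k. Proof. by rewrite lerDr cabs_ge0. Qed.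
Let veb k : cabs (q v (e_ k)) <= bet A z v k. Proof. by rewrite lerDl cabs_ge0. Qed.

(** Ward identity for the resolvent and for its adjoint. A single [bet] may be as large as 2 Gam,
    but the squares sum to the order of 1/Im z. *)
Let b2 : \sum_k bet A z v k ^+ 2 <= 4 * Gam / h ^+ 2.
Proof.
have im : complex.Im (q v v) <= Gam by apply: le_trans (Im_qf_le _ _ _) (gd_vv gd).
have e1 : \sum_k cabs (q (e_ k) v) ^+ 2 <= Gam / h ^+ 2.
  under eq_bigr do rewrite qf_e.
  by rewrite -/(nrm2 _) h2 ler_pdivlMr// mulrC -ward_r.
have e2 : \sum_k cabs (q v (e_ k)) ^+ 2 <= Gam / h ^+ 2.
  have -> : \sum_k cabs (q v (e_ k)) ^+ 2 = nrm2 (adjmx (res A z) *m v).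
    apply: eq_bigr => k _; congr (_ ^+ 2).
    by rewrite /qf dotc_adj -dotc_conj cabsJ dotc_ebase.
  by rewrite h2 ler_pdivlMr// mulrC -ward_l.
apply: (@le_trans _ _ (2 * (\sum_k cabs (q v (e_ k)) ^+ 2 + \sum_k cabs (q (e_ k) v) ^+ 2))).
  rewrite -big_split mulr_sumr /=; apply: ler_sum => k _; rewrite /bet.
  move: (cabs (q v (e_ k))) (cabs (q (e_ k) v)) => a b.
  by have := sqr_ge0 (a - b); nra.
have -> : 4 * Gam / h ^+ 2 = 2 * (Gam / h ^+ 2 + Gam / h ^+ 2) by ring.
by rewrite ler_wpM2l// lerD.
Qed.

Let mG : cabs (mst A z) <= Gam.
Proof.
rewrite /mst cabs_div_nat ler_pdivrMr//.
apply: le_trans (cabs_sum _ _ _) _.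
have -> : Gam * N%:R = \sum_(k < N) Gam by rewrite sumr_const card_ord mulr_natr.
by apply: ler_sum => k _; exact: (gd_ee gd).
Qed.

Let zmG : cabs (z + mst A z) <= 2 * Gam.
Proof. by rewrite mulr2n mulrDl !mul1r; apply: cabs_lerD => //; case: rg. Qed.

Let rf_le x y : cabs (q x x) <= Gam -> cabs (q y y) <= Gam ->
  cabs (rf A z x y / N%:R) <= Gam * nu.
Proof.
move=> xG yG; have -> : Gam * nu = Gam / h ^+ 2 * n ^+ 2 by rewrite nuE; ring.
rewrite cabs_div_nat NV ler_wpM2r ?sqr_ge0// h2.
apply: le_trans (qf_resr_le _ _ hA im0) _; rewrite ler_wpM2r ?invr_ge0 ?(ltW im0)//.
have s w : cabs (q w w) <= Gam -> Num.sqrt (complex.Im (q w w)) <= Num.sqrt Gam.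
  by move=> wG; rewrite ler_sqrt ?(ltW Gam0)// (le_trans (Im_qf_le _ _ _)).
by rewrite -[leRHS](sqr_sqrtr (ltW Gam0)) expr2; apply: ler_pM; rewrite ?sqrtr_ge0 ?s.
Qed.

(** One bound for X before and after the replacement, and at least psi, so that lost powers can be
    paid for. The exponent 11 arises as follows: X moves by at most Gam^7 n Y with Y <= Gam^3, and n
    = psi h <= Gam psi. *)
Definition MM := cabs X + Gam ^+ 11 * psi.

Let psiM : psi <= MM.
Proof. by rewrite /MM -[leLHS]add0r lerD ?cabs_ge0// ler_peMl ?(ltW psi_gt0)// exprn_ege1. Qed.

Let XM : cabs X <= MM.
Proof. by rewrite lerDl mulr_ge0// ltW. Qed.

Section Pair.
Variables (B : 'M[R[i]]_N) (i j : 'I_N) (t t' : R[i]).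
Hypotheses (hB : hermitian B) (BA : B - A = t *: delta_mx i j + t' *: delta_mx j i).
Hypotheses (ts : cabs t <= 2 * Gam * n) (ts' : cabs t' <= 2 * Gam * n).
Hypothesis tt' : (i != j /\ t' = conjc t) \/ (i = j /\ t' = 0 /\ conjc t = t).

Local Notation q' := (qf B z).
Let s := 2 * Gam * n.

Let s0 : 0 <= s. Proof. by rewrite /s !mulr_ge0// ltW. Qed.

Let c0 : 0 <= 8 * Gam * s ^+ 2.
Proof. by apply: mulr_ge0; [apply: mulr_ge0 => //; exact: ltW|exact: sqr_ge0]. Qed.

(** In [qf_expand1] the unknown entries reappear with a factor at most 1/4, so the linear system can
    be solved. *)
Let block (a b : 'I_N) : (a = i \/ a = j) -> (b = i \/ b = j) -> cabs (q' (e_ a) (e_ b)) <= 8 * Gam.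
Proof.
have k : s * Gam <= 4^-1.
  have := Gam2n Gam100 n_gt0 (rg_Gn rg).
  have -> : s * Gam = 2 * (Gam ^+ 2 * n) by rewrite /s; ring.
  by move: (Gam ^+ 2 * n) => x; lra.
have st a' b' : cabs (q' (e_ a') (e_ b')) <=
    Gam + 4^-1 * (cabs (q' (e_ j) (e_ b')) + cabs (q' (e_ i) (e_ b'))).
  rewrite (qf_expand1 hA hB z0 BA); apply: cabs_lerB; first exact: (gd_ee gd).
  apply: le_trans (first_order_le _ _ _ _ ts ts') _.
  apply: (@le_trans _ _ (s * Gam * (cabs (q' (e_ j) (e_ b')) + cabs (q' (e_ i) (e_ b'))))); last first.
    by apply: ler_wpM2r k; rewrite addr_ge0 ?cabs_ge0.
  exact: (st_real s0 (gd_ee gd _ _) (gd_ee gd _ _) (cabs_ge0 _) (cabs_ge0 _)).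
have fin b' := block_real (cabs_ge0 _) (cabs_ge0 _) (ltW Gam0) (st i b') (st j b').
by move=> [->|->] [->|->]; [case: (fin i)|case: (fin j)|case: (fin i)|case: (fin j)].
Qed.

Local Notation bi := (bet A z v i).
Local Notation bj := (bet A z v j).
Local Notation Q1 := (bi * bj).
Local Notation Q2 := (bi ^+ 2 + bj ^+ 2).
Let Y := Q1 + nu + n * Q2.

Let bl_ij := block (or_introl erefl) (or_intror erefl).
Let bl_ji := block (or_intror erefl) (or_introl erefl).
Let bl_ii := block (or_introl erefl) (or_introl erefl).
Let bl_jj := block (or_intror erefl) (or_intror erefl).

(** The letters g, m, d and x denote the changes of the form at v, of m, of the entry between e_j
    and v, and of X; index 1 is the part linear in t and t', index 2 what is left, up to sign. *)
Let g1 := t * (q v (e_ i) * q (e_ j) v) + t' * (q v (e_ j) * q (e_ i) v).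
Let g2 := t * (q v (e_ i) * (t * (q' (e_ j) (e_ i) * q (e_ j) v) + t' * (q' (e_ j) (e_ j) * q (e_ i) v)))
   + t' * (q v (e_ j) * (t * (q' (e_ i) (e_ i) * q (e_ j) v) + t' * (q' (e_ i) (e_ j) * q (e_ i) v))).
Let m1 := (t * rf A z (e_ j) (e_ i) + t' * rf A z (e_ i) (e_ j)) / N%:R.
Let m2 := (t * (t * (q' (e_ j) (e_ i) * rf A z (e_ j) (e_ i)) + t' * (q' (e_ j) (e_ j) * rf A z (e_ i) (e_ i)))
   + t' * (t * (q' (e_ i) (e_ i) * rf A z (e_ j) (e_ j)) + t' * (q' (e_ i) (e_ j) * rf A z (e_ i) (e_ j))))
    / N%:R.
Let d1 := t * (q (e_ j) (e_ i) * q (e_ j) v) + t' * (q (e_ j) (e_ j) * q (e_ i) v).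
Let d2 := t * (q (e_ j) (e_ i) * (t * (q' (e_ j) (e_ i) * q (e_ j) v) + t' * (q' (e_ j) (e_ j) * q (e_ i) v)))
   + t' * (q (e_ j) (e_ j) * (t * (q' (e_ i) (e_ i) * q (e_ j) v) + t' * (q' (e_ i) (e_ j) * q (e_ i) v))).
Let x1 := t * dX A z v i j + t' * dX A z v j i.
Let x2 := (z + mst A z) * g2 + m2 * q v v + (m2 - m1) * (g2 - g1).

Let x1E : x1 = - ((z + mst A z) * g1 + m1 * q v v).
Proof. exact: dX_split. Qed.

Let XE : Xst B z v - X = x1 + x2.
Proof.
have eg : q' v v = q v v - g1 + g2 := qf_expand2 hA hB z0 BA v v.
have em : mst B z = mst A z - m1 + m2 := mst_expand hA hB z0 BA.
by rewrite x1E /Xst eg em; exact: X_split.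
Qed.

Let g1_le : cabs g1 <= s * Q1.
Proof.
apply: le_trans (first_order_le _ _ _ _ ts ts') _; rewrite ler_wpM2l// /bet.
by apply: cross_real; exact: cabs_ge0.
Qed.

Let g2_le : cabs g2 <= 16 * Gam * s ^+ 2 * Q2.
Proof.
apply: le_trans (second_order_le _ _ _ _ ts ts' bl_ji bl_jj bl_ii bl_ij) _.
have -> : 16 * Gam * s ^+ 2 * Q2 = 8 * Gam * s ^+ 2 * (2 * Q2) by ring.
apply: (ler_wpM2l c0).
apply: (@le_trans _ _ ((bi + bj) * (bi + bj))).
  apply: ler_pM; [by rewrite addr_ge0 ?cabs_ge0|by rewrite addr_ge0 ?cabs_ge0|exact: lerD|].
  by rewrite addrC; exact: lerD.
by have := sqr_ge0 (bi - bj); move: (bi) (bj) => x y; nra.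
Qed.

Let rfe k l : cabs (rf A z (e_ k) (e_ l) / N%:R) <= Gam * nu.
Proof. by apply: rf_le; exact: (gd_ee gd). Qed.

Let m1_le : cabs m1 <= 2 * s * Gam * nu.
Proof.
rewrite /m1 m1_split.
have -> : 2 * s * Gam * nu = s * (Gam * nu) + s * (Gam * nu) by ring.
by apply: cabs_lerD; apply: cabs_ler_pM.
Qed.

Let m2_le : cabs m2 <= 32 * Gam ^+ 2 * s ^+ 2 * nu.
Proof.
rewrite /m2 m2_split.
have -> : 32 * Gam ^+ 2 * s ^+ 2 * nu = 
  s * (s * (8 * Gam * (Gam * nu)) + s * (8 * Gam * (Gam * nu))) + s * (s * (8 * Gam * (Gam * nu)) + s * (8 * Gam * (Gam * nu))) by ring.
by do 2![apply: cabs_lerD; apply: cabs_ler_pM => //]; apply: cabs_ler_pM => //.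
Qed.

Let x1_le : cabs x1 <= Gam ^+ 4 * n * (Q1 + nu).
Proof.
rewrite x1E cabsN; apply: le_trans (cabsD _ _) _; rewrite (cabsM (z + _)) (cabsM m1).
exact: (x1_real_le Gam100 n_gt0 nu0 (b0 i) (b0 j) erefl (cabs_ge0 _) (cabs_ge0 _) zmG (gd_vv gd) g1_le m1_le).
Qed.

Let x2_le : cabs x2 <= Gam ^+ 7 * n ^+ 2 * (Q2 + nu).
Proof.
apply: le_trans (cabs_lerD (cabs_lerD (lexx _) (lexx _)) (lexx _)) _; rewrite (cabsM (z + _)) (cabsM m2) (cabsM (m2 - m1)).
apply: (@le_trans _ _ (cabs (z + mst A z) * cabs g2 + cabs m2 * cabs (q v v)
   + (cabs m2 + cabs m1) * (cabs g2 + cabs g1))).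
  by rewrite lerD2l; apply: ler_pM; rewrite ?cabs_ge0 ?cabsB.
exact: (x2_real_le (bi := bi) (bj := bj) Gam100 n_gt0 (rg_Gn rg) nu0 nu1 erefl erefl (cabs_ge0 _) (cabs_ge0 _)
  (cabs_ge0 _) (cabs_ge0 _) zmG (gd_vv gd) g1_le m1_le g2_le m2_le).
Qed.

Let xs_le : cabs x1 + cabs x2 <= Gam ^+ 7 * n * Y.
Proof. have := @xsum_real_le _ Gam n Gam100 n_gt0 (rg_Gn rg) nu Q1 Q2 bi bj nu0 (b0 i) (b0 j) erefl _ _ x1_le x2_le.
exact. Qed.

Let Y0 : 0 <= Y.
Proof.
apply: addr_ge0; first exact: addr_ge0 (mulr_ge0 (b0 i) (b0 j)) nu0.
exact: mulr_ge0 (ltW n_gt0) (addr_ge0 (sqr_ge0 _) (sqr_ge0 _)).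
Qed.

Let X'M : cabs (Xst B z v) <= MM.
Proof.
apply: le_trans (cabs_sub_le _ X) _; rewrite /MM lerD2l XE.
apply: le_trans (cabsD _ _) _; apply: le_trans xs_le _.
apply: (@le_trans _ _ (Gam ^+ 7 * n * Gam ^+ 3)).
  apply: ler_wpM2l; first exact: mulr_ge0 (Gk 7) (ltW n_gt0).
  have := @Y_le _ Gam n Gam100 n_gt0 (rg_Gn rg) nu Q1 Q2 bi bj nu1 (b0 i) (b0 j) (bG i) (bG j) erefl erefl.
  exact.
have -> : Gam ^+ 7 * n * Gam ^+ 3 = Gam ^+ 10 * (psi * h).
  by rewrite /psi_ divfK ?gt_eqF//; ring.
rewrite [Gam ^+ 11]exprSr -mulrA ler_wpM2l// mulrC ler_wpM2r ?(ltW psi_gt0)//.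
by case: rg.
Qed.

(** Conjugation exchanges the increments t and t', which is why [alphaF] and [betaF] contain the
    conjugate of the derivative in the opposite direction. *)
Let x1J : conjc x1 = t * conjc (dX A z v j i) + t' * conjc (dX A z v i j).
Proof. by apply: conj_comb; case: tt' => [[_ ->]|[-> [-> ->]]]; [left|right]. Qed.

(** Beyond the linear part one finds the second-order change of the entry, the product of two
    first-order changes, and the Taylor error of W; each is at least quadratic in the increment. *)
Lemma pair_remainder :
  cabs (Psi p B z v j - Psi p A z v j - (t * alphaF p A z v i j + t' * betaF p A z v i j)) <=
  Gam ^+ 16 * MM ^+ (2 * p + 5) * pair_err n h nu bi bj.
Proof.
have -> : Psi p B z v j - Psi p A z v j - (t * alphaF p A z v i j + t' * betaF p A z v i j) =
  d2 * Wfun p (Xst B z v) - d1 * (Wfun p (Xst B z v) - Wfun p X)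
   + q (e_ j) v * (Wfun p (Xst B z v) - Wfun p X - dWfun p X x1).
  have ed : q' (e_ j) v = q (e_ j) v - d1 + d2 := qf_expand2 hA hB z0 BA (e_ j) v.
  by rewrite /Psi ed /alphaF /betaF alpha_beta_split -x1J; exact: Psi_split.
have d1_le : cabs d1 <= Gam ^+ 3 * n * (bi + bj).
  apply: le_trans (first_order_le _ _ _ _ ts ts') _.
  apply: (@le_trans _ _ (s * (Gam * (bi + bj)))).
    apply: (ler_wpM2l s0); rewrite mulrDr addrC.
    by apply: lerD; apply: ler_pM; rewrite ?cabs_ge0//; exact: (gd_ee gd).
  have -> : s * (Gam * (bi + bj)) = 2 * Gam ^+ 2 * n * (bi + bj) by rewrite /s; ring.
  apply: ler_wpM2r; first exact: addr_ge0.
  apply: ler_wpM2r; first exact: ltW.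
  by apply: (Gam_c1 Gam100); lra.
have d2_le : cabs d2 <= Gam ^+ 5 * n ^+ 2 * (bi + bj).
  apply: le_trans (second_order_le _ _ _ _ ts ts' bl_ji bl_jj bl_ii bl_ij) _.
  apply: (@le_trans _ _ (8 * Gam * s ^+ 2 * (2 * Gam * (bi + bj)))).
    apply: (ler_wpM2l c0).
    apply: ler_pM; rewrite ?addr_ge0 ?cabs_ge0//.
      by rewrite mulr2n mulrDl mul1r lerD//; exact: (gd_ee gd).
    by rewrite addrC lerD.
  have -> : 8 * Gam * s ^+ 2 * (2 * Gam * (bi + bj)) = 64 * Gam ^+ 4 * n ^+ 2 * (bi + bj) by rewrite /s; ring.
  apply: ler_wpM2r; first exact: addr_ge0.
  apply: ler_wpM2r; first exact: sqr_ge0.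
  by apply: (Gam_c1 Gam100); lra.
have e5 : (2 * p + 5 = K.+2)%N by clear; lia.
have e4 : (2 * p + 4 = K.+1)%N by clear; lia.
apply: le_trans (cabs_lerD (cabs_lerB (lexx _) (lexx _)) (lexx _)) _; rewrite (cabsM d2) (cabsM d1) (cabsM (q (e_ j) v)) /pair_err e5.
have yE : cabs (Xst B z v - X) <= Gam ^+ 7 * n * Y.
  by rewrite XE; apply: le_trans (cabsD _ _) xs_le.
have w1 := Wfun_diff p XM X'M; rewrite e4 in w1.
have w2 := Wfun_taylor p XM X'M XE; rewrite e4 in w2.
apply: (remainder_real_le Gam100 n_gt0 h_gt0 nu0 (b0 i) (b0 j) erefl erefl
  0 (psi := psi) (P := (2 * p + 6)%:R) (y := cabs (Xst B z v - X)) (x2 := cabs x2));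
  rewrite ?cabs_ge0 ?ler0n//; try by case: rg.
rewrite cabs_Wfun e5; apply: lerXn2r; rewrite ?nnegrE ?cabs_ge0//.
by apply: le_trans psiM; exact: ltW.
Qed.

End Pair.

(** With the factor s for the new entry, the errors are of third order in the size n of the entries;
    the Ward identity makes their sum a multiple of psi. *)
Lemma sum_remainder (B : 'I_N -> 'I_N -> 'M[R[i]]_N) (s t t' : 'I_N -> 'I_N -> R[i]) :
  (forall i j, hermitian (B i j)) ->
  (forall i j, B i j - A = t i j *: delta_mx i j + t' i j *: delta_mx j i) ->
  (forall i j, cabs (t i j) <= 2 * Gam * n) -> (forall i j, cabs (t' i j) <= 2 * Gam * n) ->
  (forall i j, (i != j /\ t' i j = conjc (t i j)) \/
     (i = j /\ t' i j = 0 /\ conjc (t i j) = t i j)) ->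
  (forall i j, cabs (s i j) <= Gam * n) ->
  \sum_i \sum_j cabs (v i ord0) * (cabs (s i j) * cabs (Psi p (B i j) z v j - Psi p A z v j
     - (t i j * alphaF p A z v i j + t' i j * betaF p A z v i j))) <=
  Gam ^+ 29 * psi * MM ^+ (2 * p + 5).
Proof.
move=> hB BA ts ts' tt' sG.
have M0 : 0 <= MM := le_trans (ltW psi_gt0) psiM.
have u2 : \sum_i cabs (v i ord0) ^+ 2 <= 1 := v1.
have := @sum_pair_err _ N Gam n h psi nu (fun i => cabs (v i ord0)) (bet A z v).
move=> /(_ Gam100 n_gt0 h_gt0 (rg_nh rg) (rg_hG rg)) spe.
apply: (@le_trans _ _ (Gam ^+ 17 * n * MM ^+ (2 * p + 5) * (\sum_i \sum_j cabs (v i ord0) *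
   pair_err n h nu (bet A z v i) (bet A z v j)))).
  rewrite mulr_sumr; apply: ler_sum => i _; rewrite mulr_sumr; apply: ler_sum => j _.
  rewrite [leRHS]mulrCA; apply: ler_wpM2l; first exact: cabs_ge0.
  have -> : Gam ^+ 17 * n * MM ^+ (2 * p + 5) * pair_err n h nu (bet A z v i) (bet A z v j) =
    (Gam * n) * (Gam ^+ 16 * MM ^+ (2 * p + 5) * pair_err n h nu (bet A z v i) (bet A z v j)).
    by rewrite (exprS Gam 16); move: (Gam ^+ 16) (MM ^+ _) (pair_err _ _ _ _ _) => a b c; ring.
  apply: ler_pM; rewrite ?cabs_ge0//.
  exact: (pair_remainder (hB i j) (BA i j) (ts i j) (ts' i j) (tt' i j)).
have -> : Gam ^+ 29 * psi * MM ^+ (2 * p + 5) = Gam ^+ 17 * n * MM ^+ (2 * p + 5) * (Gam ^+ 12 / h).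
  by rewrite /psi_ (exprD Gam 17 12); move: (Gam ^+ 17) (Gam ^+ 12) (MM ^+ _) => a b c; ring.
apply: ler_wpM2l; last exact: (spe n1 erefl erefl nN (fun=> cabs_ge0 _) b0 bG u2 b2).
by apply: mulr_ge0; [exact: mulr_ge0 (Gk 17) (ltW n_gt0)|exact: exprn_ge0].
Qed.

(** [dX] is linear in each direction, so a weighted sum over i is again one resolvent expression:
    N^2 terms become N. *)
Let dXl (x : 'cV[R[i]]_N) a : \sum_i conjc (x i ord0) * dX A z v a i =
  - ((z + mst A z) * (q v (e_ a) * q x v) + rf A z x (e_ a) / N%:R * q v v).
Proof. by rewrite (qf_coordl _ _ x v) (rf_coordl _ _ x); exact: sum_dXl. Qed.

Let dXr (x : 'cV[R[i]]_N) a : \sum_i x i ord0 * dX A z v i a =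
  - ((z + mst A z) * (q v x * q (e_ a) v) + rf A z (e_ a) x / N%:R * q v v).
Proof. by rewrite (qf_coordr _ _ v x) (rf_coordr _ _ _ x); exact: sum_dXr. Qed.

Let dXb x w b : cabs x <= Gam -> cabs w <= bet A z v b -> forall r, cabs (r / N%:R) <= Gam * nu ->
  cabs (- ((z + mst A z) * (w * x) + r / N%:R * q v v)) <= 2 * Gam ^+ 2 * bet A z v b + Gam ^+ 2 * nu.
Proof.
move=> xG wb r rG; rewrite cabsN.
have -> : 2 * Gam ^+ 2 * bet A z v b + Gam ^+ 2 * nu =
  2 * Gam * (bet A z v b * Gam) + (Gam * nu) * Gam by ring.
apply: cabs_lerD; apply: cabs_ler_pM => //; last exact: (gd_vv gd).
exact: cabs_ler_pM.
Qed.

Let sum_bet : \sum_k bet A z v k <= 2 * Gam / (n * h).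
Proof.
apply: le_trans (sum_le_sqrt_card _) _.
have -> : 2 * Gam / (n * h) = n^-1 * (2 * Gam / h) by rewrite invfM mulrCA.
rewrite /nn_ invrK ler_wpM2l ?sqrtr_ge0//.
have g0 : 0 <= 2 * Gam / h by rewrite divr_ge0 ?mulr_ge0 ?(ltW Gam0) ?(ltW h_gt0).
rewrite -[leRHS](ger0_norm g0) -sqrtr_sqr ler_sqrt ?sqr_ge0//.
apply: le_trans b2 _; rewrite expr_div_n ler_wpM2r ?invr_ge0 ?sqr_ge0// exprMn.
by rewrite expr2 -!mulrA [4 * Gam]mulrC; have := Gam1; nra.
Qed.

(** The [betaF] sums hold the term that cancels m times the form at v. All the rest has a factor
    [bet] for the index j, and its average over j is of order psi. *)
Lemma main_sum_le :
  cabs (mst A z * q v v * Wfun p X + (\sum_j (\sum_i conjc (v i ord0) * betaF p A z v i j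
     + \sum_i uu j i ord0 * alphaF p A z v i j)) / N%:R) <= Gam ^+ 5 * psi * MM ^+ (2 * p + 5).
Proof.
pose c1 := p.+2%:R * X ^+ p.+1 * conjc X ^+ p.+3.
pose c2 := p.+3%:R * X ^+ p.+2 * conjc X ^+ p.+2.
(* A1 and A2 are the derivatives of X summed over i against v and its conjugate, B1 and B2 those
   summed against [uu j]. *)
pose A1 j := - ((z + mst A z) * (q v (e_ j) * q v v) + rf A z v (e_ j) / N%:R * q v v).
pose A2 j := - ((z + mst A z) * (q v v * q (e_ j) v) + rf A z (e_ j) v / N%:R * q v v).
pose B1 j := - ((z + mst A z) * (q v (uu j) * q (e_ j) v) + rf A z (e_ j) (uu j) / N%:R * q v v).
pose B2 j := - ((z + mst A z) * (q v (e_ j) * q (uu j) v) + rf A z (uu j) (e_ j) / N%:R * q v v).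
pose F j := q (e_ j) v * (c1 * (A1 j + B1 j) + c2 * conjc (A2 j + B2 j)) - q (e_ j) v * q (e_ j) (uu j) * Wfun p X.
have M0 : 0 <= MM := le_trans (ltW psi_gt0) psiM.
have cJ (a b : 'I_N -> R[i]) : conjc (\sum_i a i * b i) = \sum_i conjc (a i) * conjc (b i).
  by rewrite rmorph_sum; apply: eq_bigr => i _; rewrite rmorphM.
have cJ' (a b : 'I_N -> R[i]) : conjc (\sum_i conjc (a i) * b i) = \sum_i a i * conjc (b i).
  by rewrite cJ; apply: eq_bigr => i _; rewrite conjcK.
(* The subtracted term is the one that cancels; it comes from the diagonal entry in [betaF]. *)
have Ej j : \sum_i conjc (v i ord0) * betaF p A z v i j + \sum_i uu j i ord0 * alphaF p A z v i j =
    F j - q (e_ j) (e_ j) * (q v v * Wfun p X).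
  have -> : \sum_i conjc (v i ord0) * betaF p A z v i j =
      q (e_ j) v * (c1 * A1 j + c2 * conjc (A2 j)) - q (e_ j) (e_ j) * q v v * Wfun p X.
    rewrite /A1 -dXl /A2 -dXr cJ [q v v](qf_coordl _ _ v v).
    exact: sum_lin_split.
  have -> : \sum_i uu j i ord0 * alphaF p A z v i j =
      q (e_ j) v * (c1 * B1 j + c2 * conjc (B2 j)) - q (e_ j) v * q (e_ j) (uu j) * Wfun p X.
    rewrite /B1 -dXr /B2 -dXl cJ' [q (e_ j) (uu j)](qf_coordr _ _ (e_ j) (uu j)).
    rewrite -sum_lin_split; apply: eq_bigr => i _; rewrite /alphaF.
    by rewrite (mulrC (q (e_ j) (e_ i))).
  rewrite /F rmorphD /=; exact: lin_collect.
have -> : mst A z * q v v * Wfun p X + (\sum_j (\sum_i conjc (v i ord0) * betaF p A z v i j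
     + \sum_i uu j i ord0 * alphaF p A z v i j)) / N%:R = (\sum_j F j) / N%:R.
  under eq_bigr do rewrite Ej.
  rewrite sumrB -mulr_suml mulrBl {1}/mst; exact: cancel_main.
rewrite cabs_div_nat ler_pdivrMr//.
apply: le_trans (cabs_sum _ _ _) _.
have cle k l r : (k <= 2 * p + 6)%N -> (l + r = 2 * p + 4)%N ->
    cabs (k%:R * X ^+ l * conjc X ^+ r) <= Gam * MM ^+ (2 * p + 4).
  move=> kp <-; rewrite exprD mulrA !(cabsM, cabsX, cabsJ) cabs_nat.
  have kG : k%:R <= Gam by apply: le_trans (rg_p rg); rewrite ler_nat.
  apply: ler_pM; rewrite ?mulr_ge0 ?exprn_ge0 ?cabs_ge0 ?ler0n//.
    by apply: ler_pM; rewrite ?exprn_ge0 ?cabs_ge0 ?ler0n// lerXn2r ?nnegrE ?cabs_ge0.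
  by rewrite lerXn2r ?nnegrE ?cabs_ge0.
have c1G : cabs c1 <= Gam * MM ^+ (2 * p + 4) by apply: cle; clear; lia.
have c2G : cabs c2 <= Gam * MM ^+ (2 * p + 4) by apply: cle; clear; lia.
have rG x y : cabs (q x x) <= Gam -> cabs (q y y) <= Gam -> cabs (rf A z x y / N%:R) <= Gam * nu.
  exact: rf_le.
pose D j := 2 * Gam ^+ 2 * bet A z v j + Gam ^+ 2 * nu.
have A1G j : cabs (A1 j) <= D j.
  by apply: dXb; [exact: (gd_vv gd)|exact: veb|apply: rG; [exact: (gd_vv gd)|exact: (gd_ee gd)]].
have A2G j : cabs (A2 j) <= D j.
  rewrite /A2 (mulrC (q v v) (q (e_ j) v)).
  by apply: dXb; [exact: (gd_vv gd)|exact: evb|apply: rG; [exact: (gd_ee gd)|exact: (gd_vv gd)]].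
have B1G j : cabs (B1 j) <= D j.
  rewrite /B1 (mulrC (q v (uu j)) (q (e_ j) v)).
  by apply: dXb; [exact: (gd_vu gd)|exact: evb|apply: rG; [exact: (gd_ee gd)|exact: (gd_uu gd)]].
have B2G j : cabs (B2 j) <= D j.
  by apply: dXb; [exact: (gd_uv gd)|exact: veb|apply: rG; [exact: (gd_uu gd)|exact: (gd_ee gd)]].
have FG j : cabs (F j) <= bet A z v j * (Gam * MM ^+ (2 * p + 4) * (D j + D j) + Gam * MM ^+ (2 * p + 4) * (D j + D j))
    + bet A z v j * Gam * MM ^+ (2 * p + 5).
  apply: cabs_lerB.
    apply: cabs_ler_pM; first exact: evb.
    apply: cabs_lerD; first exact: cabs_ler_pM c1G (cabs_lerD (A1G j) (B1G j)).
    by apply: (cabs_ler_pM c2G); rewrite cabsJ; exact: cabs_lerD (A2G j) (B2G j).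
  apply: cabs_ler_pM; first by apply: cabs_ler_pM; [exact: evb|exact: (gd_eu gd)].
  by rewrite cabs_Wfun lerXn2r ?nnegrE ?cabs_ge0.
have nupsi : nu <= psi by rewrite expr2 ler_piMl// ltW.
have e5 : MM ^+ (2 * p + 5) = MM ^+ (2 * p + 4) * MM by rewrite -exprSr; congr (_ ^+ _); clear; lia.
have := main_real Gam100 n_gt0 h_gt0 erefl psiM nupsi nu0 (exprn_ge0 (2 * p + 4) M0) sum_bet b2.
rewrite -e5 -nN; apply: le_trans.
apply: le_trans (ler_sum _ (fun j _ => FG j)) _.
rewrite !mulr_sumr -!big_split /=; apply: ler_sum => j _; apply: le_of_eq.
rewrite /D; exact: sum_bound_term.
Qed.

End Fixed.
End GoodEvent.

(** * Polynomial bounds valid everywhere *)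

Section CrudeBounds.
Local Open Scope complex_scope.
Variable R : rcfType.
Variables (N p : nat) (A : 'M[R[i]]_N) (z : R[i]) (v : 'cV[R[i]]_N).
Local Notation e_ := (@ebase R N).
Local Notation q := (qf A z).
Local Notation X := (Xst A z v).
Hypotheses (hA : hermitian A) (N0 : (0 < N)%N) (zI : 1 <= N%:R * complex.Im z) (zN : cabs z <= N%:R).
Hypothesis v1 : nrm2 v <= 1.

Let NR : (1 : R) <= N%:R. Proof. by rewrite ler1n. Qed.
Let N0R : (0 : R) < N%:R. Proof. by rewrite ltr0n. Qed.
Let im0 : 0 < complex.Im z.
Proof. by rewrite -(pmulr_rgt0 _ N0R); apply: lt_le_trans zI. Qed.

Let imV : (complex.Im z)^-1 <= N%:R.
Proof. by rewrite -[_^-1]mul1r ler_pdivrMr. Qed.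

Lemma qf_crude x y : nrm2 x <= 1 -> nrm2 y <= 1 -> cabs (q x y) <= N%:R.
Proof.
move=> x1 y1; apply: le_trans (qf_le x y hA im0) _.
rewrite -[leRHS]mul1r; apply: ler_pM => //; rewrite ?mulr_ge0 ?sqrtr_ge0 ?invr_ge0 ?(ltW im0)//.
by rewrite -[leRHS]mul1r; apply: ler_pM; rewrite ?sqrtr_ge0// -[leRHS]sqrtr1 ler_sqrt.
Qed.

Let e1 k : nrm2 (e_ k) <= 1. Proof. by rewrite nrm2_ebase. Qed.

Lemma rf_crude x y : nrm2 x <= 1 -> nrm2 y <= 1 -> cabs (rf A z x y / N%:R) <= N%:R ^+ 2.
Proof.
move=> x1 y1; rewrite cabs_div_nat ler_pdivrMr//.
apply: le_trans (qf_resr_le x y hA im0) _.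
have s w : nrm2 w <= 1 -> Num.sqrt (complex.Im (q w w)) <= Num.sqrt N%:R.
  by move=> w1; rewrite ler_sqrt// (le_trans (Im_qf_le _ _ _))// qf_crude.
apply: (@le_trans _ _ (N%:R * N%:R)); last by rewrite -expr2 ler_peMr// sqr_ge0.
apply: ler_pM => //; rewrite ?mulr_ge0 ?sqrtr_ge0 ?invr_ge0 ?(ltW im0)//.
by rewrite -[leRHS](sqr_sqrtr (ltW N0R)) expr2; apply: ler_pM; rewrite ?sqrtr_ge0 ?s.
Qed.

Lemma mst_crude : cabs (mst A z) <= N%:R.
Proof.
rewrite /mst cabs_div_nat ler_pdivrMr//.
apply: le_trans (cabs_sum _ _ _) _.
have -> : (N%:R * N%:R : R) = \sum_(k < N) N%:R by rewrite sumr_const card_ord mulr_natr.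
by apply: ler_sum => k _; exact: qf_crude.
Qed.

Let zm : cabs (z + mst A z) <= 2 * N%:R.
Proof. by rewrite mulr2n mulrDl !mul1r; apply: cabs_lerD => //; exact: mst_crude. Qed.

(** A power of N bounding all functionals on the bad event too. Only its degree in N matters, as the
    probability of that event will be a still smaller power. *)
Definition Lc : R := (2 * p + 7)%:R * (3 * N%:R ^+ 2) ^+ (2 * p + 6).

Let b := 3 * N%:R ^+ 2 : R.
Let N2 : (1 : R) <= N%:R ^+ 2. Proof. exact: exprn_ege1. Qed.
Let b1 : 1 <= b. Proof. by rewrite /b; have := N2; lra. Qed.
Let b0 : 0 <= b. Proof. exact: le_trans b1. Qed.
Let Nb : N%:R <= b.
Proof.
have h : (N%:R : R) <= N%:R ^+ 2 by rewrite expr2 ler_peMr // ltW.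
by rewrite /b; have := N2; lra.
Qed.

Lemma Xst_crude : cabs X <= b.
Proof.
rewrite /b /Xst; apply: (@le_trans _ _ (1 + 2 * N%:R * N%:R)).
  apply: cabs_lerD; first by rewrite cabs_real ger0_norm ?nrm2_ge0.
  by apply: cabs_ler_pM => //; exact: qf_crude.
by rewrite -mulrA -expr2; have := N2; lra.
Qed.

Let W_crude : cabs (Wfun p X) <= b ^+ (2 * p + 5).
Proof. by rewrite cabs_Wfun; apply: lerXn2r; rewrite ?nnegrE ?cabs_ge0 //; exact: Xst_crude. Qed.

Let dX_crude k l : cabs (dX A z v k l) <= b * N%:R.
Proof.
rewrite /dX cabsN /b.
have -> : 3 * N%:R ^+ 2 * N%:R = 2 * N%:R * (N%:R * N%:R) + N%:R ^+ 2 * N%:R :> R by ring.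
apply: cabs_lerD.
  by apply: cabs_ler_pM => //; apply: cabs_ler_pM; exact: qf_crude.
by apply: cabs_ler_pM; [exact: rf_crude|exact: qf_crude].
Qed.

Let LcE : Lc = (2 * p + 6)%:R * b ^+ (2 * p + 6) + b ^+ (2 * p + 6).
Proof. by rewrite /Lc -/b addnS -addn1 natrD mulrDl mul1r. Qed.

Let Xterm l r c d : (l + r = 2 * p + 4)%N -> cabs d <= b * N%:R ->
  cabs (c%:R * X ^+ l * conjc X ^+ r * d) <= c%:R * b ^+ (2 * p + 4) * (b * N%:R).
Proof.
move=> lr dN; apply: cabs_ler_pM => //; rewrite -lr exprD mulrA.
have x := Xst_crude.
apply: cabs_ler_pM; first apply: cabs_ler_pM; first by rewrite cabs_nat.
  by rewrite cabsX; apply: lerXn2r; rewrite ?nnegrE ?cabs_ge0.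
by rewrite cabsX cabsJ; apply: lerXn2r; rewrite ?nnegrE ?cabs_ge0.
Qed.

Let ab_crude (x1 x2 x3 : 'cV[R[i]]_N) x4 (y1 y2 : R[i]) :
  nrm2 x1 <= 1 -> nrm2 x2 <= 1 -> nrm2 x3 <= 1 -> nrm2 x4 <= 1 ->
  cabs y1 <= b * N%:R -> cabs y2 <= b * N%:R ->
  cabs (q x1 v * (p.+2%:R * X ^+ p.+1 * conjc X ^+ p.+3 * y1
     + p.+3%:R * X ^+ p.+2 * conjc X ^+ p.+2 * conjc y2)
  - q x2 x3 * q x4 v * Wfun p X) <= Lc.
Proof.
move=> h1 h2 h3 h4 k1 k2; rewrite LcE; apply: cabs_lerB.
  apply: (@le_trans _ _ (N%:R * (p.+2%:R * b ^+ (2 * p + 4) * (b * N%:R) + p.+3%:R * b ^+ (2 * p + 4) * (b * N%:R)))).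
    apply: cabs_ler_pM; first exact: qf_crude.
    by apply: cabs_lerD; apply: Xterm; rewrite ?cabsJ//; clear; lia.
  have -> : N%:R * (p.+2%:R * b ^+ (2 * p + 4) * (b * N%:R) + p.+3%:R * b ^+ (2 * p + 4) * (b * N%:R)) =
     (p.+2 + p.+3)%:R * (b ^+ (2 * p + 4) * (b * N%:R ^+ 2)) by rewrite natrD; ring.
  apply: ler_pM => //; first by rewrite !mulr_ge0 ?exprn_ge0.
    by rewrite ler_nat; clear; lia.
  have -> : b ^+ (2 * p + 6) = b ^+ (2 * p + 4) * (b * b) by rewrite -expr2 -exprD; congr (_ ^+ _); clear; lia.
  apply: ler_wpM2l; first exact: exprn_ge0.
  by apply: ler_wpM2l => //; rewrite /b; have := N2; lra.
have -> : b ^+ (2 * p + 6) = b * b ^+ (2 * p + 5) by rewrite -exprS; congr (_ ^+ _); clear; lia.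
apply: cabs_ler_pM => //; apply: (@le_trans _ _ (N%:R * N%:R)).
  by apply: cabs_ler_pM; exact: qf_crude.
by rewrite /b -expr2; have := N2; lra.
Qed.

Lemma alphaF_crude i j : cabs (alphaF p A z v i j) <= Lc.
Proof. exact: ab_crude. Qed.

Lemma betaF_crude i j : cabs (betaF p A z v i j) <= Lc.
Proof. exact: ab_crude. Qed.

Let b6 : b ^+ (2 * p + 6) <= Lc.
Proof. by rewrite LcE lerDr mulr_ge0// exprn_ge0. Qed.

Lemma Psi_crude j : cabs (Psi p A z v j) <= Lc.
Proof.
apply: le_trans b6.
have -> : b ^+ (2 * p + 6) = b * b ^+ (2 * p + 5) by rewrite -exprS; congr (_ ^+ _); clear; lia.
by apply: cabs_ler_pM => //; apply: le_trans Nb; exact: qf_crude.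
Qed.

Lemma main_crude (uu : 'I_N -> 'cV[R[i]]_N) : (forall j, nrm2 (uu j) <= 1) ->
  cabs (mst A z * q v v * Wfun p X + (\sum_j (\sum_i conjc (v i ord0) * betaF p A z v i j
     + \sum_i uu j i ord0 * alphaF p A z v i j)) / N%:R) <= 3 * N%:R * Lc.
Proof.
move=> uu1; have L0 : 0 <= Lc by rewrite /Lc mulr_ge0// exprn_ge0.
have x1 x i : nrm2 x <= 1 -> cabs (x i ord0 : R[i]) <= 1.
  move=> h; rewrite -(@expr_le1 _ 2)// ?cabs_ge0//; apply: le_trans h.
  by rewrite /nrm2 (bigD1 i)//= lerDl sumr_ge0// => k _; exact: sqr_ge0.
have s1 (x : 'cV[R[i]]_N) (F : 'I_N -> R[i]) : (forall i, cabs (x i ord0) <= 1) -> (forall i, cabs (F i) <= Lc) ->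
    cabs (\sum_i x i ord0 * F i) <= N%:R * Lc.
  move=> h hF; apply: le_trans (cabs_sum _ _ _) _.
  have -> : N%:R * Lc = \sum_(k < N) Lc by rewrite sumr_const card_ord mulr_natl.
  by apply: ler_sum => k _; rewrite -[leRHS]mul1r; exact: cabs_ler_pM.
apply: (@le_trans _ _ (Lc + 2 * N%:R * Lc)); last first.
  by have := mulr_ge0 L0 (ler0n R N); have := ler_wpM2r L0 NR; lra.
apply: cabs_lerD.
  apply: le_trans b6.
  have -> : b ^+ (2 * p + 6) = b * b ^+ (2 * p + 5) by rewrite -exprS; congr (_ ^+ _); clear; lia.
  apply: cabs_ler_pM => //; apply: (@le_trans _ _ (N%:R * N%:R)).
    by apply: cabs_ler_pM; [exact: mst_crude|exact: qf_crude].
  by rewrite /b -expr2; have := N2; lra.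
rewrite cabs_div_nat ler_pdivrMr//; apply: le_trans (cabs_sum _ _ _) _.
have -> : 2 * N%:R * Lc * N%:R = \sum_(k < N) (N%:R * Lc + N%:R * Lc).
  by rewrite sumr_const card_ord -mulr_natr; ring.
apply: ler_sum => k _; apply: cabs_lerD; last first.
  by apply: s1 => i; [exact: x1|exact: alphaF_crude].
rewrite -[\sum_i _]conjcK cabsJ rmorph_sum.
under eq_bigr do rewrite rmorphM /= conjcK.
by apply: s1 => i; rewrite ?cabsJ; [exact: x1|exact: betaF_crude].
Qed.

End CrudeBounds.

(** * Measurability of the functionals *)

Section FunctionalMeasurability.
Local Open Scope complex_scope.
Variables (R : realType) (N : nat) (d : measure_display) (T : measurableType d).
Variables (F : T -> 'M[R[i]]_N) (z : R[i]) (v : 'cV[R[i]]_N) (p : nat).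
Hypothesis mF : forall i j, cmeas (fun w => F w i j).
Local Notation e_ := (@ebase R N).

Lemma cmeas_mst : cmeas (fun w => mst (F w) z).
Proof.
apply: cmeasM; last exact: cmeas_cst.
by apply: cmeas_sum => k; exact: cmeas_qf.
Qed.

Lemma cmeas_Xst : cmeas (fun w => Xst (F w) z v).
Proof.
apply: cmeasD; first exact: cmeas_cst.
apply: cmeasM; last exact: cmeas_qf.
by apply: cmeasD; [exact: cmeas_cst|exact: cmeas_mst].
Qed.

Lemma cmeas_rf x y : cmeas (fun w => rf (F w) z x y).
Proof.
under eq_fun do rewrite rf_sum.
by apply: cmeas_sum => k; apply: cmeasM; exact: cmeas_qf.
Qed.

Lemma cmeas_dX a b : cmeas (fun w => dX (F w) z v a b).
Proof.
have q x y : cmeas (fun w => qf (F w) z x y) by exact: cmeas_qf.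
apply: cmeasN; apply: cmeasD; apply: cmeasM => //.
- by apply: cmeasD; [exact: cmeas_cst|exact: cmeas_mst].
- exact: cmeasM.
- by apply: cmeasM; [exact: cmeas_rf|exact: cmeas_cst].
Qed.

Lemma cmeas_Wfun : cmeas (fun w => Wfun p (Xst (F w) z v)).
Proof. by apply: cmeasM; apply: cmeasX; [|apply: cmeasJ]; exact: cmeas_Xst. Qed.

Lemma cmeas_Psi j : cmeas (fun w => Psi p (F w) z v j).
Proof. by apply: cmeasM; [exact: cmeas_qf|exact: cmeas_Wfun]. Qed.

Let cmeas_ab (x1 x2 x3 x4 : 'cV[R[i]]_N) (y1 y2 : T -> R[i]) : cmeas y1 -> cmeas y2 ->
  cmeas (fun w => qf (F w) z x1 v * (p.+2%:R * Xst (F w) z v ^+ p.+1 * conjc (Xst (F w) z v) ^+ p.+3 * y1 w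
     + p.+3%:R * Xst (F w) z v ^+ p.+2 * conjc (Xst (F w) z v) ^+ p.+2 * conjc (y2 w))
  - qf (F w) z x2 x3 * qf (F w) z x4 v * Wfun p (Xst (F w) z v)).
Proof.
move=> m1 m2; have q x y : cmeas (fun w => qf (F w) z x y) by exact: cmeas_qf.
have X c l r : cmeas (fun w => c%:R * Xst (F w) z v ^+ l * conjc (Xst (F w) z v) ^+ r).
  apply: cmeasM; [apply: cmeasM; [exact: cmeas_cst|exact: cmeasX cmeas_Xst]|].
  by apply: cmeasX; exact: cmeasJ cmeas_Xst.
apply: cmeasB; apply: cmeasM => //.
- by apply: cmeasD; apply: cmeasM => //; exact: cmeasJ.
- exact: cmeasM.
- exact: cmeas_Wfun.
Qed.

Lemma cmeas_alphaF i j : cmeas (fun w => alphaF p (F w) z v i j).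
Proof. by apply: cmeas_ab; exact: cmeas_dX. Qed.

Lemma cmeas_betaF i j : cmeas (fun w => betaF p (F w) z v i j).
Proof. by apply: cmeas_ab; exact: cmeas_dX. Qed.

End FunctionalMeasurability.

(** * High moments of X *)

Section IntegrationByParts.
Local Open Scope complex_scope.
Variables (R : realType) (N : nat) (d : measure_display) (T : measurableType d).
Variables (P : probability T R) (H : T -> 'M[R[i]]_N).
Hypothesis Hh : forall w, hermitian (H w).
Hypothesis Hi : entry_indep P H.
Hypothesis Hn : forall i j, cnice P (fun w => H w i j).
Hypothesis H0 : forall i j, cE P (fun w => H w i j) = 0.
Hypothesis H2 : forall i j, EE P (fun w => cabs (H w i j) ^+ 2) = N%:R^-1.

Local Notation PP := (P \x P)%E.
Let P1 : P setT = 1%E := probability_setT P.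
Let PP1 : PP setT = 1%E := PP_setT P.
Let Hm i j : cmeas (fun w => H w i j). Proof. by case: (Hn i j). Qed.

(** A diagonal entry is real and moves a single position; its variance is already counted in the
    term with 1/N, hence the value 0 there. *)
Definition kap i j : R[i] := if i == j then 0 else cE P (fun w => H w i j ^+ 2).
Definition dt i j (w : T * T) : R[i] := H w.2 i j - H w.1 i j.
Definition dt' i j (w : T * T) : R[i] := if i == j then 0 else conjc (dt i j w).

Lemma cE_HHJ i j : cE P (fun w => H w i j * conjc (H w i j)) = (N%:R)^-1.
Proof.
under eq_fun do rewrite cabs_mulJ.
by rewrite (cE_real P1) H2 fmorphV rmorph_nat.
Qed.

Lemma kap_le i j : cabs (kap i j) <= N%:R^-1.
Proof.
rewrite /kap; case: ifP => _; first by rewrite cabs0 invr_ge0.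
have h := cabs_cE P1 (cniceX P1 2 (Hn i j)); apply: le_trans h _.
by under eq_fun do rewrite cabsX; rewrite H2.
Qed.

Lemma cE_prod_mean0 i j (F : T -> R[i]) : cnice P F ->
  cE PP (fun w => F w.1 * H w.2 i j) = 0.
Proof. by move=> hF; rewrite (cE_prod hF (Hn i j)) H0 mulr0. Qed.

(** E h F(H) equals E h' F at the modified matrix, and E h' F(H) = 0 may be subtracted. In the
    linear part, E h' (h' - h) = E h'^2 multiplies a and E h' conj (h' - h) = 1/N multiplies b. *)
Lemma integration_by_parts i j (F a b : mspace R N -> R[i]) : cmeas F ->
  cnice P (fun w => F (H w)) -> cnice P (fun w => a (H w)) -> cnice P (fun w => b (H w)) ->
  (i = j -> forall A, a A = b A) ->
  cE P (fun w => H w i j * F (H w)) =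
  kap i j * cE P (fun w => a (H w)) + N%:R^-1 * cE P (fun w => b (H w))
  + cE PP (fun w => H w.2 i j * (F (Hrepl H i j w) - F (H w.1)
         - (dt i j w * a (H w.1) + dt' i j w * b (H w.1)))).
Proof.
move=> mF nF na nb ab.
have nJ : cnice P (fun w => conjc (H w i j)) := cniceJ (Hn i j).
have n2 : cnice P (fun w => H w i j ^+ 2) := cniceX P1 2 (Hn i j).
have nHJ : cnice P (fun w => H w i j * conjc (H w i j)) := cniceM (Hn i j) nJ.
have f1 G : cnice P G -> cnice PP (fun w => G w.1) by exact: cnice_fst.
have f2 G : cnice P G -> cnice PP (fun w => G w.2) by exact: cnice_snd.
have g1 : cnice PP (fun w => H w.1 i j) := f1 _ (Hn i j).
have g2 : cnice PP (fun w => H w.2 i j) := f2 _ (Hn i j).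
have a1 : cnice PP (fun w => a (H w.1)) := f1 _ na.
have b1 : cnice PP (fun w => b (H w.1)) := f1 _ nb.
have k1 : cnice PP (fun w => F (H w.1)) := f1 _ nF.
have ndt : cnice PP (dt i j) := cniceB g2 g1.
pose main w : R[i] := H w.2 i j * (dt i j w * a (H w.1) + dt' i j w * b (H w.1)).
have ndt' : cnice PP (dt' i j).
  rewrite /dt'; case: (i == j); first exact: (cnice_cst PP1).
  exact: cniceJ ndt.
have nmain1 : cnice PP (fun w => H w.2 i j * (dt i j w * a (H w.1))) := cniceM g2 (cniceM ndt a1).
have nmain2 : cnice PP (fun w => H w.2 i j * (dt' i j w * b (H w.1))) := cniceM g2 (cniceM ndt' b1).
have nmain : cnice PP main := cniceM g2 (cniceD (cniceM ndt a1) (cniceM ndt' b1)).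
have nF1 : cnice PP (fun w => H w.2 i j * F (H w.1)) := cniceM g2 k1.
have nrep : cnice PP (fun w => H w.2 i j * F (Hrepl H i j w)) := cniceM g2 (cnice_Hrepl Hh Hm Hi i j mF nF).
have e0 : cE P (fun w => H w i j * F (H w)) = cE PP (fun w => H w.2 i j * F (Hrepl H i j w)).
  rewrite -(cE_Hrepl Hh Hm Hi i j (F := fun A => A i j * F A)).
  - by congr (cE PP _); apply/funext => w; rewrite mxE !eqxx.
  - by apply: cmeasM mF; exact: cmeas_entry.
  - exact: (cniceM (Hn i j) nF).
have ea : cE PP (fun w => H w.2 i j * (dt i j w * a (H w.1))) =
    cE P (fun w => H w i j ^+ 2) * cE P (fun w => a (H w)).
  have -> : (fun w => H w.2 i j * (dt i j w * a (H w.1))) =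
    (fun w : T * T => a (H w.1) * H w.2 i j ^+ 2 - (H w.1 i j * a (H w.1)) * H w.2 i j).
    by apply/funext => w; rewrite /dt; move: (H w.2 i j) (H w.1 i j) (a _) => x y k; ring.
  rewrite (cEB PP1); last first.
  - exact: (cniceM (cniceM g1 a1) g2).
  - exact: (cniceM a1 (cniceX PP1 2 g2)).
  rewrite (cE_prod_mean0 i j (F := fun w => H w i j * a (H w))) ?subr0; last exact: (cniceM (Hn i j) na).
  by rewrite (cE_prod (F := fun w => a (H w)) (G := fun w => H w i j ^+ 2)) // mulrC.
have eb : i != j -> cE PP (fun w => H w.2 i j * (dt' i j w * b (H w.1))) =
    N%:R^-1 * cE P (fun w => b (H w)).
  move=> ij.
  have -> : (fun w => H w.2 i j * (dt' i j w * b (H w.1))) =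
    (fun w : T * T => b (H w.1) * (H w.2 i j * conjc (H w.2 i j)) - (conjc (H w.1 i j) * b (H w.1)) * H w.2 i j).
    apply/funext => w; rewrite /dt' (negbTE ij) /dt rmorphB /=.
    by move: (H w.2 i j) (conjc (H w.2 i j)) (conjc (H w.1 i j)) (b _) => x x' y k; ring.
  rewrite (cEB PP1); last first.
  - exact: (cniceM (cniceM (cniceJ g1) b1) g2).
  - exact: (cniceM b1 (cniceM g2 (cniceJ g2))).
  rewrite (cE_prod_mean0 i j (F := fun w => conjc (H w i j) * b (H w))) ?subr0; last exact: (cniceM nJ nb).
  by rewrite (cE_prod (F := fun w => b (H w)) (G := fun w => H w i j * conjc (H w i j))) // cE_HHJ mulrC.
have em : cE PP main = kap i j * cE P (fun w => a (H w)) + N%:R^-1 * cE P (fun w => b (H w)).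
  rewrite /main; under eq_fun do rewrite mulrDr.
  rewrite (cED nmain1 nmain2) ea /kap; case: (eqVneq i j) => [ij|ij]; last by rewrite eb.
  rewrite mul0r add0r.
  have -> : (fun w => H w.2 i j * (dt' i j w * b (H w.1))) = fun=> 0.
    by apply/funext => w; rewrite /dt' ij eqxx mul0r mulr0.
  rewrite (cE_cst PP1) addr0; congr (_ * _); last first.
    by congr (cE P _); apply/funext => w; exact: ab.
  rewrite -(cE_HHJ i j); congr (cE P _); apply/funext => w.
  by rewrite expr2; congr (_ * _); rewrite ij -Hh.
rewrite e0 -em -(cED nmain); last first.
  have -> : (fun w => H w.2 i j * (F (Hrepl H i j w) - F (H w.1) - (dt i j w * a (H w.1) + dt' i j w * b (H w.1)))) =
    (fun w => H w.2 i j * F (Hrepl H i j w) - H w.2 i j * F (H w.1) - main w).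
    by apply/funext => w; rewrite !mulrBr.
  exact: (cniceB (cniceB nrep nF1) nmain).
have -> : (fun w => main w + H w.2 i j * (F (Hrepl H i j w) - F (H w.1) - (dt i j w * a (H w.1) + dt' i j w * b (H w.1)))) =
  (fun w => H w.2 i j * F (Hrepl H i j w) - F (H w.1) * H w.2 i j).
  by apply/funext => w; rewrite !mulrBr /main (mulrC (F (H w.1))) addrC subrK.
rewrite (cEB PP1 nrep (cniceM k1 g2)).
by rewrite (cE_prod_mean0 i j nF) subr0.
Qed.

End IntegrationByParts.

(** Young's inequality by comparing Y with l a; for l = 2^(k+1) the case of large Y gives exactly
    half of Y^(k+1), which can be absorbed. *)
Lemma young_pow (R : realFieldType) (Y a : R) k : 0 <= Y -> 0 <= a ->
  a * (Y + a) ^+ k <= Y ^+ k.+1 / 2 + (2 ^+ k.+1 + 1) ^+ k * a ^+ k.+1.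
Proof.
move=> Y0 a0; set l : R := 2 ^+ k.+1.
have l1 : 1 <= l by rewrite exprn_ege1// ler1n.
have l0 : 0 < l by exact: lt_le_trans l1.
case: (leP Y (l * a)) => h.
  apply: (@le_trans _ _ (a * ((l + 1) * a) ^+ k)).
    apply: ler_wpM2l => //; apply: lerXn2r; rewrite ?nnegrE ?addr_ge0 ?mulr_ge0 ?addr_ge0 ?(ltW l0)//.
    by rewrite mulrDl mul1r lerD2r.
  have -> : a * ((l + 1) * a) ^+ k = (l + 1) ^+ k * a ^+ k.+1 by rewrite exprMn mulrCA -exprS.
  by rewrite lerDr divr_ge0// exprn_ge0.
apply: (@le_trans _ _ (Y ^+ k.+1 / 2)); last first.
  by rewrite lerDl mulr_ge0// exprn_ge0// addr_ge0// ltW.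
have aY : a <= Y / l by rewrite ler_pdivlMr// mulrC ltW.
have Ya : Y + a <= 2 * Y.
  have : Y / l <= Y by rewrite ler_pdivrMr// ler_peMr.
  by move: (Y / l) aY => b; lra.
apply: (@le_trans _ _ (Y / l * (2 * Y) ^+ k)).
  by apply: ler_pM; rewrite ?exprn_ge0 ?addr_ge0//; apply: lerXn2r; rewrite ?nnegrE ?addr_ge0 ?mulr_ge0.
have -> : Y / l * (2 * Y) ^+ k = Y ^+ k.+1 / 2.
  by rewrite /l exprMn [Y ^+ k.+1]exprS [2 ^+ k.+1]exprS; field; rewrite expf_neq0// pnatr_eq0.
by [].
Qed.

(** * The moment bound for X *)

Section MomentBound.
Local Open Scope complex_scope.
Variables (R : realType) (N : nat) (d : measure_display) (T : measurableType d).
Variables (P : probability T R) (H : T -> 'M[R[i]]_N).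
Hypothesis Hh : forall w, hermitian (H w).
Hypothesis Hi : entry_indep P H.
Hypothesis Hn : forall i j, cnice P (fun w => H w i j).
Hypothesis H0 : forall i j, cE P (fun w => H w i j) = 0.
Hypothesis H2 : forall i j, EE P (fun w => cabs (H w i j) ^+ 2) = N%:R^-1.
Variable C4 : R.
Hypothesis H4 : forall i j, EE P (fun w => cabs (H w i j) ^+ 4) <= C4.

Variables (p : nat) (z : R[i]) (v : 'cV[R[i]]_N) (Gam : R).
Hypotheses (rg : regime N p z Gam) (zI : 1 <= N%:R * complex.Im z) (zN : cabs z <= N%:R).
Hypothesis v1 : nrm2 v <= 1.

(* Chosen so that the sums over i of kap i j * conj (v i) times a resolvent entry are again
   entries of the resolvent. *)
Definition kapv j : 'cV[R[i]]_N := \col_i (N%:R * kap P H i j * conjc (v i ord0)).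

Variables (A : set T) (e : R).
Hypotheses (mA : measurable A) (e0 : 0 < e) (e1 : e <= 1) (PA : fine (P A) <= e ^+ 2).
Hypothesis hA : forall w, ~ A w -> good (H w) z v kapv Gam /\ forall i j, cabs (H w i j) <= Gam * nn_ R N.

Local Notation PP := (P \x P)%E.
Local Notation e_ := (@ebase R N).
Let P1 : P setT = 1%E := probability_setT P.
Let PP1 : PP setT = 1%E := PP_setT P.
Let Hm i j : cmeas (fun w => H w i j). Proof. by case: (Hn i j). Qed.
Local Notation X w := (Xst (H w) z v).
Local Notation k := (2 * p + 6)%N.
Let N0 : (0 < N)%N := rg_N rg.
Let N0R : (0 : R) < N%:R. Proof. by rewrite ltr0n. Qed.
Let im0 := rg_im rg.
Let z0 : complex.Im z != 0. Proof. by rewrite gt_eqF. Qed.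

(** Since A G = 1 + z G, X is m times the form at v plus <v, A G v>. The entries of the matrix now
    stand in front linearly, ready for the integration by parts. *)
Lemma Xst_mul_Wfun B : hermitian B -> Xst B z v * Wfun p (Xst B z v) =
  mst B z * qf B z v v * Wfun p (Xst B z v) + \sum_i \sum_j conjc (v i ord0) * (B i j * Psi p B z v j).
Proof.
move=> hB; have hX : Xst B z v = mst B z * qf B z v v + dotc v (B *m (res B z *m v)).
  by rewrite (qf_res_mul v hB z0) /Xst mulrDl addrA addrC.
rewrite {1}hX mulrDl; congr (_ + _); rewrite /dotc mulr_suml; apply: eq_bigr => i _.
rewrite -mulrA -mulr_sumr; congr (_ * _); rewrite mxE mulr_suml; apply: eq_bigr => j _.
by rewrite /Psi qf_e mulrA.
Qed.

(** |E h^2| <= E |h|^2 = 1/N, so the factor N only compensates: the vector stays in the unit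
    ball. *)
Lemma nrm2_kapv j : nrm2 (kapv j) <= 1.
Proof.
apply: le_trans v1; apply: ler_sum => i _; rewrite mxE.
apply: lerXn2r; rewrite ?nnegrE ?cabs_ge0//.
rewrite cabsM (cabsM N%:R) cabs_nat cabsJ ler_piMl ?cabs_ge0//.
by rewrite -[leRHS](divff (x := N%:R)) ?gt_eqF// ler_wpM2l// kap_le.
Qed.

(** S1 collects m times the form at v and the two derivative terms, where the cancellation takes
    place; S2 is the third-order remainder. *)
Let S1 w : R[i] := mst (H w) z * qf (H w) z v v * Wfun p (X w) +
  (\sum_j (\sum_i conjc (v i ord0) * betaF p (H w) z v i j
     + \sum_i kapv j i ord0 * alphaF p (H w) z v i j)) / N%:R.
Let Rem i j (w : T * T) : R[i] := Psi p (Hrepl H i j w) z v j - Psi p (H w.1) z v j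
  - (dt H i j w * alphaF p (H w.1) z v i j + dt' H i j w * betaF p (H w.1) z v i j).
Let S2 (w : T * T) : R[i] := \sum_i \sum_j conjc (v i ord0) * (H w.2 i j * Rem i j w).

Let L := Lc R N p.
Let nPsi j : cnice P (fun w => Psi p (H w) z v j).
Proof.
apply: (cnice_bounded P1 (c := L)); first exact: cmeas_Psi.
by move=> w; apply: Psi_crude.
Qed.
Let nal i j : cnice P (fun w => alphaF p (H w) z v i j).
Proof.
apply: (cnice_bounded P1 (c := L)); first exact: cmeas_alphaF.
by move=> w; apply: alphaF_crude.
Qed.
Let nbe i j : cnice P (fun w => betaF p (H w) z v i j).
Proof.
apply: (cnice_bounded P1 (c := L)); first exact: cmeas_betaF.
by move=> w; apply: betaF_crude.
Qed.
Let nX : cnice P (fun w => X w).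
Proof.
apply: (cnice_bounded P1 (c := 3 * N%:R ^+ 2)); first exact: cmeas_Xst.
by move=> w; apply: Xst_crude.
Qed.
Let ng x y : nrm2 x <= 1 -> nrm2 y <= 1 -> cnice P (fun w => qf (H w) z x y).
Proof.
move=> x1 y1; apply: (cnice_bounded P1 (c := N%:R)); first exact: cmeas_qf.
by move=> w; apply: qf_crude.
Qed.
Let nm : cnice P (fun w => mst (H w) z).
Proof.
apply: (cnice_bounded P1 (c := N%:R)); first exact: cmeas_mst.
by move=> w; apply: mst_crude.
Qed.
Let nW : cnice P (fun w => Wfun p (X w)).
Proof. exact: (cniceM (cniceX P1 _ nX) (cniceX P1 _ (cniceJ nX))). Qed.

Let nRem i j : cnice PP (Rem i j).
Proof.
have g1 : cnice PP (fun w => H w.1 i j) := cnice_fst (Hn i j).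
have g2 : cnice PP (fun w => H w.2 i j) := cnice_snd (Hn i j).
have a1 : cnice PP (fun w => alphaF p (H w.1) z v i j) := cnice_fst (nal i j).
have b1 : cnice PP (fun w => betaF p (H w.1) z v i j) := cnice_fst (nbe i j).
have k1 : cnice PP (fun w => Psi p (H w.1) z v j) := cnice_fst (nPsi j).
have ndt : cnice PP (dt H i j) := cniceB g2 g1.
have ndt' : cnice PP (dt' H i j).
  rewrite /dt'; case: (i == j); first exact: (cnice_cst PP1).
  exact: cniceJ ndt.
have nr : cnice PP (fun w => Psi p (Hrepl H i j w) z v j).
  apply: (cnice_Hrepl Hh Hm Hi i j (F := fun B => Psi p B z v j)); last exact: nPsi.
  by apply: cmeas_Psi => a b; exact: cmeas_entry.
exact: (cniceB (cniceB nr k1) (cniceD (cniceM ndt a1) (cniceM ndt' b1))).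
Qed.

Let nS1 : cnice P S1.
Proof.
apply: cniceD; first exact: (cniceM (cniceM nm (ng v1 v1)) nW).
apply: cniceM; last exact: (cnice_cst P1).
apply: (cnice_sum P1) => j; apply: cniceD; apply: (cnice_sum P1) => i.
  exact: (cniceM (cnice_cst P1 _) (nbe i j)).
exact: (cniceM (cnice_cst P1 _) (nal i j)).
Qed.

Let nS2 : cnice PP S2.
Proof.
apply: (cnice_sum PP1) => i; apply: (cnice_sum PP1) => j.
exact: (cniceM (cnice_cst PP1 _) (cniceM (cnice_snd (Hn i j)) (nRem i j))).
Qed.

Lemma moment_identity : cE P (fun w => X w * Wfun p (X w)) = cE P S1 + cE PP S2.
Proof.
have nmgW : cnice P (fun w => mst (H w) z * qf (H w) z v v * Wfun p (X w)) :=
  cniceM (cniceM nm (ng v1 v1)) nW.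
have nhp i j : cnice P (fun w => conjc (v i ord0) * (H w i j * Psi p (H w) z v j)) :=
  cniceM (cnice_cst P1 _) (cniceM (Hn i j) (nPsi j)).
have -> : (fun w => X w * Wfun p (X w)) = fun w =>
    mst (H w) z * qf (H w) z v v * Wfun p (X w) + \sum_i \sum_j conjc (v i ord0) * (H w i j * Psi p (H w) z v j).
  by apply/funext => w; exact: Xst_mul_Wfun.
rewrite (cED nmgW); last by apply: (cnice_sum P1) => i; exact: (cnice_sum P1).
have nb i j : cnice P (fun w => conjc (v i ord0) * betaF p (H w) z v i j) := cniceM (cnice_cst P1 _) (nbe i j).
have na i j : cnice P (fun w => kapv j i ord0 * alphaF p (H w) z v i j) := cniceM (cnice_cst P1 _) (nal i j).
have -> : cE P S1 = cE P (fun w => mst (H w) z * qf (H w) z v v * Wfun p (X w)) +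
    \sum_i \sum_j conjc (v i ord0) * (kap P H i j * cE P (fun w => alphaF p (H w) z v i j)
      + N%:R^-1 * cE P (fun w => betaF p (H w) z v i j)).
  have nS j : cnice P (fun w => \sum_i conjc (v i ord0) * betaF p (H w) z v i j
     + \sum_i kapv j i ord0 * alphaF p (H w) z v i j).
    by apply: cniceD; exact: (cnice_sum P1).
  rewrite /S1 (cED nmgW); last exact: (cniceM (cnice_sum P1 _ _ nS) (cnice_cst P1 _)).
  congr (_ + _).
  have -> : (fun w => (\sum_j (\sum_i conjc (v i ord0) * betaF p (H w) z v i j
     + \sum_i kapv j i ord0 * alphaF p (H w) z v i j)) / N%:R) = fun w =>
       N%:R^-1 * (\sum_j (\sum_i conjc (v i ord0) * betaF p (H w) z v i j
     + \sum_i kapv j i ord0 * alphaF p (H w) z v i j)) by apply/funext => w; rewrite mulrC.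
  rewrite (cEZ P1 _ (cnice_sum P1 _ _ nS)) (cE_sum P1 _ _ nS) exchange_big mulr_sumr /=; apply: eq_bigr => j _.
  rewrite (cED (cnice_sum P1 _ _ (fun i => nb i j)) (cnice_sum P1 _ _ (fun i => na i j))).
  rewrite (cE_sum P1 _ _ (fun i => nb i j)) (cE_sum P1 _ _ (fun i => na i j)) -big_split mulr_sumr /=.
  apply: eq_bigr => i _; rewrite (cEZ P1 _ (nbe i j)) (cEZ P1 _ (nal i j)) mxE.
  move: (cE P _) (cE P _) (conjc _) (kap _ _ _ _) => b a c l.
  have NV : N%:R^-1 * N%:R = 1 :> R[i] by rewrite mulVf// pnatr_eq0 -lt0n.
  by rewrite mulrDr !mulrA NV mul1r mulrDr addrC; congr (_ + _); ring.
rewrite -addrA; congr (_ + _).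
have -> : cE PP S2 = \sum_i \sum_j conjc (v i ord0) * cE PP (fun w => H w.2 i j * Rem i j w).
  have nr i j : cnice PP (fun w => H w.2 i j * Rem i j w) := cniceM (cnice_snd (Hn i j)) (nRem i j).
  have nr' i j : cnice PP (fun w => conjc (v i ord0) * (H w.2 i j * Rem i j w)) := cniceM (cnice_cst PP1 _) (nr i j).
  rewrite (cE_sum PP1); last by move=> i; exact: (cnice_sum PP1).
  apply: eq_bigr => i _; rewrite (cE_sum PP1)//; apply: eq_bigr => j _.
  by rewrite (cEZ PP1 _ (nr i j)).
rewrite -big_split (cE_sum P1); last by move=> i; exact: (cnice_sum P1).
apply: eq_bigr => i _; rewrite (cE_sum P1)// -big_split; apply: eq_bigr => j _ /=.
rewrite (cEZ P1 _ (cniceM (Hn i j) (nPsi j))) -mulrDr; congr (_ * _).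
apply: (integration_by_parts Hh Hi Hn H0 H2 (F := fun B => Psi p B z v j)
  (a := fun B => alphaF p B z v i j) (b := fun B => betaF p B z v i j)) => //.
  by apply: cmeas_Psi => a b; exact: cmeas_entry.
by move=> <-.
Qed.

Lemma repl_sub (B : 'M[R[i]]_N) (i j : 'I_N) (t : R[i]) : hermitian B ->
  repl B i j t - B = (t - B i j) *: delta_mx i j
    + (if i == j then 0 else conjc (t - B i j)) *: delta_mx j i.
Proof.
move=> hB; apply/matrixP => a b; rewrite !mxE.
case: (boolP ((a == i) && (b == j))) => [/andP[/eqP -> /eqP ->]|h1] /=.
  by case: (eqVneq i j) => [->|ij]; rewrite ?eqxx /= ?mulr1 ?mulr0 ?mul0r ?addr0// ?(negbTE ij) ?mulr0 ?addr0.
case: (boolP ((a == j) && (b == i))) => [/andP[/eqP aj /eqP bi]|h2] /=; last by rewrite subrr !mulr0 addr0.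
have ij : i == j = false by apply/negbTE; apply: contraNneq h1 => ij; rewrite aj bi ij eqxx.
by rewrite ij aj bi rmorphB /= -hB mulr0 add0r mulr1.
Qed.

Let Y w := MM (H w) z v Gam.
Let psi := psi_ N z.
Let psi0 : 0 <= psi. Proof. by rewrite /psi /psi_ divr_ge0 ?sqrtr_ge0// invr_ge0 sqrtr_ge0. Qed.
Let G0 : 0 <= Gam. Proof. by apply: le_trans (rg_Gam rg). Qed.
Let G1 : 1 <= Gam. Proof. by apply: le_trans (rg_Gam rg); rewrite ler1n. Qed.
Let Y0 w : 0 <= Y w.
Proof. exact: (addr_ge0 (cabs_ge0 _) (mulr_ge0 (exprn_ge0 _ G0) psi0)). Qed.
Let L0 : 0 <= L. Proof. by rewrite /L /Lc mulr_ge0// exprn_ge0// mulr_ge0// exprn_ge0. Qed.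

Let k0 w : 0 <= Gam ^+ 29 * psi * Y w ^+ (2 * p + 5).
Proof. exact: (mulr_ge0 (mulr_ge0 (exprn_ge0 _ G0) psi0) (exprn_ge0 _ (Y0 w))). Qed.

Let S1_le w : cabs (S1 w) <= Gam ^+ 29 * psi * Y w ^+ (2 * p + 5) + 3 * N%:R * L * \1_A w.
Proof.
rewrite indicE; case: (boolP (w \in A)) => [|/negP]; rewrite inE => Aw.
  rewrite mulr1; apply: (@le_trans _ _ (3 * N%:R * L)); last first.
    by rewrite lerDr; exact: k0.
  exact: (main_crude p (Hh w) N0 zI zN v1 nrm2_kapv).
rewrite mulr0 addr0; have [gd _] := hA Aw.
apply: le_trans (main_sum_le (Hh w) rg gd) _.
apply: ler_wpM2r; first exact: (exprn_ge0 _ (Y0 w)).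
by apply: (ler_wpM2r psi0); apply: ler_weXn2l.
Qed.

(** On the bad event S2 is not bounded by a constant, because it contains the entries themselves;
    their fourth moments will control Z. *)
Let Z (w : T * T) : R := 2 * L * \sum_i \sum_j (cabs (H w.2 i j) * (1 + cabs (H w.2 i j) + cabs (H w.1 i j))).

Let Z0 w : 0 <= Z w.
Proof.
apply: mulr_ge0; first by rewrite mulr_ge0.
apply: sumr_ge0 => i _; apply: sumr_ge0 => j _.
by rewrite mulr_ge0 ?addr_ge0 ?cabs_ge0.
Qed.

Let S2_crude w : cabs (S2 w) <= Z w.
Proof.
apply: le_trans (cabs_sum _ _ _) _; rewrite /Z mulr_sumr; apply: ler_sum => i _.
apply: le_trans (cabs_sum _ _ _) _; rewrite mulr_sumr; apply: ler_sum => j _.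
rewrite (cabsM (conjc _)) cabsJ (cabsM (H w.2 i j)).
have vi : cabs (v i ord0) <= 1.
  rewrite -(@expr_le1 _ 2)// ?cabs_ge0//; apply: le_trans v1.
  by rewrite /nrm2 (bigD1 i)//= lerDl sumr_ge0// => l _; exact: sqr_ge0.
rewrite -[leLHS]mul1r -[leLHS]mul1r.
rewrite mul1r mul1r -[leRHS]mul1r.
apply: ler_pM; rewrite ?mulr_ge0 ?cabs_ge0// mulrCA; apply: ler_wpM2l; first exact: cabs_ge0.
have tl : cabs (dt H i j w) <= cabs (H w.2 i j) + cabs (H w.1 i j) by exact: cabsB.
have tl' : cabs (dt' H i j w) <= cabs (H w.2 i j) + cabs (H w.1 i j).
  by rewrite /dt'; case: ifP => _; rewrite ?cabs0 ?cabsJ// addr_ge0 ?cabs_ge0.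
have -> : 2 * L * (1 + cabs (H w.2 i j) + cabs (H w.1 i j)) =
  (L + L) + ((cabs (H w.2 i j) + cabs (H w.1 i j)) * L + (cabs (H w.2 i j) + cabs (H w.1 i j)) * L) by ring.
apply: cabs_lerB; first apply: cabs_lerB.
- exact: (Psi_crude p (Hrepl_herm Hh i j w) N0 zI zN v1).
- exact: (Psi_crude p (Hh w.1) N0 zI zN v1).
- apply: cabs_lerD; apply: cabs_ler_pM => //.
    exact: (alphaF_crude p (Hh w.1) N0 zI zN v1).
  exact: (betaF_crude p (Hh w.1) N0 zI zN v1).
Qed.

Let S2_le w : cabs (S2 w) <= Gam ^+ 29 * psi * Y w.1 ^+ (2 * p + 5) + (\1_A w.1 + \1_A w.2) * Z w.
Proof.
have bad a b : (1 <= a + b :> R) -> cabs (S2 w) <= Gam ^+ 29 * psi * Y w.1 ^+ (2 * p + 5) + (a + b) * Z w.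
  by move=> ab; apply: le_trans (S2_crude w) _; have := ler_wpM2r (Z0 w) ab; have := k0 w.1; lra.
rewrite !indicE.
case: (boolP (w.1 \in A)) => [_|/negP]; first by apply: bad; rewrite lerDl ler0n.
rewrite inE => /hA[gd h1].
case: (boolP (w.2 \in A)) => [_|/negP]; first by apply: bad; rewrite lerDr.
rewrite inE => /hA[_ h2].
rewrite addr0 mul0r addr0.
apply: le_trans (cabs_sum _ _ _) _.
apply: le_trans (sum_remainder (B := fun i j => Hrepl H i j w) (s := fun i j => H w.2 i j)
  (t := fun i j => dt H i j w) (t' := fun i j => dt' H i j w) (Hh w.1) rg gd v1 _ _ _ _ _ _).
- apply: ler_sum => i _; apply: le_trans (cabs_sum _ _ _) _; apply: ler_sum => j _.
  by rewrite (cabsM (conjc _)) cabsJ (cabsM (H w.2 i j)).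
- by move=> i j; exact: Hrepl_herm.
- by move=> i j; exact: repl_sub.
- move=> i j; have -> : 2 * Gam * nn_ R N = Gam * nn_ R N + Gam * nn_ R N by ring.
  exact: cabs_lerB.
- move=> i j; have -> : 2 * Gam * nn_ R N = Gam * nn_ R N + Gam * nn_ R N by ring.
  rewrite /dt'; case: ifP => _; last by rewrite cabsJ; exact: cabs_lerB.
  by rewrite cabs0 addr_ge0 ?mulr_ge0// invr_ge0 sqrtr_ge0.
- move=> i j; rewrite /dt'; case: (eqVneq i j) => [->|ij]; [right|left] => //.
  by split=> //; split=> //; rewrite /dt rmorphB /= -!Hh.
- by move=> i j; exact: h2.
Qed.

Let rX : rnice P (fun w => cabs (X w)) := rnice_cabs nX.

Let rY : rnice P Y.
Proof. exact: (rniceD rX (rnice_cst P1 _)). Qed.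

Let Z2 (w : T * T) : R := 12 * L ^+ 2 * N%:R ^+ 2 *
  \sum_i \sum_j (1 + (9 * cabs (H w.2 i j) ^+ 4 + cabs (H w.1 i j) ^+ 4)).

Let Z_sq w : Z w ^+ 2 <= Z2 w.
Proof.
have cs (I : finType) (c : I -> R) : (\sum_i c i) ^+ 2 <= #|I|%:R * \sum_i c i ^+ 2.
  have := sum_cauchy_schwarz (fun=> 1) c.
  have -> : \sum_i 1 * c i = \sum_i c i by apply: eq_bigr => i _; rewrite mul1r.
  by have -> : \sum_(i : I) (1 : R) ^+ 2 = #|I|%:R by rewrite -sumr_const; apply: eq_bigr => i _; rewrite expr1n.
rewrite /Z /Z2 (exprMn _ (2 * L)).
have -> : 12 * L ^+ 2 * N%:R ^+ 2 = (2 * L) ^+ 2 * (3 * N%:R ^+ 2) by move: L (N%:R : R) => l m; ring.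
rewrite -mulrA; apply: ler_wpM2l; first exact: sqr_ge0.
apply: le_trans (cs _ _) _.
have -> : 3 * N%:R ^+ 2 = N%:R * (N%:R * 3) :> R by ring.
rewrite card_ord -mulrA; apply: ler_wpM2l => //.
rewrite mulr_sumr; apply: ler_sum => i _.
apply: le_trans (cs _ _) _; rewrite card_ord -mulrA; apply: ler_wpM2l => //.
rewrite mulr_sumr; apply: ler_sum => j _.
move: (cabs_ge0 (H w.2 i j)) (cabs_ge0 (H w.1 i j)); move: (cabs _) (cabs _) => y x x0 y0.
have h : x * (1 + x + y) <= 1 + 3 * x ^+ 2 + y ^+ 2.
  by have := sqr_ge0 (x - 1); have := sqr_ge0 (x - y); nra.
apply: (@le_trans _ _ ((1 + 3 * x ^+ 2 + y ^+ 2) ^+ 2)).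
  apply: (lerXn2r _ _ _ h); rewrite nnegrE.
    by rewrite mulr_ge0// !addr_ge0.
  by rewrite !addr_ge0 ?mulr_ge0 ?sqr_ge0.
have -> : x ^+ 4 = (x ^+ 2) ^+ 2 by rewrite -exprM.
have -> : y ^+ 4 = (y ^+ 2) ^+ 2 by rewrite -exprM.
move: (x ^+ 2) (y ^+ 2) => a b.
have := sqr_ge0 (1 - 3 * a); have := sqr_ge0 (1 - b); have := sqr_ge0 (3 * a - b); nra.
Qed.

(** Replaces the indicator times Z by indicator / e plus e Z^2. As the bad event has probability at
    most e^2, both have expectation of order e. *)
Let S2_le' w : cabs (S2 w) <= Gam ^+ 29 * psi * Y w.1 ^+ (2 * p + 5)
  + (e^-1 * (\1_A w.1 + \1_A w.2) + 2 * e * Z2 w).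
Proof.
apply: le_trans (S2_le w) _; rewrite lerD2l.
have ie : 0 < e^-1 by rewrite invr_gt0.
have i0 (x : T) : 0 <= (\1_A x : R) <= 1 by rewrite indicE; case: (_ \in _); rewrite ?lexx ?ler01.
have zz : Z w <= e^-1 + e * Z2 w.
  apply: (@le_trans _ _ (e^-1 + e * Z w ^+ 2)); last by rewrite lerD2l ler_wpM2l ?(ltW e0)// Z_sq.
  have := sqr_ge0 (Z w * e - 1); have := Z0 w; move: (Z w) => y y0 s.
  have -> : e^-1 + e * y ^+ 2 = (1 + (e * y) ^+ 2) / e.
    by field; rewrite gt_eqF.
  by rewrite ler_pdivlMr//; nra.
have Z20 : 0 <= Z2 w by apply: le_trans (Z_sq w); exact: sqr_ge0.
have := i0 w.1; have := i0 w.2; move: (\1_A w.1) (\1_A w.2) => x y /andP[y0 y1] /andP[x0 x1].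
apply: le_trans (ler_wpM2l (addr_ge0 x0 y0) zz) _.
rewrite mulrDr mulrC lerD2l.
have ez : 0 <= e * Z2 w by rewrite mulr_ge0// ltW.
have : (x + y) * (e * Z2 w) <= 2 * (e * Z2 w) by rewrite ler_wpM2r//; lra.
by rewrite mulrA.
Qed.

(** S1 and S2 contribute a quarter of the moment each; moving this half to the left gives the factor
    2. *)
Lemma moment_bound : EE P (fun w => cabs (X w) ^+ (2 * p + 6)) <=
  2 * ((2 ^+ (2 * p + 6) + 1) ^+ (2 * p + 5) * (Gam ^+ 30 * psi) ^+ (2 * p + 6))
  + e * (490 * Lc R N p ^+ 2 * N%:R ^+ 4 * (1 + C4)).
Proof.
have C40 : 0 <= C4.
  by apply: le_trans (H4 (Ordinal N0) (Ordinal N0)); apply: EE_ge0 => w; rewrite exprn_ge0// cabs_ge0.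
pose a := Gam ^+ 30 * psi; have a0 : 0 <= a by rewrite mulr_ge0// exprn_ge0.
set C := (2 ^+ (2 * p + 6) + 1) ^+ (2 * p + 5) * _.
pose E := EE P (fun w => cabs (X w) ^+ (2 * p + 6)).
have rk : rnice P (fun w => cabs (X w) ^+ (2 * p + 6)) := rniceX P1 _ rX.
have E0 : E <= cabs (cE P (fun w => X w * Wfun p (X w))).
  have -> : (fun w => X w * Wfun p (X w)) = fun w => (cabs (X w) ^+ (2 * p + 6))%:C.
    by apply/funext => w; exact: mul_Wfun.
  by rewrite (cE_real P1) cabs_real ler_norm.
have rA : rnice P (\1_A : T -> R) := rnice_indic P1 mA.
have EA : EE P (\1_A : T -> R) <= e ^+ 2 by rewrite EE_indic.
have rY5 : rnice P (fun w => Gam ^+ 29 * psi * Y w ^+ (2 * p + 5)) := rniceM (rnice_cst P1 _) (rniceX P1 _ rY).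
have rY5' : rnice PP (fun w => Gam ^+ 29 * psi * Y w.1 ^+ (2 * p + 5)) := rnice_fst rY5.
(* One of the 30 powers of Gam in a absorbs a factor 2, so that Young's half of the moment becomes a
   quarter. *)
have EYa : EE P (fun w => Gam ^+ 29 * psi * Y w ^+ (2 * p + 5)) <= E / 4 + C / 2.
  have rr : rnice P (fun w => 4^-1 * cabs (X w) ^+ (2 * p + 6)) := rniceM (rnice_cst P1 _) rk.
  have -> : E / 4 + C / 2 = EE P (fun w => 4^-1 * cabs (X w) ^+ (2 * p + 6) + C / 2).
    by rewrite (EED rr (rnice_cst P1 _)) (EE_cst P1) (EEZ _ rk) mulrC.
  apply: EE_le => [//||w]; first exact: (rniceD rr (rnice_cst P1 _)).
  have Yle : Y w <= cabs (X w) + a.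
    by rewrite /Y /MM lerD2l; apply: (ler_wpM2r psi0); apply: ler_weXn2l.
  have ga : 2 * (Gam ^+ 29 * psi) <= a.
    rewrite /a (exprS _ 29) mulrA; apply: (ler_wpM2r psi0); apply: (ler_wpM2r (exprn_ge0 29 G0)).
    by apply: le_trans (rg_Gam rg); rewrite ler_nat.
  have yg := young_pow (2 * p + 5) (cabs_ge0 (X w)) a0.
  have e6 : (2 * p + 5).+1 = (2 * p + 6)%N by rewrite -addnS.
  rewrite e6 -/C in yg.
  have : 2 * (Gam ^+ 29 * psi) * Y w ^+ (2 * p + 5) <= a * (cabs (X w) + a) ^+ (2 * p + 5).
    apply: (ler_pM _ _ ga).
    - exact: (mulr_ge0 (ler0n _ _) (mulr_ge0 (exprn_ge0 _ G0) psi0)).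
    - exact: (exprn_ge0 _ (Y0 w)).
    - by apply: lerXn2r; rewrite ?nnegrE// addr_ge0// cabs_ge0.
  rewrite -mulrA; move: (Gam ^+ 29 * psi * _) (a * _) (_ ^+ (2 * p + 6)) yg => r1 r2 r3; lra.
have ES1 : EE P (fun w => cabs (S1 w)) <= E / 4 + C / 2 + 3 * N%:R * L * e ^+ 2.
  have r1 : rnice P (fun w => 3 * N%:R * L * \1_A w) := rniceM (rnice_cst P1 _) rA.
  apply: le_trans (EE_le (rnice_cabs nS1) (rniceD rY5 r1) S1_le) _.
  rewrite (EED rY5 r1) (EEZ _ rA); apply: lerD => //.
  by apply: ler_wpM2l => //; rewrite !mulr_ge0.
have r41 i j : rnice P (fun w => cabs (H w i j) ^+ 4) := rniceX P1 4 (rnice_cabs (Hn i j)).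
have fstE f : rnice P f -> EE PP (fun w => f w.1) = EE P f.
  move=> rf; have := EE_prod rf (rnice_cst P1 1); rewrite (EE_cst P1) mulr1 => <-.
  by congr (EE PP _); apply/funext => w; rewrite mulr1.
have sndE f : rnice P f -> EE PP (fun w => f w.2) = EE P f.
  move=> rf; have := EE_prod (rnice_cst P1 1) rf; rewrite (EE_cst P1) mul1r => <-.
  by congr (EE PP _); apply/funext => w; rewrite mul1r.
have rz i j : rnice PP (fun w => 1 + (9 * cabs (H w.2 i j) ^+ 4 + cabs (H w.1 i j) ^+ 4)).
  apply: (rniceD (rnice_cst PP1 _)); apply: rniceD; last exact: (rnice_fst (r41 i j)).
  exact: (rniceM (rnice_cst PP1 _) (rnice_snd (r41 i j))).
have rZ2 : rnice PP Z2.
  by apply: (rniceM (rnice_cst PP1 _)); apply: (rnice_sum PP1) => i; exact: (rnice_sum PP1).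
have EZ2 : EE PP Z2 <= 120 * L ^+ 2 * N%:R ^+ 4 * (1 + C4).
  have zij i j : EE PP (fun w => 1 + (9 * cabs (H w.2 i j) ^+ 4 + cabs (H w.1 i j) ^+ 4)) <= 10 * (1 + C4).
    have q1 : rnice PP (fun w => 9 * cabs (H w.2 i j) ^+ 4) := rniceM (rnice_cst PP1 _) (rnice_snd (r41 i j)).
    have q2 : rnice PP (fun w => cabs (H w.1 i j) ^+ 4) := rnice_fst (r41 i j).
    rewrite (EED (rnice_cst PP1 _) (rniceD q1 q2)) (EED q1 q2) (EE_cst PP1) (EEZ _ (rnice_snd (r41 i j))).
    rewrite (fstE _ (r41 i j)) (sndE _ (r41 i j)).
    by have := H4 i j; move: (EE P _) => x; lra.
  rewrite /Z2 (EEZ _ (rnice_sum PP1 _ _ (fun i => rnice_sum PP1 _ _ (rz i)))).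
  rewrite (EE_sum PP1); last by move=> i; exact: (rnice_sum PP1).
  apply: (@le_trans _ _ (12 * L ^+ 2 * N%:R ^+ 2 * \sum_(i < N) \sum_(j < N) (10 * (1 + C4)))).
    apply: ler_wpM2l; first by rewrite !mulr_ge0 ?sqr_ge0.
    by apply: ler_sum => i _; rewrite (EE_sum PP1)//; apply: ler_sum => j _.
  rewrite !sumr_const !card_ord -mulrnA -[_ *+ (N * N)]mulr_natr natrM.
  by apply: le_of_eq; ring.
have ES2 : EE PP (fun w => cabs (S2 w)) <= E / 4 + C / 2 + (2 * e + 2 * e * (120 * L ^+ 2 * N%:R ^+ 4 * (1 + C4))).
  have r1 : rnice PP (fun w => \1_A w.1 + \1_A w.2 : R) := rniceD (rnice_fst rA) (rnice_snd rA).
  have r2 : rnice PP (fun w => e^-1 * (\1_A w.1 + \1_A w.2)) := rniceM (rnice_cst PP1 _) r1.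
  have r3 : rnice PP (fun w => 2 * e * Z2 w) := rniceM (rnice_cst PP1 _) rZ2.
  apply: le_trans (EE_le (rnice_cabs nS2) (rniceD rY5' (rniceD r2 r3)) S2_le') _.
  rewrite (EED rY5' (rniceD r2 r3)) (EED r2 r3); apply: lerD.
    by rewrite (fstE (fun w => Gam ^+ 29 * psi * Y w ^+ (2 * p + 5))).
  rewrite (EEZ _ r1) (EEZ _ rZ2); apply: lerD.
    rewrite (EED (rnice_fst rA) (rnice_snd rA)) (fstE _ rA) (sndE _ rA) mulrC ler_pdivrMr//.
    by rewrite -mulrA -expr2; move: (EE P _) EA => x; lra.
  by apply: ler_wpM2l => //; rewrite mulr_ge0// ltW.
have Es : E <= EE P (fun w => cabs (S1 w)) + EE PP (fun w => cabs (S2 w)).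
  apply: le_trans E0 _; rewrite moment_identity; apply: le_trans (cabsD _ _) _.
  by apply: lerD; [exact: (cabs_cE P1 nS1)|exact: (cabs_cE PP1 nS2)].
have L1 : 1 <= L.
  rewrite /L /Lc; apply: mulr_ege1; first by rewrite ler1n addnS.
  apply: exprn_ege1; apply: mulr_ege1; first by rewrite ler1n.
  by apply: exprn_ege1; rewrite ler1n.
have N1 : (1 : R) <= N%:R by rewrite ler1n.
have nl : N%:R * L <= L ^+ 2 * N%:R ^+ 4.
  rewrite mulrC; apply: ler_pM => //.
    by rewrite expr2 ler_peMl.
  by rewrite exprS ler_peMr// exprn_ege1.
have l1 : 1 <= L ^+ 2 * N%:R ^+ 4 by apply: mulr_ege1; apply: exprn_ege1.
have e2e : N%:R * L * e ^+ 2 <= e * (L ^+ 2 * N%:R ^+ 4).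
  rewrite mulrC; apply: ler_pM => //; rewrite ?sqr_ge0 ?mulr_ge0//.
  by rewrite expr2 ler_piMl// ltW.
have M0 : 0 <= e * (L ^+ 2 * N%:R ^+ 4) by rewrite mulr_ge0 ?(ltW e0)// (le_trans ler01).
have el : e <= e * (L ^+ 2 * N%:R ^+ 4) by rewrite ler_peMr// ltW.
have MC : 0 <= e * (L ^+ 2 * N%:R ^+ 4) * C4 by rewrite mulr_ge0.
rewrite -/E -/L.
(* 490 = 2 (3 + 2 + 240), from the bad part of S1 and the two bad parts of S2. *)
have -> : e * (490 * L ^+ 2 * N%:R ^+ 4 * (1 + C4)) = 490 * (e * (L ^+ 2 * N%:R ^+ 4)) + 490 * (e * (L ^+ 2 * N%:R ^+ 4) * C4) by ring.
have h2 : 2 * e * (120 * L ^+ 2 * N%:R ^+ 4 * (1 + C4)) = 240 * (e * (L ^+ 2 * N%:R ^+ 4)) + 240 * (e * (L ^+ 2 * N%:R ^+ 4) * C4) by ring.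
rewrite h2 in ES2.
have h3 : 3 * N%:R * L * e ^+ 2 = 3 * (N%:R * L * e ^+ 2) by ring.
rewrite h3 in ES1.
move: (EE PP _) (EE P (fun w => cabs (S1 w))) ES1 ES2 Es => s2 s1.
move: (e * (L ^+ 2 * N%:R ^+ 4) * C4) MC => m1 m10.
move: (e * (L ^+ 2 * N%:R ^+ 4)) (N%:R * L * e ^+ 2) M0 el e2e => m2 m3.
by clearbody E C; move=> *; lra.
Qed.

End MomentBound.

(** * The norm of H *)

(* Sums over walks, an edge used m times being weighted by edge_weight m.  A walk
   whose edges are all used at most twice has weight one for each step to a new
   vertex (N choices, weight 1/N) and for each return along an edge used once.
   All the other steps either cost a power of N, or return along one of several
   edges used once, which is paid for by the excess of degrees walk_excess. *)
Section WalkSum.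

Variables (R : realType) (N : nat) (B th : R).
Implicit Types r : 'I_N -> 'I_N -> nat.

(** Bounds the expectation of m factors of one truncated entry: truncation leaves a mean of at most
    1/N, and for m >= 2 all factors but two are bounded by B. *)
Definition edge_weight (m : nat) : R :=
  match m with 0 => 1 | 1 => N%:R^-1 | m.+2 => B ^+ m / N%:R end.

(** Uses of the undirected edge; a loop is counted once. *)
Definition mult r (a b : 'I_N) : nat := if a == b then r a a else (r a b + r b a)%N.

Definition add_step r (c x : 'I_N) : 'I_N -> 'I_N -> nat :=
  fun a b => (r a b + ((a == c) && (b == x)))%N.

Definition history_weight r : R := \prod_(k : 'I_N * 'I_N | (k.1 <= k.2)%N) edge_weight (mult r k.1 k.2).

Fixpoint walk_sum r (c : 'I_N) (L : nat) : R :=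
  match L with
  | 0 => history_weight r
  | L.+1 => \sum_x walk_sum (add_step r c x) x L
  end.

Definition single_deg r (u : 'I_N) : nat := (\sum_w (mult r u w == 1))%N.

(** With truncated subtraction, the excess over a simple path ending at the current vertex, which
    has degree 1 at its end and at most 2 elsewhere. *)
Definition walk_excess r (c : 'I_N) : nat :=
  (\sum_u (single_deg r u - (if u == c then 1 else 2)))%N.

Lemma multC r a b : mult r a b = mult r b a.
Proof. by rewrite /mult eq_sym; case: eqP => [->|_] //; rewrite addnC. Qed.

Lemma mult_add_step r c x a b : mult (add_step r c x) a b =
  (mult r a b + (((a == c) && (b == x)) || ((a == x) && (b == c))))%N.
Proof.
rewrite /mult /add_step; case: (eqVneq a b) => [->|ab]; first by rewrite [(b == x) && _]andbC orbb.
rewrite [in LHS](andbC (b == c)).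
have : ~~ (((a == c) && (b == x)) && ((a == x) && (b == c))).
  by apply: contra ab => /andP[/andP[/eqP -> _] /andP[_ /eqP ->]].
by move: ((a == c) && (b == x)) ((a == x) && (b == c)) => [] [] //= _; clear; lia.
Qed.

Hypotheses (N0 : (0 < N)%N) (B0 : 0 < B) (th1 : 1 <= th).

Let N0R : (0 : R) < N%:R. Proof. by rewrite ltr0n. Qed.

Lemma edge_weight_gt0 m : 0 < edge_weight m.
Proof. by case: m => [|[|m]] //=; rewrite ?invr_gt0// divr_gt0// exprn_gt0. Qed.

Lemma history_weight_ge0 r : 0 <= history_weight r.
Proof. by apply: prodr_ge0 => k _; exact: ltW (edge_weight_gt0 _). Qed.

Definition step_factor (m : nat) : R :=
  match m with 0 => N%:R^-1 | 1 => 1 | _ => B end.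

Lemma edge_weightS m : edge_weight m.+1 = step_factor m * edge_weight m.
Proof.
case: m => [|[|m]]; first by rewrite /= mulr1.
  by rewrite /= expr0 !mul1r.
by rewrite /= exprS -mulrA.
Qed.

Lemma history_weight_step r c x :
  history_weight (add_step r c x) = step_factor (mult r c x) * history_weight r.
Proof.
pose k0 : 'I_N * 'I_N := if (c <= x)%N then (c, x) else (x, c).
have k0P : (k0.1 <= k0.2)%N by rewrite /k0; case: (leqP c x) => [//|xc] /=; exact: ltnW.
have mk0 r' : mult r' k0.1 k0.2 = mult r' c x by rewrite /k0; case: ifP => // _; rewrite multC.
rewrite /history_weight (bigD1 k0)//= [in RHS](bigD1 k0)//= mulrA; congr (_ * _).
  rewrite !mk0 mult_add_step !eqxx /= addn1; exact: edge_weightS.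
apply: eq_bigr => -[a b] /= /andP[ab k]; congr edge_weight; rewrite mult_add_step.
suff -> : ((a == c) && (b == x)) || ((a == x) && (b == c)) = false by rewrite addn0.
apply/negbTE; apply: contra k => /orP[|] /andP[/eqP ea /eqP eb]; rewrite /k0 -ea -eb.
  by rewrite ab.
case: (leqP b a) => // ba; apply/eqP.
by have -> : a = b by apply/val_inj/eqP; rewrite eqn_leq ab ba.
Qed.

Lemma single_deg_other r c x u : u != c -> u != x -> single_deg (add_step r c x) u = single_deg r u.
Proof.
by move=> uc ux; apply: eq_bigr => w _; rewrite mult_add_step (negbTE uc) (negbTE ux) /= addn0.
Qed.

Lemma single_deg_step r c x :
  (single_deg (add_step r c x) c + (mult r c x == 1) = single_deg r c + (mult r c x == 0))%N.
Proof.
rewrite /single_deg (bigD1 x)//= [in RHS](bigD1 x)//= mult_add_step !eqxx /= addn1 eqSS.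
have -> : (\sum_(w | w != x) (mult (add_step r c x) c w == 1) = \sum_(w | w != x) (mult r c w == 1))%N.
  apply: eq_bigr => w wx; rewrite mult_add_step (negbTE wx) andbF /=.
  case: (eqVneq c x) => [cx|_] /=; last by rewrite addn0.
  by rewrite cx (negbTE wx) addn0.
by case: (mult r c x) => [|[|m]] /=; clear; lia.
Qed.

Lemma single_deg_step' r c x :
  (single_deg (add_step r c x) x + (mult r c x == 1) = single_deg r x + (mult r c x == 0))%N.
Proof.

rewrite multC.
have e u : single_deg (add_step r c x) u = single_deg (add_step r x c) u.
  by apply: eq_bigr => w _; rewrite !mult_add_step orbC.
by rewrite !e single_deg_step.
Qed.

(** Only the degrees of c and x, and the allowance of these two, change. A fresh vertex extends the
    path at no cost. Going back along an edge used once lowers the excess if there was another such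
    edge at c to choose. *)
Lemma walk_excess_step r c x (m := mult r c x) (Q := walk_excess r c) :
  let Q' := walk_excess (add_step r c x) x in
  [/\ m = 0%N -> (Q' <= Q + 2)%N,
      m = 0%N -> x != c -> single_deg r x = 0%N -> (Q' <= Q)%N,
      m = 1%N -> (Q' + (1 < single_deg r c) <= Q)%N &
      (1 < m)%N -> (Q' <= Q + 1)%N].
Proof.
have h := single_deg_step r c x; have h' := single_deg_step' r c x.
rewrite -/m in h h' *.
pose g (r' : 'I_N -> 'I_N -> nat) y u := (single_deg r' u - (if u == y then 1 else 2))%N.
case: (eqVneq c x) => [cx|cx] /=.
  subst x; pose s := (\sum_(u | u != c) g r c u)%N.
  have e1 : Q = (single_deg r c - 1 + s)%N by rewrite /Q /walk_excess (bigD1 c)//= eqxx.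
  have e2 : walk_excess (add_step r c c) c = (single_deg (add_step r c c) c - 1 + s)%N.
    rewrite /walk_excess (bigD1 c)//= eqxx; congr (_ + _)%N.
    by apply: eq_bigr => u uc; rewrite /g single_deg_other.
  rewrite e1 e2; move: h => {h' e1 e2}; move: (single_deg (add_step r c c) c) (single_deg r c) s (m) => d' d s0 m0.
  by case: m0 => [|[|m1]] /= h; split => //; move: h; clear; lia.
pose s := (\sum_(u | (u != c) && (u != x)) g r c u)%N.
have xc : x != c by rewrite eq_sym.
have e1 : Q = (single_deg r c - 1 + (single_deg r x - 2 + s))%N.
  by rewrite /Q /walk_excess (bigD1 c)//= eqxx (bigD1 x)//= (negbTE xc).
have e2 : walk_excess (add_step r c x) x =
    (single_deg (add_step r c x) c - 2 + (single_deg (add_step r c x) x - 1 + s))%N.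
  rewrite /walk_excess (bigD1 c)//= (negbTE cx) (bigD1 x)//= eqxx; congr (_ + (_ + _))%N.
  by apply: eq_bigr => u /andP[uc ux]; rewrite /g single_deg_other// (negbTE uc) (negbTE ux).
rewrite e1 e2; move: h h' => {e1 e2}.
move: (single_deg (add_step r c x) c) (single_deg r c) (single_deg (add_step r c x) x) (single_deg r x) s (m).
move=> d' d e' e s0 m0.
by case: m0 => [|[|m1]] /= h h'; split => //; move: h h'; clear; lia.
Qed.

Hypothesis small : th ^+ 3 / N%:R + th ^+ 2 * B <= 2^-1.

(** Induction on the remaining steps, S being the visited vertices. The next step has total weight
    at most 5/2: 1 for new vertices, 1 for edges used once, and 1/2 for all others by the smallness
    hypothesis. *)
Lemma walk_sum_le (L : nat) r c (S : {set 'I_N}) : c \in S ->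
  (forall u w, (0 < mult r u w)%N -> u \in S) -> (#|S| + L)%:R <= th ->
  walk_sum r c L <= history_weight r * (5 / 2) ^+ L * th ^+ walk_excess r c.
Proof.
have th0 : 0 < th by exact: lt_le_trans th1.
elim: L r c S => [|L IH] r c S cS rS Sth /=.
  by rewrite expr0 mulr1 ler_peMr ?history_weight_ge0// exprn_ege1.
pose m x := mult r c x; pose d := single_deg r c.
(* With d edges used once at c, each receives weight 1/d: for d > 1 the excess drops and pays a
   factor th >= d, for d = 1 there is no choice. *)
pose f x : R := if x \in S then match m x with 0 => th ^+ 2 / N%:R | 1 => d%:R^-1 | _ => B * th end else N%:R^-1.
set W := history_weight r; set Q := walk_excess r c.
have W0 : 0 <= W by exact: history_weight_ge0.
have Sl : #|S|%:R <= th by apply: le_trans Sth; rewrite ler_nat leq_addr.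
have dS : (d <= #|S|)%N.
  rewrite /d /single_deg -sum1_card big_mkcond [leqRHS]big_mkcond /=; apply: leq_sum => w _.
  case: (boolP (w \in S)) => [_|wS]; first by case: (_ == _).
  case: eqP => // e; case/negP: wS; apply: (rS _ c); by rewrite multC e.
have step x : walk_sum (add_step r c x) x L <= W * (5 / 2) ^+ L * th ^+ Q * f x.
  have iS : x \in x |: S by rewrite !inE eqxx.
  have irS u w : (0 < mult (add_step r c x) u w)%N -> u \in x |: S.
    rewrite mult_add_step addn_gt0 !inE => /orP[/rS ->|]; first by rewrite orbT.
    by rewrite lt0b => /orP[/andP[/eqP -> _]|/andP[/eqP -> _]]; rewrite ?cS ?orbT ?eqxx.
  have cth : (#|x |: S| + L)%:R <= th.
    apply: le_trans Sth; rewrite ler_nat cardsU1; move: #|S| => s; case: (_ \notin _) => /=; clear; lia.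
  apply: le_trans (IH _ _ _ iS irS cth) _; rewrite history_weight_step -/W.
  set Q' := walk_excess _ x.
  have -> : step_factor (mult r c x) * W * (5 / 2) ^+ L * th ^+ Q' =
    W * (5 / 2) ^+ L * (step_factor (m x) * th ^+ Q') by rewrite /m; ring.
  have -> : W * (5 / 2) ^+ L * th ^+ Q * f x = W * (5 / 2) ^+ L * (th ^+ Q * f x) by ring.
  apply: ler_wpM2l; first by rewrite mulr_ge0// exprn_ge0// divr_ge0.
  have tX a b : (a <= b)%N -> th ^+ a <= th ^+ b by move=> ab; apply: ler_weXn2l.
  have [q0 qn q1 q2] := walk_excess_step r c x; rewrite -/Q -/Q' -/(m x) -/d in q0 qn q1 q2.
  rewrite /f; case: ifPn => xS; last first.
    have mx : m x = 0%N by apply/eqP; rewrite -leqn0 leqNgt /m multC; apply: contra xS => /rS.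
    rewrite mx /= mulrC ler_wpM2r ?invr_ge0//; apply: tX; apply: qn => //.
      by apply: contraNneq xS => ->.
    rewrite /single_deg big1// => w _; case: eqP => // e; case/negP: xS.
    by apply: (rS _ w); rewrite e.
  case E : (m x) => [|[|k]] /=.
  - rewrite [leRHS]mulrA -exprD mulrC ler_wpM2r ?invr_ge0//; apply: tX; exact: q0.
  - have d1 : (0 < d)%N.
      by rewrite /d /single_deg (bigD1 x)//= -/(m x) E eqxx.
    rewrite mul1r; have := q1 E; case: (ltnP 1 d) => d2; last first.
      have -> : d = 1%N by apply/eqP; rewrite eqn_leq d2 d1.
      by rewrite invr1 mulr1 addn0; exact: tX.
    rewrite addn1 => qq; rewrite ler_pdivlMr ?ltr0n//.
    apply: (@le_trans _ _ (th ^+ Q' * th)); last by rewrite -exprSr; exact: tX.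
    rewrite ler_wpM2l ?exprn_ge0 ?(ltW th0)// (le_trans _ Sl)// ler_nat//.
  - rewrite mulrCA ler_wpM2l ?(ltW B0)// -exprSr; apply: tX.
    by rewrite -addn1; apply: q2; rewrite E.
apply: le_trans (ler_sum _ (fun x _ => step x)) _.
rewrite -mulr_sumr.
have -> : W * (5 / 2) ^+ L.+1 * th ^+ Q = W * (5 / 2) ^+ L * th ^+ Q * (5 / 2) by rewrite exprSr; ring.
apply: ler_wpM2l; first by rewrite !mulr_ge0 ?exprn_ge0 ?divr_ge0// ltW.
have fle x : f x <= N%:R^-1 + ((m x == 1%N)%:R / d%:R + (x \in S)%:R * (th ^+ 2 / N%:R + B * th)).
  have i0 : 0 <= N%:R^-1 :> R by rewrite invr_ge0.
  have t0 : 0 <= th ^+ 2 / N%:R by rewrite divr_ge0// exprn_ge0// ltW.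
  have b0 : 0 <= B * th by rewrite mulr_ge0// ltW.
  have d0 : 0 <= d%:R^-1 :> R by rewrite invr_ge0.
  rewrite /f; case: (x \in S) => /=; last first.
    by rewrite mul0r addr0 lerDl divr_ge0.
  rewrite mul1r; case: (m x) => [|[|k]] /=; rewrite ?mul0r ?mul1r; lra.
apply: le_trans (ler_sum _ (fun x _ => fle x)) _.
rewrite !big_split /= sumr_const card_ord -[_ *+ N]mulr_natr mulVf ?gt_eqF// -!mulr_suml.
have -> : \sum_x ((m x == 1%N)%:R : R) = d%:R by rewrite /d /single_deg -natr_sum.
have -> : \sum_x ((x \in S)%:R : R) = #|S|%:R.
  by rewrite -natr_sum; congr _%:R; rewrite -sum1_card [RHS]big_mkcond; apply: eq_bigr => i _; case: (_ \in _).
have dd : d%:R / d%:R <= 1 :> R.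
  by case: (posnP d) => [->|dp]; rewrite ?mul0r// divff// pnatr_eq0 -lt0n.
have : #|S|%:R * (th ^+ 2 / N%:R + B * th) <= 2^-1.
  apply: le_trans small; apply: (@le_trans _ _ (th * (th ^+ 2 / N%:R + B * th))).
    by apply: ler_wpM2r Sl; rewrite addr_ge0 ?mulr_ge0 ?exprn_ge0 ?invr_ge0 ?(ltW th0) ?(ltW B0).
  by apply: le_of_eq; ring.
by move: (_ / _) (_ * (_ + _)) dd => x y; lra.
Qed.

Lemma walk_sum0_le (L : nat) c : (1 + L)%:R <= th ->
  walk_sum (fun _ _ => 0%N) c L <= (5 / 2) ^+ L.
Proof.
move=> Lth; have m0 a b : mult (fun _ _ => 0%N) a b = 0%N by rewrite /mult; case: ifP.
have d0 u : single_deg (fun _ _ => 0%N) u = 0%N by rewrite /single_deg big1// => w _; rewrite m0.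
apply: le_trans (@walk_sum_le L (fun _ _ => 0%N) c [set c] _ _ _) _; rewrite ?set11 ?cards1//.
  by move=> u w; rewrite m0.
rewrite /walk_excess big1 => [|u _]; last by rewrite d0.
rewrite /history_weight big1 => [|k _]; last by rewrite m0.
by rewrite mul1r expr0 mulr1.
Qed.

End WalkSum.

(** * Events of small probability *)

Section OuterBound.
Variables (R : realType) (d : measure_display) (T : measurableType d) (P : probability T R).

(* Outer probability, so that bad events need not be shown measurable. *)
Definition small (e : R) (B : set T) :=
  exists A : set T, [/\ measurable A, B `<=` A & fine (P A) <= e].

Let P1 : P setT = 1%E := probability_setT P.

Lemma small_sub e e' (B B' : set T) : B' `<=` B -> e <= e' -> small e B -> small e' B'.
Proof. by move=> BB ee [A [mA BA PA]]; exists A; split => //; [exact: subset_trans BA|exact: le_trans ee]. Qed.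

Lemma smallU e e' (B B' : set T) : small e B -> small e' B' -> small (e + e') (B `|` B').
Proof.
move=> [A [mA BA PA]] [A' [mA' BA' PA']]; exists (A `|` A'); split.
- exact: measurableU.
- exact: setUSS.
- apply: le_trans (lerD PA PA').
  rewrite -!(EE_indic P)//; last exact: measurableU.
  rewrite -(EED (rnice_indic P1 mA) (rnice_indic P1 mA')).
  apply: EE_le; [by apply: (rnice_indic P1); exact: measurableU|exact: rniceD (rnice_indic P1 mA) (rnice_indic P1 mA')|].
  move=> x; rewrite !indicE in_setU.
  by case: (_ \in A); case: (_ \in A') => /=; lra.
Qed.

Lemma small0 : small 0 set0.
Proof. by exists set0; split => //; rewrite measure0. Qed.

Lemma small_bigU (I : finType) e (B : I -> set T) : (forall i, small e (B i)) ->
  small (#|I|%:R * e) [set w | exists i, B i w].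
Proof.
move=> h.
have k (s : seq I) : small ((size s)%:R * e) [set w | exists2 i, i \in s & B i w].
  elim: s => [|i s IH].
    by rewrite mul0r; apply: (small_sub _ _ small0) => // w [].
  rewrite /= -natr1 mulrDl mul1r; apply: (small_sub _ _ (smallU IH (h i))) => // w [j].
  by rewrite inE => /orP[/eqP ->|js] Bj; [right|left; exists j].
rewrite cardE; apply: (small_sub _ _ (k (enum I))) => // w [i Bi].
by exists i => //; rewrite mem_enum.
Qed.

Lemma small_markov (f : T -> R) (c : R) : 0 < c -> rnice P f -> (forall x, 0 <= f x) ->
  small (c^-1 * EE P f) [set x | c <= f x].
Proof.
move=> c0 hf f0; exists [set x | c <= f x]; split => //.
  have -> : [set x | c <= f x] = f @^-1` `[c, +oo[.
    by apply/seteqP; split => x /=; rewrite in_itv /= andbT.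
  by rewrite -[X in measurable X]setTI; apply: hf.1.
apply: (markov_EE P1 c0 hf f0) => //.
have -> : [set x | c <= f x] = f @^-1` `[c, +oo[.
  by apply/seteqP; split => x /=; rewrite in_itv /= andbT.
by rewrite -[X in measurable X]setTI; apply: hf.1.
Qed.

End OuterBound.

(** * Norms and traces of matrix powers *)

Section MatrixPowers.
Local Open Scope complex_scope.
Variables (R : rcfType) (N : nat).
Implicit Types A : 'M[R[i]]_N.

Definition mpow A L : 'M[R[i]]_N := iter L (mulmx A) 1%:M.

Lemma mpowS A L : mpow A L.+1 = A *m mpow A L.
Proof. by []. Qed.

Lemma mpowD A k l : mpow A (k + l) = mpow A k *m mpow A l.
Proof. by elim: k => [|k IH]; rewrite ?mul1mx// addSn !mpowS IH mulmxA. Qed.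

Lemma adjmx_mpow A k : hermitian A -> adjmx (mpow A k) = mpow A k.
Proof.
move=> hA; elim: k => [|k IH]; first exact: adjmx1.
rewrite {1}mpowS adjmx_mul (adjmx_herm hA) IH -[k.+1]addn1 mpowD.
by congr (_ *m _); rewrite /mpow /= mulmx1.
Qed.

Lemma nrm2_mul_le (K : 'M[R[i]]_N) u : nrm2 (K *m u) <= (\sum_a \sum_b cabs (K a b) ^+ 2) * nrm2 u.
Proof.
rewrite mulr_suml; apply: ler_sum => a _; rewrite mxE.
apply: le_trans (sum_cauchy_schwarz (fun b => cabs (K a b)) (fun b => cabs (u b ord0))).
apply: lerXn2r; rewrite ?nnegrE ?cabs_ge0//; first by apply: sumr_ge0 => b _; rewrite mulr_ge0 ?cabs_ge0.
by apply: le_trans (cabs_sum _ _ _) _; apply: ler_sum => b _; rewrite cabsM.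
Qed.

Lemma mpow_diag A k c : hermitian A ->
  mpow A (k + k) c c = (\sum_b cabs (mpow A k c b) ^+ 2)%:C.
Proof.
move=> hA; rewrite mpowD mxE rmorph_sum; apply: eq_bigr => b _.
by rewrite /= -cabs_mulJ; congr (_ * _); rewrite -{1}(adjmx_mpow k hA) mxE.
Qed.

(** Repeated squaring without diagonalisation: |A^k u|^2 = <u, A^(2k) u> <= |A^(2k) u|. *)
Lemma nrm2_pow_le A u r : hermitian A -> nrm2 u = 1 ->
  nrm2 (A *m u) ^+ (2 ^ r) <= nrm2 (mpow A (2 ^ r) *m u).
Proof.
move=> hA u1; elim: r => [|r IH]; first by rewrite /mpow /= mulmx1.
rewrite expnS mulnC exprM.
apply: (@le_trans _ _ (nrm2 (mpow A (2 ^ r) *m u) ^+ 2)).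
  by apply: lerXn2r; rewrite ?nnegrE ?exprn_ge0 ?nrm2_ge0.
set k := (2 ^ r)%N; have -> : (k * 2 = k + k)%N by rewrite muln2 addnn.
have e : dotc u (mpow A (k + k) *m u) = (nrm2 (mpow A k *m u))%:C.
  by rewrite mpowD -mulmxA dotc_adj adjmx_mpow// dotcxx.
have := dotc_cauchy_schwarz u (mpow A (k + k) *m u).
rewrite e u1 sqrtr1 mul1r cabs_real ger0_norm ?nrm2_ge0// => h.
rewrite -[leRHS](sqr_sqrtr (nrm2_ge0 _)).
by apply: lerXn2r h; rewrite nnegrE ?sqrtr_ge0 ?nrm2_ge0.
Qed.

(** The Hilbert-Schmidt norm of A^k bounds its operator norm, and its square is the trace of
    A^(2k). *)
Lemma nrm2_pow_le_trace A u r : hermitian A -> nrm2 u = 1 ->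
  nrm2 (A *m u) ^+ (2 ^ r) <= \sum_c complex.Re (mpow A (2 ^ r + 2 ^ r) c c).
Proof.
move=> hA u1; apply: le_trans (nrm2_pow_le r hA u1) _.
apply: le_trans (nrm2_mul_le _ _) _; rewrite u1 mulr1.
by apply: ler_sum => c _; rewrite (mpow_diag _ _ hA).
Qed.

End MatrixPowers.

(** * Trace moments of the truncated matrix *)

Section TruncatedMoments.
Local Open Scope complex_scope.
Variables (R : realType) (N : nat) (d : measure_display) (T : measurableType d).
Variables (P : probability T R) (H : T -> 'M[R[i]]_N).
Hypothesis Hh : forall w, hermitian (H w).
Hypothesis Hi : entry_indep P H.
Hypothesis Hn : forall i j, cnice P (fun w => H w i j).
Hypothesis H2 : forall i j, EE P (fun w => cabs (H w i j) ^+ 2) = N%:R^-1.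
Variable B : R.
Hypothesis B0 : 0 < B.

Let P1 : P setT = 1%E := probability_setT P.
Let Hm i j : cmeas (fun w => H w i j). Proof. by case: (Hn i j). Qed.

Definition trunc (x : R[i]) : R[i] := if cabs x <= B then x else 0.

Lemma cabs_trunc x : cabs (trunc x) <= B.
Proof. by rewrite /trunc; case: ifP => // _; rewrite cabs0 ltW. Qed.

Lemma cabs_trunc_le x : cabs (trunc x) <= cabs x.
Proof. by rewrite /trunc; case: ifP => // _; rewrite cabs0 cabs_ge0. Qed.

Lemma truncJ x : trunc (conjc x) = conjc (trunc x).
Proof. by rewrite /trunc cabsJ; case: ifP => // _; rewrite conjc0. Qed.

Lemma cmeas_trunc (d' : measure_display) (T' : measurableType d') (F : T' -> R[i]) :
  cmeas F -> cmeas (fun w => trunc (F w)).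
Proof.
move=> mF; have mc := measurable_cabs mF.
have mS : measurable [set w | cabs (F w) <= B].
  have -> : [set w | cabs (F w) <= B] = (fun w => cabs (F w)) @^-1` `]-oo, B].
    by apply/seteqP; split => x /=; rewrite in_itv.
  by rewrite -[X in measurable X]setTI; exact: mc.
have -> : (fun w => trunc (F w)) = fun w => F w * (\1_[set w | cabs (F w) <= B] w)%:C.
  apply/funext => w; rewrite /trunc indicE; case: ifPn => h; first by rewrite mem_set// mulr1.
  by rewrite memNset ?mulr0//; exact/negP.
by apply: cmeasM => //; apply: cmeas_real; exact: measurable_indic.
Qed.

(** Independence in product form, by induction: resampling the first entry of the list leaves the
    other factors unchanged and makes it independent of them. *)
Lemma cE_prod_entries (F : 'I_N * 'I_N -> R[i] -> R[i]) (c : R) (s : seq ('I_N * 'I_N)) :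
  (forall k (d' : measure_display) (T' : measurableType d') (G : T' -> R[i]),
     cmeas G -> cmeas (fun w => F k (G w))) ->
  (forall k x, cabs (F k x) <= c) -> uniq s -> (forall k, k \in s -> (k.1 <= k.2)%N) ->
  cnice P (fun w => \prod_(k <- s) F k (H w k.1 k.2)) /\
  cE P (fun w => \prod_(k <- s) F k (H w k.1 k.2)) = \prod_(k <- s) cE P (fun w => F k (H w k.1 k.2)).
Proof.
move=> mF bF.
have nF k : cnice P (fun w => F k (H w k.1 k.2)).
  by apply: (cnice_bounded P1 (c := c)) => [|w]; [exact: mF|exact: bF].
elim: s => [|[i j] s IH] /= us ss.
  split; first by under eq_fun do rewrite big_nil; exact: (cnice_cst P1).
  by under eq_fun do rewrite big_nil; rewrite big_nil (cE_cst P1).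
case/andP: us => ks us; have [nr er] := IH us (fun k kin => ss k (mem_behead (s := _ :: _) kin)).
have e : (fun w => \prod_(k <- (i, j) :: s) F k (H w k.1 k.2)) =
    fun w => F (i, j) (H w i j) * \prod_(k <- s) F k (H w k.1 k.2).
  by apply/funext => w; rewrite big_cons.
have nh : cnice P (fun w => F (i, j) (H w i j)) by exact: (nF (i, j)).
rewrite e big_cons; split; first exact: cniceM.
have ij : (i <= j)%N by apply: (ss (i, j)); rewrite inE eqxx.
rewrite -(cE_Hrepl Hh Hm Hi i j (F := fun A => F (i, j) (A i j) * \prod_(k <- s) F k (A k.1 k.2))); last 2 first.
- apply: cmeasM; first by apply: mF; exact: cmeas_entry.
  by apply: cmeas_prod => k; apply: mF; exact: cmeas_entry.
- exact: cniceM.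
rewrite -er mulrC -(cE_prod nr nh); congr (cE _ _); apply/funext => w.
rewrite mulrC; congr (_ * _); last by rewrite mxE !eqxx.
apply: eq_big_seq => -[a b] ls; congr (F _ _) => /=.
have ab : (a <= b)%N by apply: (ss (a, b)); rewrite inE ls orbT.
have nij : (a == i) && (b == j) = false.
  by apply/negbTE; apply: contra ks => /andP[/eqP <- /eqP <-].
have nji : (a == j) && (b == i) = false.
  apply/negbTE; apply: contra ks => /andP[/eqP ea /eqP eb].
  have e' : i = j by apply/val_inj/eqP; rewrite eqn_leq ij -ea -eb ab.
  by rewrite {1}e' -{1}ea {1}(esym e') -eb.
by rewrite mxE nij nji.
Qed.

(** All factors of a walk that involve one entry of the upper triangle; a step in the opposite
    direction contributes the conjugate. *)
Definition entry_factor (r : 'I_N -> 'I_N -> nat) (k : 'I_N * 'I_N) (x : R[i]) : R[i] :=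
  if k.1 == k.2 then trunc x ^+ r k.1 k.2 else trunc x ^+ r k.1 k.2 * trunc (conjc x) ^+ r k.2 k.1.

Definition history_mono r (A : 'M[R[i]]_N) : R[i] :=
  \prod_(k : 'I_N * 'I_N | (k.1 <= k.2)%N) entry_factor r k (A k.1 k.2).

Lemma cabs_entry_factor r k x : cabs (entry_factor r k x) = cabs (trunc x) ^+ mult r k.1 k.2.
Proof.
rewrite /entry_factor /mult; case: eqVneq => [e|_]; first by rewrite cabsX -e.
by rewrite cabsM !cabsX truncJ cabsJ exprD.
Qed.

Lemma history_mono_step r c x A : hermitian A ->
  history_mono (add_step r c x) A = history_mono r A * trunc (A c x).
Proof.
move=> hA; pose k0 : 'I_N * 'I_N := if (c <= x)%N then (c, x) else (x, c).
have k0P : (k0.1 <= k0.2)%N by rewrite /k0; case: (leqP c x) => [//|xc] /=; exact: ltnW.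
rewrite /history_mono (bigD1 k0)//= [in RHS](bigD1 k0)//= mulrAC; congr (_ * _).
  rewrite /entry_factor /k0 /add_step; case: (leqP c x) => cx /=.
    case: (eqVneq c x) => [->|ne]; first by rewrite !eqxx addn1 exprSr.
    by rewrite !eqxx andbF addn1 addn0 exprSr mulrAC.
  have ne : x != c by apply: contraTneq cx => ->; rewrite ltnn.
  by rewrite (negbTE ne) /= !eqxx addn1 addn0 exprSr mulrA -hA.
apply: eq_bigr => -[a b] /= /andP[ab k]; rewrite /entry_factor /add_step /=.
have h1 : (a == c) && (b == x) = false.
  apply/negbTE; apply: contra k => /andP[/eqP ea /eqP eb].
  by rewrite /k0 -ea -eb ab.
have h2 : (b == c) && (a == x) = false.
  apply/negbTE; apply: contra k => /andP[/eqP eb /eqP ea]; rewrite /k0 -ea -eb.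
  case: (leqP b a) => // ba; apply/eqP.
  by have -> : a = b by apply/val_inj/eqP; rewrite eqn_leq ab ba.
by rewrite h1 h2 !addn0.
Qed.

Hypothesis N0 : (0 < N)%N.
Hypothesis mean_trunc : forall i j, cabs (cE P (fun w => trunc (H w i j))) <= N%:R^-1.

(** An edge used once is handled by the mean of the truncated entry; an edge used m + 2 times keeps
    two factors for the variance and bounds m of them by B. *)
Lemma cE_entry_factor_le r k :
  cabs (cE P (fun w => entry_factor r k (H w k.1 k.2))) <= edge_weight N B (mult r k.1 k.2).
Proof.
case: k => a b /=.
have mt i j : cmeas (fun w => trunc (H w i j)) by exact: cmeas_trunc.
have me : cmeas (fun w => entry_factor r (a, b) (H w a b)).
  rewrite /entry_factor /=; case: (a == b); first exact: cmeasX.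
  by apply: cmeasM; apply: cmeasX => //; apply: cmeas_trunc; exact: cmeasJ.
have ef w : cabs (entry_factor r (a, b) (H w a b)) = cabs (trunc (H w a b)) ^+ mult r a b.
  by rewrite cabs_entry_factor.
case E : (mult r a b) => [|[|m]].
- have -> : (fun w => entry_factor r (a, b) (H w a b)) = fun=> 1.
    apply/funext => w; move: E; rewrite /entry_factor /mult /=; case: eqVneq => [<- ->|_] //.
    by move/eqP; rewrite addn_eq0 => /andP[/eqP -> /eqP ->]; rewrite mulr1.
  by rewrite (cE_cst P1) cabs1.
- move: E; rewrite /entry_factor /mult /=; case: eqVneq => [<- ->|ab E]; first exact: mean_trunc.
  case E1 : (r a b) E => [|m]; first rewrite add0n => ->.
    under eq_fun do rewrite expr0 mul1r expr1 -Hh; exact: mean_trunc.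
  rewrite addSn => -[/eqP]; rewrite addn_eq0 => /andP[/eqP -> /eqP ->].
  under eq_fun do rewrite expr0 mulr1 expr1; exact: mean_trunc.
have n2 : rnice P (fun w => cabs (H w a b) ^+ 2) := rniceX P1 2 (rnice_cabs (Hn a b)).
have le w : cabs (entry_factor r (a, b) (H w a b)) <= B ^+ m * cabs (H w a b) ^+ 2.
  rewrite ef E -addn2 exprD; apply: ler_pM; rewrite ?exprn_ge0 ?cabs_ge0//.
    by apply: lerXn2r; rewrite ?nnegrE ?cabs_ge0 ?(ltW B0) ?cabs_trunc.
  by apply: lerXn2r; rewrite ?nnegrE ?cabs_ge0 ?cabs_trunc_le.
have ne : cnice P (fun w => entry_factor r (a, b) (H w a b)).
  apply: (cnice_bounded P1 (c := B ^+ m.+2)) => // w; rewrite ef E.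
  by apply: lerXn2r; rewrite ?nnegrE ?cabs_ge0 ?(ltW B0) ?cabs_trunc.
apply: le_trans (cabs_cE P1 ne) _.
apply: le_trans (EE_le (rnice_cabs ne) (rniceM (rnice_cst P1 _) n2) le) _.
by rewrite (EEZ _ n2) H2.
Qed.

Definition Ht w : 'M[R[i]]_N := \matrix_(i, j) trunc (H w i j).

Lemma Ht_herm w : hermitian (Ht w).
Proof. by move=> i j; rewrite !mxE Hh truncJ. Qed.

Lemma cE_history_mono_le r : cnice P (fun w => history_mono r (H w)) /\
  cabs (cE P (fun w => history_mono r (H w))) <= history_weight B r.
Proof.
pose s := [seq k : 'I_N * 'I_N <- index_enum ('I_N * 'I_N)%type | (k.1 <= k.2)%N].
have us : uniq s by rewrite filter_uniq// index_enum_uniq.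
have ss k : k \in s -> (k.1 <= k.2)%N by rewrite mem_filter => /andP[].
have mF k (d' : measure_display) (T' : measurableType d') (G : T' -> R[i]) : cmeas G ->
    cmeas (fun w => entry_factor r k (G w)).
  move=> mG; rewrite /entry_factor; case: (k.1 == k.2); first by apply: cmeasX; exact: cmeas_trunc.
  by apply: cmeasM; apply: cmeasX; apply: cmeas_trunc => //; exact: cmeasJ.
have [c bF] : exists c, forall k x, cabs (entry_factor r k x) <= c.
  pose g (k : 'I_N * 'I_N) := Num.max B 1 ^+ mult r k.1 k.2.
  have B1 : 1 <= Num.max B 1 by rewrite le_max lexx orbT.
  exists (\sum_k g k) => k x; rewrite cabs_entry_factor (bigD1 k)//= -[leLHS]addr0; apply: lerD.
    apply: lerXn2r; rewrite ?nnegrE ?cabs_ge0//; first exact: le_trans B1.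
    by rewrite (le_trans (cabs_trunc x))// le_max lexx.
  by apply: sumr_ge0 => l _; rewrite exprn_ge0// (le_trans _ B1).
have [n e] := cE_prod_entries mF bF us ss.
have E : (fun w => history_mono r (H w)) = fun w => \prod_(k <- s) entry_factor r k (H w k.1 k.2).
  by apply/funext => w; rewrite /history_mono /s big_filter.
rewrite E; split => //; rewrite e /history_weight /s big_filter.
elim/big_rec2: _ => [|k y1 y2 _ h]; first by rewrite cabs1.
rewrite cabsM; apply: ler_pM; rewrite ?cabs_ge0//; exact: cE_entry_factor_le.
Qed.

Lemma cnice_mpow L a b : cnice P (fun w => mpow (Ht w) L a b).
Proof.
elim: L a b => [|L IH] a b.
  by have := cnice_cst P1 ((1%:M : 'M[R[i]]_N) a b).
under eq_fun do rewrite mpowS mxE.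
apply: (cnice_sum P1) => k; apply: cniceM (IH k b).
apply: (cnice_bounded P1 (c := B)) => [|w]; last by rewrite mxE cabs_trunc.
by under eq_fun do rewrite mxE; exact: cmeas_trunc.
Qed.

(** Expanding one factor of the power moves an entry into the monomial, which is the recursion of
    [walk_sum]. *)
Lemma truncated_moment_le L r c y :
  cabs (cE P (fun w => history_mono r (H w) * mpow (Ht w) L c y)) <= walk_sum B r c L.
Proof.
elim: L r c => [|L IH] r c.
  have [n h] := cE_history_mono_le r; rewrite /= /mpow /=.
  under eq_fun do rewrite mulrC; rewrite (cEZ P1 _ n) mxE; case: (c == y).
    by rewrite mul1r.
  by rewrite mul0r cabs0; exact: history_weight_ge0.
rewrite /=.
have e : (fun w => history_mono r (H w) * mpow (Ht w) L.+1 c y) =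
    fun w => \sum_x history_mono (add_step r c x) (H w) * mpow (Ht w) L x y.
  apply/funext => w; rewrite mpowS mxE mulr_sumr; apply: eq_bigr => x _.
  by rewrite (history_mono_step _ _ _ (Hh w)) mulrA mxE.
rewrite e (cE_sum P1); last by move=> x; apply: cniceM (cnice_mpow _ _ _); case: (cE_history_mono_le (add_step r c x)).
by apply: le_trans (cabs_sum _ _ _) _; apply: ler_sum => x _; exact: IH.
Qed.

Lemma truncated_trace_le (th : R) L : 1 <= th -> th ^+ 3 / N%:R + th ^+ 2 * B <= 2^-1 -> (1 + L)%:R <= th ->
  EE P (fun w => \sum_c complex.Re (mpow (Ht w) L c c)) <= N%:R * (5 / 2) ^+ L.
Proof.
move=> th1 sm Lth; rewrite (EE_sum P1); last by move=> c; apply: rnice_Re; exact: cnice_mpow.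
have -> : N%:R * (5 / 2) ^+ L = \sum_(c < N) (5 / 2) ^+ L :> R by rewrite sumr_const card_ord mulr_natl.
apply: ler_sum => c _.
apply: (@le_trans _ _ (cabs (cE P (fun w => mpow (Ht w) L c c)))).
  apply: le_trans (Re_le_cabs _); exact: ler_norm.
apply: le_trans (walk_sum0_le N0 B0 th1 sm c Lth).
apply: le_trans (truncated_moment_le L (fun _ _ => 0%N) c c).
rewrite le_eqVlt; apply/orP; left; apply/eqP; congr (cabs (cE _ _)); apply/funext => w.
rewrite /history_mono big1 ?mul1r// => k _; rewrite /entry_factor.
by case: ifP => _; rewrite ?expr0 ?mulr1.
Qed.

End TruncatedMoments.

(** * Growth of powers and exponentials *)

Section Growth.
Variable R : realType.

Lemma ev_ge (a K : R) : 0 < a -> exists N0, forall N, (N0 <= N)%N -> K <= N%:R `^ a.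
Proof.
move=> a0; set M := Num.max K 1; exists (Num.truncn (M `^ a^-1)).+1 => N hN.
have M1 : 1 <= M by rewrite le_max lexx orbT.
have M0 : 0 <= M by exact: le_trans M1.
apply: (@le_trans _ _ M); first by rewrite le_max lexx.
have MN : M `^ a^-1 <= N%:R by apply: ltW; apply: lt_le_trans (truncnS_gt _) _; rewrite ler_nat.
have -> : M = (M `^ a^-1) `^ a by rewrite -powRrM mulVf ?gt_eqF// powRr1.
by apply: (ge0_ler_powR (ltW a0)); rewrite ?nnegrE ?powR_ge0 ?ler0n.
Qed.

Lemma ev_nat (K : R) : exists N0, forall N, (N0 <= N)%N -> K <= N%:R.
Proof.
have [N0 h] := ev_ge K (@ltr01 R); exists N0 => N /h.
by rewrite powRr1.
Qed.

Lemma bernoulli_le (x : R) n : 0 <= x -> x * n%:R <= (1 + x) ^+ n.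
Proof.
move=> x0; elim: n => [|n IH]; first by rewrite mulr0n mulr0 expr0.
have h : 1 <= (1 + x) ^+ n by rewrite exprn_ege1// lerDl.
rewrite exprS mulrDl mul1r -natr1 mulrDr mulr1; apply: lerD => //.
by rewrite ler_peMr.
Qed.

(** Induction on the degree: one factor n is paid by (1 + x/3)^n, the others by a second copy, and
    (1 + x/3)^2 <= 1 + x. *)
Lemma poly_le_exp (k : nat) (x : R) : 0 < x -> x <= 1 ->
  exists2 C : R, 0 < C & forall n : nat, n%:R ^+ k <= C * (1 + x) ^+ n.
Proof.
elim: k x => [|k IH] x x0 x1.
  by exists 1 => // n; rewrite expr0 mul1r exprn_ege1// lerDl ltW.
have y0 : 0 < x / 3 by rewrite divr_gt0.
have [|C C0 h] := IH (x / 3) y0; first by lra.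
exists (C / (x / 3)) => [|n]; first by rewrite divr_gt0.
have b := bernoulli_le n (ltW y0).
apply: (@le_trans _ _ ((C * (1 + x / 3) ^+ n) * ((1 + x / 3) ^+ n / (x / 3)))).
  rewrite exprSr; apply: ler_pM; rewrite ?exprn_ge0 ?ler0n//.
  by rewrite ler_pdivlMr// mulrC.
have -> : (C * (1 + x / 3) ^+ n) * ((1 + x / 3) ^+ n / (x / 3)) = C / (x / 3) * ((1 + x / 3) ^+ 2) ^+ n.
  rewrite -exprM mulnC exprM expr2; move: ((1 + x / 3) ^+ n) ((x / 3)^-1) => z t.
  by ring.
apply: ler_wpM2l; first by rewrite divr_ge0 ?ltW.
by apply: lerXn2r; rewrite ?nnegrE ?sqr_ge0 ?addr_ge0 ?(ltW x0)//; nra.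
Qed.

(** The hypothesis says n >= N^(1/16) / 2, and (36/25)^n = (1 + 11/25)^n exceeds every power of such
    an n. *)
Lemma ev_exp (D : nat) : exists N0, forall N n : nat, (N0 <= N)%N ->
  (N <= 2 ^ 16 * n ^ 16)%N -> (25 / 36) ^+ n <= N%:R ^- D :> R.
Proof.
have [||C C0 h] := @poly_le_exp (16 * D.+1) (11 / 25); try lra.
have [N0 hN0] := ev_nat (2 ^+ (16 * D.+1) * C).
exists (maxn N0 1) => N n; rewrite geq_max => /andP[/hN0 hN Npos] Nn.
have N0R : (0 : R) < N%:R by rewrite ltr0n.
have Nn' : (N%:R : R) <= 2 ^+ 16 * n%:R ^+ 16 by rewrite -!natrX -natrM ler_nat.
have e : 1 + 11 / 25 = 36 / 25 :> R by lra.
have := h n; rewrite e => hn.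
have p0 : (0 : R) < (36 / 25) ^+ n by rewrite exprn_gt0// divr_gt0.
have -> : 25 / 36 = (36 / 25)^-1 :> R by rewrite invf_div.
rewrite exprVn lef_pV2 ?posrE ?exprn_gt0//.
rewrite -(ler_pM2l N0R) -exprS.
apply: (@le_trans _ _ ((2 ^+ 16 * n%:R ^+ 16) ^+ D.+1)).
  by apply: lerXn2r; rewrite ?nnegrE ?mulr_ge0 ?exprn_ge0 ?ler0n.
rewrite exprMn -!exprM; apply: (@le_trans _ _ (2 ^+ (16 * D.+1) * (C * (36 / 25) ^+ n))).
  by rewrite ler_wpM2l// exprn_ge0.
by rewrite mulrA ler_wpM2r// ltW.
Qed.

End Growth.

(** * Moments and tails of the entries of a Wigner matrix *)

Section WignerFacts.
Local Open Scope complex_scope.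
Variables (R : realType) (d : measure_display) (T : measurableType d).
Variables (P : probability T R) (Cp : nat -> R) (N : nat) (H : T -> 'M[R[i]]_N).
Hypothesis hW : wigner P Cp H.
Hypothesis N0 : (0 < N)%N.
Local Notation n := (nn_ R N).

Let P1 : P setT = 1%E := probability_setT P.
Let N0R : (0 : R) < N%:R. Proof. by rewrite ltr0n. Qed.
Let sN0 : 0 < Num.sqrt (N%:R : R). Proof. by rewrite sqrtr_gt0. Qed.
Let n0 : 0 < n. Proof. by rewrite invr_gt0. Qed.

Lemma wigner_herm w : hermitian (H w).
Proof. by case: hW => -[h _] _ _ _ _; exact: h. Qed.

Lemma wigner_indep : entry_indep P H.
Proof. by case: hW => _ h _ _ _; exact: h. Qed.

Lemma wigner_cmeas i j : cmeas (fun w => H w i j).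
Proof. by case: hW => -[_ h] _ _ _ _; apply/c2p_meas; exact: h. Qed.

Lemma wigner_nice i j : cnice P (fun w => H w i j).
Proof.
split; first exact: wigner_cmeas.
have mc := measurable_cabs (wigner_cmeas i j).
split => // q; case: hW => _ _ _ _ /(_ i j)[_ _ _ _ /(_ q) hq].
have mf : measurable_fun setT (fun w => (Num.sqrt N%:R * cabs (H w i j)) ^+ q).
  by apply: measurable_funX; apply: measurable_funM => //; exact: measurable_cst.
apply: (@le_integrable _ _ _ _ _ _ _ (fun w => ((Num.sqrt N%:R * cabs (H w i j)) ^+ q)%:E)) => //.
- by apply/measurable_EFinP; apply: measurable_funX; exact: measurableT_comp.
- move=> w _; rewrite !abse_EFin lee_fin normrX normr_id [leRHS]ger0_norm ?exprn_ge0 ?mulr_ge0 ?cabs_ge0 ?(ltW sN0)//.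
  apply: lerXn2r; rewrite ?nnegrE ?mulr_ge0 ?cabs_ge0 ?(ltW sN0)//.
  rewrite ger0_norm ?cabs_ge0// ler_peMl ?cabs_ge0//.
  by rewrite -[leLHS]sqrtr1 ler_sqrt// ler1n.
- apply/integrableP; split; first exact/measurable_EFinP.
  apply: le_lt_trans (ltry (Cp q)); apply: le_trans hq.
  rewrite le_eqVlt; apply/orP; left; apply/eqP; apply: eq_integral => w _.
  by rewrite abse_EFin ger0_norm// exprn_ge0// mulr_ge0 ?cabs_ge0 ?(ltW sN0).
Qed.

Lemma wigner_mean0 i j : cE P (fun w => H w i j) = 0.
Proof.
case: hW => _ _ _ _ /(_ i j)[_ [_ h1] h2 _ _].
by rewrite /cE /EE h1 h2.
Qed.

Lemma wigner_var i j : EE P (fun w => cabs (H w i j) ^+ 2) = N%:R^-1.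
Proof. by case: hW => _ _ _ _ /(_ i j)[_ _ _ h _]; rewrite /EE h. Qed.

Lemma wigner_moment q i j : EE P (fun w => cabs (H w i j) ^+ q) <= Cp q * n ^+ q.
Proof.
have rq : rnice P (fun w => cabs (H w i j) ^+ q) := rniceX P1 q (rnice_cabs (wigner_nice i j)).
have rs : rnice P (fun w => Num.sqrt N%:R ^+ q * cabs (H w i j) ^+ q) := rniceM (rnice_cst P1 _) rq.
case: hW => _ _ _ _ /(_ i j)[_ _ _ _ /(_ q)].
have -> : (fun w => ((Num.sqrt N%:R * cabs (H w i j)) ^+ q)%:E) =
    fun w => (Num.sqrt N%:R ^+ q * cabs (H w i j) ^+ q)%:E by apply/funext => w; rewrite exprMn.
rewrite (fine_EE rs) lee_fin (EEZ _ rq) => h.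
by rewrite /nn_ exprVn ler_pdivlMr ?exprn_gt0// mulrC.
Qed.

Lemma entry_tail (q : nat) (l : R) i j : 0 < l ->
  small P (Cp q / l ^+ q) [set w | l * n <= cabs (H w i j)].
Proof.
move=> l0; have ln0 : 0 < l * n by rewrite mulr_gt0.
have rq : rnice P (fun w => cabs (H w i j) ^+ q) := rniceX P1 q (rnice_cabs (wigner_nice i j)).
apply: small_sub (small_markov (c := (l * n) ^+ q) _ rq _); rewrite ?exprn_gt0//.
- move=> w /= h; apply: lerXn2r => //; rewrite nnegrE ?cabs_ge0// ltW//.
- rewrite mulrC ler_pdivrMr ?exprn_gt0//; apply: le_trans (wigner_moment q i j) _.
  by rewrite exprMn mulrA divfK// expf_neq0// gt_eqF.
- by move=> w; rewrite exprn_ge0// cabs_ge0.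
Qed.

(** The entry has mean 0, so the truncated mean is minus the mean of the part cut off, where |h| >=
    l n allows extra powers of |h| / (l n). *)
Lemma mean_trunc_le (q : nat) (l : R) i j : 0 < l ->
  cabs (cE P (fun w => trunc (l * n) (H w i j))) <= Cp q.+1 * n / l ^+ q.
Proof.
move=> l0; have ln0 : 0 < l * n by rewrite mulr_gt0.
have nh := wigner_nice i j.
have nt : cnice P (fun w => trunc (l * n) (H w i j)).
  apply: (cnice_bounded P1 (c := l * n)) => [|w]; last exact: cabs_trunc.
  exact: cmeas_trunc (wigner_cmeas i j).
have rq : rnice P (fun w => cabs (H w i j) ^+ q.+1) := rniceX P1 q.+1 (rnice_cabs nh).
have -> : cE P (fun w => trunc (l * n) (H w i j)) = - cE P (fun w => H w i j - trunc (l * n) (H w i j)).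
  by rewrite (cEB P1 nh nt) wigner_mean0 sub0r opprK.
rewrite cabsN; apply: le_trans (cabs_cE P1 (cniceB nh nt)) _.
have rr : rnice P (fun w => (l * n) ^- q * cabs (H w i j) ^+ q.+1) := rniceM (rnice_cst P1 _) rq.
apply: le_trans (EE_le (rnice_cabs (cniceB nh nt)) rr _) _.
  move=> w; rewrite /trunc; case: ifPn => [_|].
    by rewrite subrr cabs0 mulr_ge0 ?exprn_ge0 ?cabs_ge0// invr_ge0 exprn_ge0// ltW.
  rewrite -ltNge subr0 => h; rewrite mulrC ler_pdivlMr ?exprn_gt0// exprS ler_wpM2l ?cabs_ge0//.
  by apply: lerXn2r; rewrite ?nnegrE ?cabs_ge0 ?(ltW ln0) ?(ltW h).
rewrite (EEZ _ rq) mulrC ler_pdivrMr ?exprn_gt0//; apply: le_trans (wigner_moment _ i j) _.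
rewrite exprMn exprS mulrA -mulrA -[leRHS]mulrA [X in _ <= _ * X]mulrA [l ^- q * _]mulVf ?mul1r ?mulrA//.
by rewrite expf_neq0// gt_eqF.
Qed.

End WignerFacts.

(** * The local law *)

Section HighProbability.
Local Open Scope complex_scope.
Variables (R : realType) (d : measure_display) (Omega : nat -> measurableType d).
Variables (P : forall N, probability (Omega N) R) (Cp : nat -> R).
Variable H : forall N, Omega N -> 'M[R[i]]_N.
Hypothesis hW : forall N, wigner (P N) Cp (@H N).

Lemma powR_nat_exp (N : nat) (a : R) q : (N%:R `^ a) ^+ q = N%:R `^ (a * q%:R) :> R.
Proof. by rewrite powRrM powR_mulrn// powR_ge0. Qed.

Lemma powR_nat (N k : nat) : N%:R `^ k%:R = N%:R ^+ k :> R.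
Proof. by rewrite powR_mulrn. Qed.

Lemma absorb_inv (N D : nat) (c : R) : (0 < N)%N -> c <= N%:R -> c * N%:R ^- D.+1 <= N%:R ^- D.
Proof.
move=> N0 cN; have N0R : (0 : R) < N%:R by rewrite ltr0n.
rewrite exprS invfM mulrA -[leRHS]mul1r ler_wpM2r ?invr_ge0 ?exprn_ge0//.
by rewrite ler_pdivrMr// mul1r.
Qed.

Lemma entries_whp (dl : R) : 0 < dl -> forall D : nat, exists N0, forall N, (N0 <= N)%N ->
  small (P N) (N%:R ^- D) [set w | exists k : 'I_N * 'I_N, N%:R `^ dl * nn_ R N <= cabs (H w k.1 k.2)].
Proof.
(* D + 3: two powers of N for the number of entries and one to absorb the moment constant. *)
move=> dl0 D; pose q := (Num.truncn ((D + 3)%:R / dl)).+1.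
have qd : (D + 3)%:R <= dl * q%:R.
  by rewrite mulrC -ler_pdivrMr//; apply: ltW; exact: truncnS_gt.
have [N0 h] := ev_nat (Cp q); exists (maxn N0 1) => N; rewrite geq_max => /andP[/h cN Npos].
have N0R : (0 : R) < N%:R by rewrite ltr0n.
have l0 : 0 < N%:R `^ dl :> R by rewrite powR_gt0.
have := small_bigU (fun k : 'I_N * 'I_N => entry_tail (hW N) Npos q k.1 k.2 l0).
apply: small_sub => //.
rewrite card_prod !card_ord natrM.
have lq : N%:R ^+ (D + 3) <= (N%:R `^ dl) ^+ q :> R.
  by rewrite powR_nat_exp -powR_nat ler_powR// ler1n.
have C0 : 0 <= Cp q.
  have := wigner_moment (hW N) Npos q (Ordinal Npos) (Ordinal Npos).
  move=> /(le_trans (EE_ge0 _ _)) => /(_ (fun w => exprn_ge0 q (cabs_ge0 _))).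
  by rewrite pmulr_lge0// exprn_gt0// invr_gt0 sqrtr_gt0.
apply: (@le_trans _ _ (N%:R * N%:R * (N%:R * N%:R ^- (D + 3)))).
  apply: ler_wpM2l; first exact: mulr_ge0.
  apply: ler_pM => //; rewrite ?invr_ge0 ?exprn_ge0 ?(ltW l0)//.
  by rewrite lef_pV2 ?posrE ?exprn_gt0.
rewrite addn3 !exprS; apply: le_of_eq.
by field; rewrite gt_eqF ?exprn_gt0//= gt_eqF.
Qed.

Lemma ratio_pow (x : R) (k : nat) : x * (25 / 36) ^+ k = (9 ^+ k)^-1 * (x * (5 / 2) ^+ (k + k)).
Proof.
have e : 25 / 36 = 9^-1 * (5 / 2) ^+ 2 :> R by field.
by rewrite e exprMn exprVn -exprM mul2n -addnn mulrCA.
Qed.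

(** The trace moment of order 2m is at most N (5/2)^(2m), while a squared norm 9 would force 9^m;
    the ratio (25/36)^m is negligible because m grows like N^(1/16). With high probability
    truncation does not change H. *)
Lemma norm_whp : forall D : nat, exists N0, forall N, (N0 <= N)%N ->
  small (P N) (N%:R ^- D) [set w | exists u, nrm2 u = 1 /\ 9 <= nrm2 (H w *m u)].
Proof.
move=> D; have e0 : (0 : R) < 8^-1 by rewrite invr_gt0.
have [N1 h1] := ev_ge (Num.max 6 (Cp 9)) e0.
have [N2 h2] := entries_whp e0 D.+1.
have [N3 h3] := ev_exp R D.+3.
exists (maxn (maxn N1 N2) (maxn N3 2)) => N.
rewrite !geq_max => /andP[/andP[/h1 l6 /h2 ent] /andP[hN3 N2']].
have Npos : (0 < N)%N by exact: ltnW.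
have N0R : (0 : R) < N%:R by rewrite ltr0n.
set l : R := N%:R `^ 8^-1 in l6 ent.
have l8 : l ^+ 8 = N%:R by rewrite /l powR_nat_exp mulVf ?powRr1.
have [l6' l9] : 6 <= l /\ Cp 9 <= l by move: l6; rewrite ge_max => /andP[].
have l0 : 0 < l by lra.
have nl : nn_ R N = l ^- 4.
  by rewrite /nn_ -l8 -[8%N]/(4 * 2)%N exprM sqrtr_sqr ger0_norm// exprn_ge0// ltW.
(* m is a power of two, for the repeated squaring, with m^16 <= N < 2^16 m^16. With l = N^(1/8) this
   gives m^2 <= l, and the cut-off is B = l N^(-1/2) = l^-3, so the smallness hypothesis on walks
   holds. *)
pose r := trunc_log (2 ^ 16) N; pose m := (2 ^ r)%N.
have /andP[m1 m2] := trunc_log_bounds (isT : 1 < 2 ^ 16)%N Npos.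
have m16 : (m ^ 16 = (2 ^ 16) ^ r)%N by rewrite /m -!expnM mulnC.
have mN : (m ^ 16 <= N)%N by rewrite m16.
have Nm : (N <= 2 ^ 16 * m ^ 16)%N by rewrite m16 -expnS ltnW.
have mpos : (1 <= m)%N by rewrite expn_gt0.
have Ml : m%:R ^+ 2 <= l.
  rewrite -(@ler_pXn2r _ 8)// ?nnegrE ?exprn_ge0 ?(ltW l0)//.
  by rewrite l8 -exprM -natrX ler_nat.
pose th : R := (1 + (m + m))%:R; pose B := l * nn_ R N.
have B0 : 0 < B by rewrite mulr_gt0// nl invr_gt0 exprn_gt0.
have M1 : (1 : R) <= m%:R by rewrite ler1n.
have th3 : th <= 3 * m%:R by rewrite /th !natrD; lra.
have th1 : 1 <= th by rewrite ler1n.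
have thl : th ^+ 2 <= 9 * l.
  apply: (@le_trans _ _ ((3 * m%:R) ^+ 2)).
    by apply: lerXn2r; rewrite ?nnegrE ?mulr_ge0// (le_trans ler01).
  by rewrite exprMn; have := Ml; lra.
have sm : th ^+ 3 / N%:R + th ^+ 2 * B <= 2^-1.
  have a1 : th ^+ 2 * B <= 4^-1.
    rewrite /B nl; apply: (@le_trans _ _ (9 * l * (l * l ^- 4))).
      by rewrite ler_wpM2r// mulr_ge0 ?(ltW l0)// invr_ge0 exprn_ge0// ltW.
    have -> : 9 * l * (l * l ^- 4) = 9 / l ^+ 2 by field; rewrite gt_eqF.
    rewrite ler_pdivrMr ?exprn_gt0//; nra.
  have a2 : th ^+ 3 / N%:R <= 4^-1.
    rewrite ler_pdivrMr// -l8; apply: (@le_trans _ _ ((th ^+ 2) ^+ 2)).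
      by rewrite -exprM ler_weXn2l.
    apply: (@le_trans _ _ ((9 * l) ^+ 2)).
      by apply: lerXn2r; rewrite ?nnegrE ?exprn_ge0 ?mulr_ge0 ?(ltW l0)// (le_trans ler01).
    have -> : l ^+ 8 = l ^+ 2 * (l ^+ 6) by rewrite -exprD.
    have l66 : 6 ^+ 6 <= l ^+ 6 by rewrite lerXn2r ?nnegrE// ltW.
    rewrite exprMn [leRHS]mulrCA [leLHS]mulrC; apply: ler_wpM2l; first exact: sqr_ge0.
    by move: l66; move: (l ^+ 6) => x; lra.
  by lra.
have Hn := wigner_nice (hW N) Npos.
(* The eighth power is used because l^8 = N gives the required 1/N; the ninth moment constant is
   beaten by n <= 1/l. *)
have mt i j : cabs (cE (P N) (fun w => trunc B (H w i j))) <= N%:R^-1.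
  apply: le_trans (mean_trunc_le (hW N) Npos 8 i j l0) _.
  rewrite l8 ler_pdivrMr// mulVf ?gt_eqF// nl ler_pdivrMr ?exprn_gt0// mul1r.
  by apply: le_trans l9 _; rewrite exprS ler_peMr ?(ltW l0)// exprn_ege1//; lra.
have tr := truncated_trace_le (wigner_herm (hW N)) (wigner_indep (hW N)) Hn (wigner_var (hW N))
  B0 Npos mt th1 sm (lexx _ : (1 + (m + m))%:R <= th).
pose f w := \sum_c complex.Re (mpow (Ht (@H N) B w) (m + m) c c).
have hHt w : hermitian (Ht (@H N) B w) := Ht_herm (wigner_herm (hW N)) B w.
have f0 w : 0 <= f w.
  by apply: sumr_ge0 => c _; rewrite (mpow_diag _ _ (hHt w)); apply: sumr_ge0 => b _; exact: sqr_ge0.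
have rf : rnice (P N) f.
  by apply: (rnice_sum (probability_setT (P N))) => c; apply: rnice_Re; apply: cnice_mpow => //.
have sf := small_markov (c := 9 ^+ m) (exprn_gt0 _ (ltac:(by []) : (0 : R) < 9)) rf f0.
apply: small_sub (smallU ent sf).
  move=> w /= [u [u1 u9]]; case: (pselect (exists k : 'I_N * 'I_N, l * nn_ R N <= cabs (H w k.1 k.2))) => [|ne].
    by left.
  right; have e : Ht (@H N) B w = H w.
    apply/matrixP => i j; rewrite mxE /trunc; case: ifPn => //; rewrite -ltNge => h.
    by case: ne; exists (i, j); exact: ltW.
  rewrite /f e; apply: le_trans (nrm2_pow_le_trace r (wigner_herm (hW N) w) u1).
  by apply: lerXn2r; rewrite ?nnegrE ?nrm2_ge0.
have N2R : (2 : R) <= N%:R by rewrite ler_nat.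
have : N%:R ^- D.+1 + (9 ^+ m)^-1 * EE (P N) f <= 2 * N%:R ^- D.+1.
  rewrite mulr_natl mulr2n lerD2l.
  apply: (@le_trans _ _ (N%:R * (25 / 36) ^+ m)).
    by rewrite ratio_pow; apply: ler_wpM2l tr; rewrite invr_ge0 exprn_ge0.
  apply: (@le_trans _ _ (N%:R * N%:R ^- D.+2)); last by rewrite absorb_inv.
  rewrite ler_wpM2l//; apply: le_trans (h3 _ _ hN3 Nm) _.
  by rewrite lef_pV2 ?posrE ?exprn_gt0// ler_weXn2l// ler1n.
by move=> h; apply: le_trans h _; exact: absorb_inv.
Qed.

End HighProbability.

(** * Deterministic steps of the bootstrap *)

Section BootstrapStep.

Lemma polar_combine (C : comNzRingType) (u I a b c d p1 p2 p3 p4 : C) : I * I = -1 -> u * 4 = 1 ->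
  p1 = u * (a + 1 * b + 1 * c + 1 * 1 * d) ->
  p2 = u * (a + I * b + - I * c + - I * I * d) ->
  p3 = u * (a + -1 * b + -1 * c + -1 * -1 * d) ->
  p4 = u * (a + - I * b + I * c + I * - I * d) ->
  b = p1 - I * p2 - p3 + I * p4.
Proof.
move=> ii u4 -> -> -> ->; transitivity (u * 4 * b); first by rewrite u4 mul1r.
have -> : u * (a + 1 * b + 1 * c + 1 * 1 * d)
    - I * (u * (a + I * b + - I * c + - I * I * d))
    - u * (a + -1 * b + -1 * c + -1 * -1 * d)
    + I * (u * (a + - I * b + I * c + I * - I * d)) =
  u * (2 * b + 2 * c) + u * (I * I) * (2 * c - 2 * b) by ring.
by rewrite ii; ring.
Qed.

Local Open Scope complex_scope.
Variables (R : rcfType) (N : nat).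
Implicit Types (A : 'M[R[i]]_N) (z : R[i]) (x y : 'cV[R[i]]_N).
Local Notation e_ := (@ebase R N).

(** The factor 1/2 keeps the vector in the unit ball, so polarization only calls on diagonal forms
    of admissible vectors. *)
Definition polar (c : R[i]) x y : 'cV[R[i]]_N := 2^-1 *: (x + c *: y).

Definition root4 (k : bool * bool) : R[i] := (if k.1 then -1 else 1) * (if k.2 then 'i else 1).

Lemma nrm2D_le x y : nrm2 (x + y) <= 2 * (nrm2 x + nrm2 y).
Proof.
rewrite /nrm2 -big_split mulr_sumr /=; apply: ler_sum => k _; rewrite mxE.
apply: (@le_trans _ _ ((cabs (x k ord0) + cabs (y k ord0)) ^+ 2)).
  by apply: lerXn2r; rewrite ?nnegrE ?addr_ge0 ?cabs_ge0 ?cabsD.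
by move: (cabs _) (cabs _) => a b; have := sqr_ge0 (a - b); nra.
Qed.

Lemma cabs_root4 k : cabs (root4 k) = 1.
Proof.
by case: k => [[] []]; rewrite /root4 /= cabsM ?cabsN ?cabs1 ?cabs_i ?mulr1.
Qed.

Lemma nrm2_polar c x y : cabs c = 1 -> nrm2 x <= 1 -> nrm2 y <= 1 -> nrm2 (polar c x y) <= 1.
Proof.
move=> c1 x1 y1; rewrite /polar nrm2Z cabsV cabs_nat.
have := nrm2D_le x (c *: y); rewrite nrm2Z c1 expr1n mul1r => h.
by move: (nrm2 _) (nrm2 x) (nrm2 y) h x1 y1 => a b e; lra.
Qed.

Lemma qf_polar A z c c' x y : conjc c = c' ->
  qf A z (polar c x y) (polar c x y) = 2^-1 * 2^-1 * (qf A z x x + c * qf A z x y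
     + c' * qf A z y x + c' * c * qf A z y y).
Proof.
move=> <-; have ch : conjc (2^-1 : R[i]) = 2^-1 by rewrite fmorphV rmorph_nat.
rewrite /polar qfZl qfZr ch qfDl !qfDr !qfZl !qfZr.
move: (qf A z x x) (qf A z x y) (qf A z y x) (qf A z y y) (2^-1) (conjc c) => a b e f u c0.
by ring.
Qed.

Lemma qf_polarization A z x y K :
  (forall k, cabs (qf A z (polar (root4 k) x y) (polar (root4 k) x y)) <= K) ->
  cabs (qf A z x y) <= 4 * K.
Proof.
move=> h; have ii : 'i * 'i = -1 :> R[i] by rewrite -expr2 sqr_i.
have u4 : 2^-1 * 2^-1 * 4 = 1 :> R[i] by field.
have ci : conjc ('i : R[i]) = - 'i by apply: complex_ext; rewrite /= ?oppr0.
have q1 := qf_polar A z x y (conjc1 R).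
have q2 := qf_polar A z x y ci.
have cN1 : conjc (-1 : R[i]) = -1 by rewrite rmorphN rmorph1.
have q3 := qf_polar A z x y cN1.
have cNi : conjc (- 'i : R[i]) = 'i by rewrite -ci conjcK.
have q4 := qf_polar A z x y cNi.
have e := polar_combine ii u4 q1 q2 q3 q4.
have r1 : root4 (false, false) = 1 :> R[i] := mulr1 1.
have r2 : root4 (false, true) = 'i :> R[i] := mul1r 'i.
have r3 : root4 (true, false) = -1 :> R[i] := mulr1 (-1).
have r4 : root4 (true, true) = - 'i :> R[i] := mulN1r 'i.
have k1 := h (false, false); have k2 := h (false, true); have k3 := h (true, false); have k4 := h (true, true).
rewrite r1 in k1; rewrite r2 in k2; rewrite r3 in k3; rewrite r4 in k4.
rewrite e; have -> : 4 * K = K + K + K + K by ring.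
have i1 (c : R[i]) : cabs c <= K -> cabs ('i * c) <= K by rewrite cabsM cabs_i mul1r.
exact: (cabs_lerD (cabs_lerB (cabs_lerB k1 (i1 _ k2)) k3) (i1 _ k4)).
Qed.

(* If t is the left-hand side, the resolvent identity gives t <= C + sqrt (K C t). *)
Lemma qf_step A z z' x (K C : R) : hermitian A -> 0 < complex.Im z -> complex.Im z <= complex.Im z' ->
  complex.Re z = complex.Re z' -> complex.Im z' <= K * complex.Im z -> 0 <= K ->
  cabs (qf A z' x x) <= C -> cabs (qf A z x x) <= (2 + K) * C.
Proof.
move=> hA z0 zz Rz Kz K0 hC; set t := cabs (qf A z x x).
have z0' : 0 < complex.Im z' := lt_le_trans z0 zz.
have nz : complex.Im z != 0 by rewrite gt_eqF.
have nz' : complex.Im z' != 0 by rewrite gt_eqF.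
have C0 : 0 <= C := le_trans (cabs_ge0 _) hC.
have t0 : 0 <= t := cabs_ge0 _.
set y := complex.Im z; set y' := complex.Im z'; rewrite -/y -/y' in z0 zz Kz z0'.
have e : qf A z x x = qf A z' x x + (z - z') * dotc (adjmx (res A z) *m x) (res A z' *m x).
  rewrite -dotc_adj /qf -{1}[res A z](subrK (res A z')) (res_sub_z hA nz nz') mulmxDl dotcDr addrC.
  by rewrite -scalemxAl dotcZr mulmxA.
have dzz : cabs (z - z') <= y'.
  rewrite /cabs cReD cImD cReN cImN Rz subrr expr0n add0r sqrtr_sqr ler_norml -/y -/y'.
  by apply/andP; split; lra.
have n1 : Num.sqrt (nrm2 (adjmx (res A z) *m x)) <= Num.sqrt (t / y).
  rewrite ler_sqrt ?divr_ge0 ?(ltW z0)// ler_pdivlMr// mulrC -ward_l//.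
  by apply: le_trans (Im_qf_le _ _ _) _.
have n2 : Num.sqrt (nrm2 (res A z' *m x)) <= Num.sqrt (C / y').
  rewrite ler_sqrt ?divr_ge0 ?(ltW z0')// ler_pdivlMr// mulrC -ward_r//.
  by apply: le_trans (Im_qf_le _ _ _) _.
have h : t <= C + y' * (Num.sqrt (t / y) * Num.sqrt (C / y')).
  rewrite /t {1}e; apply: cabs_lerD => //; apply: cabs_ler_pM => //.
  apply: le_trans (dotc_cauchy_schwarz _ _) _.
  by apply: ler_pM; rewrite ?sqrtr_ge0.
have h2 : y' * (Num.sqrt (t / y) * Num.sqrt (C / y')) <= (t + K * C) / 2.
  have y'0 : 0 <= y' := ltW z0'.
  have ty : 0 <= t / y by rewrite divr_ge0// ltW.
  have -> : y' * (Num.sqrt (t / y) * Num.sqrt (C / y')) = Num.sqrt (y' ^+ 2 * (t / y * (C / y'))).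
    by rewrite (sqrtrM _ (sqr_ge0 y')) (sqrtrM _ ty) sqrtr_sqr ger0_norm.
  have -> : y' ^+ 2 * (t / y * (C / y')) = t * (y' / y * C) by field; rewrite !gt_eqF.
  apply: (@le_trans _ _ (Num.sqrt (t * (K * C)))).
    rewrite ler_sqrt; last by rewrite !mulr_ge0.
    by apply: ler_wpM2l => //; apply: ler_wpM2r => //; rewrite ler_pdivrMr.
  have KC : 0 <= K * C by rewrite mulr_ge0.
  have s0 : 0 <= (t + K * C) / 2 by rewrite divr_ge0// addr_ge0.
  rewrite -[leRHS](ger0_norm s0) -sqrtr_sqr ler_sqrt ?sqr_ge0//.
  have g (b a : R) : b * a <= ((b + a) / 2) ^+ 2 by have := sqr_ge0 (b - a); nra.
  exact: g.
have g (b a c k : R) : b <= c + a -> a <= (b + k) / 2 -> b <= 2 * c + k by lra.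
by rewrite mulrDl; exact: g h h2.
Qed.

Lemma Xst_average A z : (0 < N)%N ->
  (\sum_k Xst A z (e_ k)) / N%:R = 1 + (z + mst A z) * mst A z.
Proof.
move=> N0; have n0 : N%:R != 0 :> R[i] by rewrite pnatr_eq0 -lt0n.
have e k : Xst A z (e_ k) = 1 + (z + mst A z) * qf A z (e_ k) (e_ k).
  by rewrite /Xst nrm2_ebase rmorph1.
rewrite (eq_bigr _ (fun k _ => e k)) big_split /= sumr_const card_ord mulrDl divff// -mulr_sumr.
by rewrite -mulrA.
Qed.

(** As (z + m) m is within 1/2 of -1, m is bounded and z + m stays away from 0. It is left open
    which root of the quadratic m is near. *)
Lemma mst_bound A z (Z : R) : 0 <= Z -> cabs z <= Z -> cabs (1 + (z + mst A z) * mst A z) <= 2^-1 ->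
  cabs (mst A z) <= Z + 2 /\ 1 <= 2 * (Z + 2) * cabs (z + mst A z).
Proof.
move=> Z0 zZ; set m := mst A z => h.
have low : 2^-1 <= cabs (z + m) * cabs m.
  rewrite -cabsM; have := cabs_sub_le 1 (- ((z + m) * m)).
  by rewrite cabs1 cabsN opprK; move: (cabs _) (cabs _) h => a b; lra.
have up : cabs m ^+ 2 <= 3 / 2 + Z * cabs m.
  rewrite -cabsX; have := cabs_sub_le (m ^+ 2) (- (1 + z * m)).
  have -> : m ^+ 2 - - (1 + z * m) = 1 + (z + m) * m by ring.
  rewrite cabsN => h1; have := cabsD 1 (z * m); rewrite cabs1 cabsM.
  have := ler_wpM2r (cabs_ge0 m) zZ; move: (cabs z * _) (Z * _) (cabs (m ^+ 2)) (cabs (1 + z * m)) h1 h.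
  by move: (cabs _) => a b c d f; lra.
have mZ : cabs m <= Z + 2.
  rewrite leNgt; apply/negP => lt; move: up lt (cabs_ge0 m); move: (cabs m) => x; nra.
split=> //; have := ler_wpM2l (cabs_ge0 (z + m)) mZ; move: low.
by move: (cabs (z + m)) (cabs m) => a b; nra.
Qed.

(** A bounded X bounds (z + m) times the form, and z + m is bounded below. *)
Lemma qf_of_Xst A z x (Z : R) : 0 <= Z -> cabs z <= Z -> nrm2 x <= 1 ->
  cabs (1 + (z + mst A z) * mst A z) <= 2^-1 -> cabs (Xst A z x) <= 1 ->
  cabs (qf A z x x) <= 4 * (Z + 2).
Proof.
move=> Z0 zZ x1 h X1; have [_ low] := mst_bound Z0 zZ h.
have up : cabs (z + mst A z) * cabs (qf A z x x) <= 2.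
  rewrite -cabsM; have := cabs_sub_le ((z + mst A z) * qf A z x x) (- (nrm2 x)%:C).
  rewrite opprK cabsN cabs_real ger0_norm ?nrm2_ge0// [_ * _ + _]addrC -/(Xst A z x).
  by move: (cabs _) (cabs _) (nrm2 x) X1 x1 => a b c; lra.
have q0 := cabs_ge0 (qf A z x x).
have := ler_wpM2r q0 low; rewrite mul1r => h1; apply: le_trans h1 _.
rewrite -mulrA; have Z2 : 0 <= 2 * (Z + 2) by lra.
by have := ler_wpM2l Z2 up; lra.
Qed.

End BootstrapStep.

(** * From larger to smaller imaginary parts *)

Section Bootstrap.
Local Open Scope complex_scope.
Variables (R : realType) (d : measure_display) (Omega : nat -> measurableType d).
Variables (P : forall N, probability (Omega N) R) (Cp : nat -> R).
Variable H : forall N, Omega N -> 'M[R[i]]_N.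
Hypothesis hW : forall N, wigner (P N) Cp (@H N).
Variables (ze dl T : R).
Hypotheses (dl0 : 0 < dl) (hdl : 244 * dl <= ze) (ze1 : ze <= 2^-1) (T0 : 0 <= T).

Definition dom N (z : R[i]) : Prop :=
  [/\ `|complex.Re z| <= 3, N%:R `^ (-1 + ze) <= complex.Im z & complex.Im z <= T + 1].

Local Notation Z := (T + 4).
Local Notation C0 := (4 * (Z + 2)).

(* The bootstrap alternates between claimQ and claimX: 4 (Z + 2) bounds a quadratic form as
   soon as the X's are small, Z being a bound for |z|; the exponent 61 dl is one dl from
   Markov's inequality and Gam^30 with Gam = N^(2 dl), and the condition 244 dl <= ze makes
   the bound smaller than N^(-ze/4). *)
Definition claimQ (b : R) := forall D : nat, exists N0, forall N, (N0 <= N)%N ->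
  forall (x : 'cV[R[i]]_N) z, nrm2 x <= 1 -> dom N z -> N%:R `^ b <= complex.Im z ->
  small (P N) (N%:R ^- D) [set w | C0 < cabs (qf (H w) z x x)].

Definition claimX (b : R) := forall D : nat, exists N0, forall N, (N0 <= N)%N ->
  forall (x : 'cV[R[i]]_N) z, nrm2 x <= 1 -> dom N z -> N%:R `^ b <= complex.Im z ->
  small (P N) (N%:R ^- D) [set w | N%:R `^ (61 * dl) * psi_ N z <= cabs (Xst (H w) z x)].

Lemma powR_nat1 N : N%:R `^ 1 = N%:R :> R. Proof. exact: powRr1. Qed.

Lemma powR_natD N (a b : R) : (0 < N)%N -> N%:R `^ (a + b) = N%:R `^ a * N%:R `^ b :> R.
Proof. by move=> N0; rewrite powRD// pnatr_eq0 -lt0n N0 implybT. Qed.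

Lemma dom_im N z : (0 < N)%N -> dom N z -> 0 < complex.Im z.
Proof. by move=> N0 [_ h _]; apply: lt_le_trans h; rewrite powR_gt0// ltr0n. Qed.

Lemma dom_Nim N z : (0 < N)%N -> dom N z -> N%:R `^ ze <= N%:R * complex.Im z.
Proof.
move=> N0 [_ h _]; have N0R : (0 : R) < N%:R by rewrite ltr0n.
have -> : N%:R `^ ze = N%:R * N%:R `^ (-1 + ze) :> R.
  by rewrite -{2}[N%:R]powR_nat1 -powR_natD// addrA subrr add0r.
by rewrite ler_wpM2l// ltW.
Qed.

Lemma dom_cabs N z : (0 < N)%N -> dom N z -> cabs z <= Z.
Proof.
move=> N0 hz; have i0 := dom_im N0 hz; case: hz => h1 _ h3.
by apply: le_trans (cabs_le_ReIm z) _; rewrite (ger0_norm (ltW i0)); lra.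
Qed.

Lemma powR_ge1 N (a : R) : (0 < N)%N -> 0 <= a -> 1 <= N%:R `^ a :> R.
Proof. by move=> N0 a0; rewrite -[leLHS](powRr0 N%:R) ler_powR// ler1n. Qed.

Lemma psi_sq N z : (0 < N)%N -> dom N z -> psi_ N z ^+ 2 = (N%:R * complex.Im z)^-1.
Proof.
move=> N0 hz; have N0R : (0 : R) < N%:R by rewrite ltr0n.
rewrite /psi_ /nn_ /hh_ expr_div_n exprVn !sqr_sqrtr ?(ltW N0R) ?(ltW (dom_im N0 hz))//.
by rewrite invfM.
Qed.

Lemma psi_ge0 N (z : R[i]) : 0 <= psi_ N z.
Proof. by rewrite /psi_ divr_ge0 ?sqrtr_ge0// invr_ge0 sqrtr_ge0. Qed.

Lemma psi_le N z : (0 < N)%N -> dom N z -> psi_ N z <= N%:R `^ (- (ze / 2)).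
Proof.
move=> N0 hz; rewrite -(@ler_pXn2r _ 2)// ?nnegrE ?psi_ge0 ?powR_ge0// (psi_sq N0 hz).
rewrite powR_nat_exp mulNr divfK// powRN lef_pV2 ?posrE ?powR_gt0 ?ltr0n//.
  exact: dom_Nim.
by rewrite mulr_gt0 ?ltr0n// (dom_im N0 hz).
Qed.

Lemma psi_ge N z : (0 < N)%N -> T + 1 <= N%:R -> dom N z -> N%:R^-1 <= psi_ N z.
Proof.
move=> N0 TN hz; have N0R : (0 : R) < N%:R by rewrite ltr0n.
rewrite -(@ler_pXn2r _ 2)// ?nnegrE ?psi_ge0 ?invr_ge0 ?(ltW N0R)// (psi_sq N0 hz).
rewrite exprVn lef_pV2 ?posrE ?exprn_gt0// ?mulr_gt0 ?(dom_im N0 hz)// expr2 ler_wpM2l ?(ltW N0R)//.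
by case: hz => _ _ h; apply: le_trans TN.
Qed.

Lemma claimQ_base : claimQ 0.
Proof.
move=> D; exists 1%N => N N0 x z x1 hz; rewrite powRr0 => i1.
apply: (small_sub _ _ (small0 (P N))); last by rewrite invr_ge0 exprn_ge0.
move=> w /=; apply/negP; rewrite -leNgt.
have i0 := dom_im N0 hz.
apply: le_trans (qf_le x x (wigner_herm (hW N) w) i0) _.
rewrite -expr2 sqr_sqrtr ?nrm2_ge0// ler_pdivrMr//.
have C1 : 1 <= C0 by have := T0; lra.
by apply: le_trans x1 _; rewrite -[leLHS]mulr1; apply: ler_pM.
Qed.

(** The eight kinds of pairs in [good], indexed by a finite type so that one union bound covers
    them. *)
Definition gpair N (x : 'cV[R[i]]_N) (u : 'I_N -> 'cV[R[i]]_N) k l (s : bool * bool * bool) :=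
  match s with
  | (false, false, false) => (ebase R k, ebase R l)
  | (false, false, true) => (ebase R k, x)
  | (false, true, false) => (x, ebase R k)
  | (false, true, true) => (x, x)
  | (true, false, false) => (ebase R k, u k)
  | (true, false, true) => (u k, x)
  | (true, true, false) => (x, u k)
  | (true, true, true) => (u k, u k)
  end.

Lemma nrm2_gpair N (x : 'cV[R[i]]_N) u k l s : nrm2 x <= 1 -> (forall k, nrm2 (u k) <= 1) ->
  nrm2 (gpair x u k l s).1 <= 1 /\ nrm2 (gpair x u k l s).2 <= 1.
Proof. by move=> x1 u1; case: s => [[[] []] []]; split; rewrite /= ?nrm2_ebase. Qed.

Lemma good_of_polar N (A : 'M[R[i]]_N) z x u (K G : R) : (0 < N)%N -> 4 * K <= G ->
  (forall k l s a, cabs (qf A z (polar (root4 R a) (gpair x u k l s).1 (gpair x u k l s).2)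
     (polar (root4 R a) (gpair x u k l s).1 (gpair x u k l s).2)) <= K) ->
  good A z x u G.
Proof.
move=> N0 KG h; pose o := Ordinal N0.
have g k l s : cabs (qf A z (gpair x u k l s).1 (gpair x u k l s).2) <= G.
  by apply: le_trans KG; apply: qf_polarization => a; exact: h.
split; [move=> k l; exact: (g k l (false, false, false))|move=> k; exact: (g k o (false, false, true))
 |move=> k; exact: (g k o (false, true, false))|exact: (g o o (false, true, true))
 |move=> k; exact: (g k o (true, false, false))|move=> k; exact: (g k o (true, false, true))
 |move=> k; exact: (g k o (true, true, false))|move=> k; exact: (g k o (true, true, true))].
Qed.

Lemma moment_constant (p : nat) (x C4 : R) : 490 * (((2 * p + 7)%:R * (3 * x ^+ 2) ^+ (2 * p + 6)) ^+ 2) * x ^+ 4 * (1 + C4) =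
  (490 * ((2 * p + 7)%:R * 3 ^+ (2 * p + 6)) ^+ 2 * (1 + C4)) * x ^+ (4 * (2 * p + 6) + 4).
Proof.
have -> : x ^+ (4 * (2 * p + 6) + 4) = (x ^+ 2) ^+ (2 * p + 6) * (x ^+ 2) ^+ (2 * p + 6) * x ^+ 4.
  by rewrite -!exprM -!exprD; congr (_ ^+ _); clear; lia.
rewrite (exprMn _ 3); move: (3 ^+ _) ((x ^+ 2) ^+ _) (_%:R) => a b c; ring.
Qed.

(** The last inequality is why Gam is taken to be K^2: 4 comes from polarization, 2 + K from
    [qf_step], and c is the constant of [claimQ]. *)
Lemma bootstrap_constants (K k U c : R) : 0 <= k -> 0 <= U -> 0 <= c ->
  100 + k + (U + 4) + 8 * c <= K ->
  [/\ 0 < K, 2 <= K, 1 <= K & [/\ 100 <= K, k <= K, U + 4 <= K, U + 1 <= K & 4 * ((2 + K) * c) <= K ^+ 2]].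
Proof.
move=> k0 U0 c0 h; split; try lra; split; try lra.
have K0 : 0 <= K by lra.
have := ler_wpM2l K0 (_ : 8 * c <= K); move=> /(_ ltac:(lra)); nra.
Qed.

(** Bounds at a point z' with larger imaginary part reach z through [qf_step] at the price of a
    factor 2 + N^dl. Polarization turns them into [good] with Gam = N^(2 dl), and Markov's
    inequality is applied to a high moment of X. *)
Lemma claimX_of_claimQ b : b <= 0 -> claimQ b -> claimX (b - dl).
Proof.
move=> b0 hQ D; have := T0; have := dl0; have := hdl; have := ze1 => ze1' hdl' dl0' T0'.
have ze0 : 0 < ze by lra.
have dl1 : dl <= 1 by lra.
have d6 : 2 * dl * 3%:R + - 2^-1 <= 0 by lra.
have T1 : 1 <= T + 1 by lra.
have C00 : 0 <= C0 by lra.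
(* The moment is so high that one factor N^dl per power of X yields N^(-D-3). *)
pose p := (Num.truncn ((D + 3)%:R / dl)).+1; pose k := (2 * p + 6)%N.
have kD : (D + 3)%:R <= dl * k%:R.
  rewrite mulrC -ler_pdivrMr//; apply: ltW; apply: lt_le_trans (truncnS_gt _) _.
  by rewrite ler_nat -/p /k; clear; lia.
(* The bad terms carry N^(4k+4); with e = N^-E they stay below N^-k, hence below a^k, since a >=
   1/N. *)
pose E := (5 * k + 4)%N; pose C4 : R := `|Cp 4|.
pose c1 : R := 2 * (2 ^+ k + 1) ^+ (2 * p + 5).
pose c2 : R := 490 * ((2 * p + 7)%:R * 3 ^+ k) ^+ 2 * (1 + C4).
have c10 : 0 <= c1 by rewrite mulr_ge0// exprn_ge0// addr_ge0// exprn_ge0.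
have c20 : 0 <= c2 := mulr_ge0 (mulr_ge0 (ler0n R 490) (sqr_ge0 _)) (addr_ge0 ler01 (normr_ge0 _)).
have [N1 h1] := ev_ge (100 + k%:R + Z + 8 * C0) dl0.
have [N2 h2] := ev_nat (c1 + c2 + 32).
have [N3 h3] := entries_whp hW dl0 (E * 2).+1.
have [N4 h4] := hQ (E * 2 + 4)%N.
exists (maxn (maxn N1 N2) (maxn N3 N4)) => N; rewrite !geq_max.
move=> /andP[/andP[/h1 hM /h2 hc] /andP[/h3 ent /h4 {}hQ]] x z x1 hz hb.
have N32 : (32 : R) <= N%:R by apply: le_trans hc; rewrite lerDr addr_ge0.
have cN : c1 + c2 <= N%:R by apply: le_trans hc; rewrite lerDl.
have N0 : (0 < N)%N by rewrite -(ltr_nat R); apply: lt_le_trans N32.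
have N0R : (0 : R) < N%:R by rewrite ltr0n.
have N1R : (1 : R) <= N%:R by rewrite ler1n.
set K : R := N%:R `^ dl in hM; have k0 : (0 : R) <= k%:R by [].
have [K0 K2 K1 [K100 kK ZK TK CK]] := bootstrap_constants k0 T0' C00 hM.
have KN : K <= N%:R by rewrite -[leRHS]powR_nat1 ler_powR.
have i0 := dom_im N0 hz; have zZ := dom_cabs N0 hz.
have Ni : 1 <= N%:R * complex.Im z by apply: le_trans (dom_Nim N0 hz); apply: powR_ge1 => //; exact: ltW.
pose G : R := N%:R `^ (2 * dl).
have GK : G = K ^+ 2 by rewrite /G /K powR_nat_exp mulrC.
have KG : K <= G by rewrite GK expr2 ler_peMr ?(ltW K0).
have G1 : 1 <= G := le_trans K1 KG.
have [Rz lz uz] := hz.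
have hh2 : hh_ z ^+ 2 = complex.Im z by rewrite sqr_sqrtr// ltW.
have nn2 : nn_ R N ^+ 2 = N%:R^-1 by rewrite /nn_ exprVn sqr_sqrtr// ltW.
have nn0 : 0 < nn_ R N by rewrite invr_gt0 sqrtr_gt0.
have rg : regime N p z G.
  have zG : cabs z <= G := le_trans zZ (le_trans ZK KG).
  have G100 : 100 <= G := le_trans K100 KG.
  have kG : k%:R <= G := le_trans kK KG.
  apply: (Regime N0 i0 G100 kG _ _ _ zG).
  - rewrite -(@ler_pXn2r _ 2)// ?nnegrE ?(ltW nn0) ?sqrtr_ge0// hh2 nn2.
    by rewrite -[_^-1]mul1r ler_pdivrMr// mulrC.
  - rewrite -(@ler_pXn2r _ 2)// ?nnegrE ?sqrtr_ge0 ?powR_ge0// hh2.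
    have GG : G <= G ^+ 2 by rewrite expr2 ler_peMr ?powR_ge0.
    exact: le_trans uz (le_trans TK (le_trans KG GG)).
  - have -> : nn_ R N = N%:R `^ (- 2^-1) by rewrite powRN powR12_sqrt// ltW.
    by rewrite powR_nat_exp -powR_natD// -[leRHS](powRr0 N%:R) ler_powR.
(* Raises the imaginary part by the factor K but not beyond 1, and never lowers it; so z' stays in
   the domain and satisfies the hypothesis for b. *)
pose y' := Num.max (complex.Im z) (Num.min (K * complex.Im z) 1).
pose z' : R[i] := Complex (complex.Re z) y'.
have y1 : complex.Im z <= y' by rewrite le_max lexx.
have y2 : y' <= K * complex.Im z.
  by rewrite ge_max ler_peMl ?(ltW i0)//= ?ge_min ?lexx.
have hz' : dom N z'.
  split => //=; first exact: le_trans lz y1.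
  by rewrite ge_max uz ge_min T1 orbT.
have hb' : N%:R `^ b <= complex.Im z'.
  rewrite /= le_max le_min; apply/orP; right; apply/andP; split.
    have := ler_wpM2l (ltW K0) hb; rewrite /K -powR_natD//.
    by rewrite addrC subrK.
  by rewrite -[leRHS](powRr0 N%:R) ler_powR.
pose kv := kapv (P N) (@H N) x.
have kv1 j : nrm2 (kv j) <= 1 by exact: (nrm2_kapv (wigner_nice (hW N) N0) (wigner_var (hW N)) rg x1 j).
(* N^2 index pairs, 8 kinds of pairs of vectors and 4 roots of unity: 32 N^2 <= N^3 events. *)
pose I := (('I_N * 'I_N) * ((bool * bool * bool) * (bool * bool)))%type.
pose pv (c : I) := polar (root4 R c.2.2) (gpair x kv c.1.1 c.1.2 c.2.1).1 (gpair x kv c.1.1 c.1.2 c.2.1).2.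
have pv1 c : nrm2 (pv c) <= 1.
  have [g1 g2] := nrm2_gpair c.1.1 c.1.2 c.2.1 x1 kv1.
  by apply: nrm2_polar => //; exact: cabs_root4.
have sQ := small_bigU (fun c : I => hQ (pv c) z' (pv1 c) hz' hb').
have [A [mA BA PA]] := smallU ent sQ.
pose e : R := N%:R ^- E.
have e0 : 0 < e by rewrite invr_gt0 exprn_gt0.
have e1 : e <= 1 by rewrite invf_le1 ?exprn_gt0// exprn_ege1.
have PA2 : fine (P N A) <= e ^+ 2.
  apply: le_trans PA _; rewrite /e exprVn -exprM.
  apply: (@le_trans _ _ (2 * N%:R ^- (E * 2).+1)); last by apply: absorb_inv => //; apply: le_trans N32; rewrite ler_nat.
  rewrite (mulr_natl _ 2) mulr2n lerD2l !card_prod !card_ord !card_bool !natrM.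
  have -> : (E * 2 + 4 = (E * 2).+4)%N by rewrite addnC.
  apply: (@le_trans _ _ (N%:R * N%:R * N%:R * N%:R ^- (E * 2).+4)).
    by apply: ler_wpM2r; [rewrite invr_ge0 exprn_ge0|apply: ler_wpM2l; [exact: mulr_ge0|by apply: le_trans N32; rewrite -!natrM ler_nat]].
  rewrite !exprS; apply: le_of_eq; field.
  by rewrite expf_neq0 ?gt_eqF//= gt_eqF.
have hA w : ~ A w -> good (H w) z x kv G /\ forall i j, cabs (H w i j) <= G * nn_ R N.
  move=> Aw; split; last first.
    move=> i j; apply: (@le_trans _ _ (K * nn_ R N)); last by rewrite ler_wpM2r// ltW.
    rewrite leNgt; apply/negP => h; apply: Aw; apply: BA; left; exists (i, j); exact: ltW.
  apply: (good_of_polar (K := (2 + K) * C0)) => //.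
    by rewrite GK.
  move=> i j s a; apply: (qf_step (wigner_herm (hW N) w) i0 (z' := z')) => //; first exact: ltW.
  rewrite leNgt; apply/negP => h; apply: Aw; apply: BA; right; exists ((i, j), (s, a)); exact: h.
have H4 i j : EE (P N) (fun w => cabs (H w i j) ^+ 4) <= C4.
  apply: le_trans (wigner_moment (hW N) N0 4 i j) _; rewrite -[leRHS]mulr1.
  apply: (@le_trans _ _ (C4 * nn_ R N ^+ 4)).
    by rewrite ler_wpM2r ?exprn_ge0 ?(ltW nn0)// ler_norm.
  apply: ler_wpM2l; first exact: normr_ge0.
  apply: exprn_ile1; first exact: ltW.
  by rewrite invf_le1 ?sqrtr_gt0// -[leLHS]sqrtr1 ler_sqrt.
have zN : cabs z <= N%:R := le_trans zZ (le_trans ZK KN).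
have mb := moment_bound (wigner_herm (hW N)) (wigner_indep (hW N)) (wigner_nice (hW N) N0)
  (wigner_mean0 (hW N)) (wigner_var (hW N)) H4 rg Ni zN x1 mA e0 e1 PA2 hA.
rewrite -/k in mb; pose psi := psi_ N z; pose a := G ^+ 30 * psi.
have psiN : N%:R^-1 <= psi by apply: psi_ge => //; exact: le_trans KN.
have psi0 : 0 < psi by apply: lt_le_trans psiN; rewrite invr_gt0.
have aN : N%:R^-1 <= a by apply: le_trans psiN _; rewrite ler_peMl ?(ltW psi0)// exprn_ege1.
have a0 : 0 < a by apply: lt_le_trans aN; rewrite invr_gt0.
(* 61 = 2 * 30 + 1. *)
have Ka : N%:R `^ (61 * dl) * psi = K * a.
  rewrite /a mulrA; congr (_ * _); rewrite GK -exprM -exprS /K powR_nat_exp.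
  by congr (_ `^ _); rewrite mulrC.
have nX : cnice (P N) (fun w => Xst (H w) z x).
  apply: (cnice_bounded (probability_setT (P N)) (c := 3 * N%:R ^+ 2)).
    by apply: cmeas_Xst; exact: (wigner_cmeas (hW N)).
  by move=> w; apply: (Xst_crude (wigner_herm (hW N) w)).
have rk : rnice (P N) (fun w => cabs (Xst (H w) z x) ^+ k) := rniceX (probability_setT (P N)) k (rnice_cabs nX).
have sm := small_markov (c := (K * a) ^+ k) (exprn_gt0 _ (mulr_gt0 K0 a0)) rk
  (fun w => exprn_ge0 k (cabs_ge0 _)).
apply: small_sub sm.
  move=> w /=; rewrite -/psi Ka => h; apply: lerXn2r => //; rewrite nnegrE ?cabs_ge0//.
  by rewrite mulr_ge0 ?(ltW K0) ?(ltW a0).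
rewrite exprMn invfM; have Kk : N%:R ^+ (D + 3) <= K ^+ k.
  by rewrite /K powR_nat_exp -powR_nat ler_powR.
have ak0 : 0 < a ^+ k by rewrite exprn_gt0.
have rest : (a ^+ k)^-1 * EE (P N) (fun w => cabs (Xst (H w) z x) ^+ k) <= c1 + c2.
  rewrite mulrC ler_pdivrMr// mulrDl; apply: le_trans mb _; apply: lerD.
    by rewrite /c1 mulrA.
  rewrite /Lc moment_constant -/k -/c2 mulrCA; apply: ler_wpM2l => //.
  rewrite mulrC /e ler_pdivrMr ?exprn_gt0//.
  apply: (@le_trans _ _ ((N%:R^-1) ^+ k * N%:R ^+ E)); last first.
    rewrite ler_wpM2r ?exprn_ge0// lerXn2r ?nnegrE ?invr_ge0 ?(ltW a0)//.
  rewrite exprVn mulrC ler_pdivlMr ?exprn_gt0// -exprD.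
  by rewrite /E; have -> : (4 * k + 4 + k = 5 * k + 4)%N by clear; lia.
rewrite -mulrA; apply: (@le_trans _ _ (N%:R ^- (D + 3) * N%:R)).
  apply: ler_pM => //; rewrite ?invr_ge0 ?exprn_ge0 ?(ltW K0)//.
  - rewrite mulr_ge0 ?invr_ge0 ?(ltW ak0)// EE_ge0// => w; exact: exprn_ge0 (cabs_ge0 _).
  - by rewrite lef_pV2 ?posrE ?exprn_gt0.
  - exact: le_trans rest cN.
rewrite addn3 mulrC; apply: (@le_trans _ _ (N%:R ^- D.+2)); first exact: absorb_inv.
by rewrite lef_pV2 ?posrE ?exprn_gt0// ler_weXn2l// -addn2 leq_addr.
Qed.

End Bootstrap.

(** * The law on the whole domain, uniformly in z *)

Section LocalLaw.
Local Open Scope complex_scope.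
Variables (R : realType) (d : measure_display) (Omega : nat -> measurableType d).
Variables (P : forall N, probability (Omega N) R) (Cp : nat -> R).
Variable H : forall N, Omega N -> 'M[R[i]]_N.
Hypothesis hW : forall N, wigner (P N) Cp (@H N).
Variables (ze dl T : R).
Hypotheses (dl0 : 0 < dl) (hdl : 244 * dl <= ze) (ze1 : ze <= 2^-1) (T0 : 0 <= T).

Local Notation Z := (T + 4).
Local Notation claimX := (claimX P H ze dl T).
Local Notation claimQ := (claimQ P H ze T).

Lemma self_consistent_le N (A : 'M[R[i]]_N) z (xi : R) : (0 < N)%N ->
  (forall k, cabs (Xst A z (ebase R k)) <= xi) -> cabs (1 + (z + mst A z) * mst A z) <= xi.
Proof.
move=> N0 h; rewrite -(Xst_average A z N0) cabs_div_nat ler_pdivrMr ?ltr0n//.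
apply: le_trans (cabs_sum _ _ _) _.
have -> : xi * N%:R = \sum_(k < N) xi by rewrite sumr_const card_ord mulr_natr.
by apply: ler_sum => k _; exact: h.
Qed.

(** The value 1/4 leaves room for the factor 2 lost in the passage to all z; the error actually
    tends to 0. *)
Lemma error_le_half : exists N1, forall N, (N1 <= N)%N -> forall z, dom ze T N z ->
  N%:R `^ (61 * dl) * psi_ N z <= 4^-1.
Proof.
have z4 : 0 < ze / 4 by have := dl0; have := hdl; lra.
have [N1 h1] := ev_ge 4 z4.
exists (maxn N1 1) => N; rewrite geq_max => /andP[/h1 h N0] z hz.
apply: (@le_trans _ _ (N%:R `^ (ze / 4) * N%:R `^ (- (ze / 2)))).
  apply: ler_pM; rewrite ?powR_ge0 ?psi_ge0//; last exact: (psi_le N0 hz).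
  by rewrite ler_powR ?ler1n//; have := hdl; have := dl0; lra.
rewrite -powR_natD//; have -> : ze / 4 + - (ze / 2) = - (ze / 4) by lra.
by rewrite powRN lef_pV2 ?posrE ?powR_gt0 ?ltr0n.
Qed.

(** The resulting bound does not depend on b, so the factor lost in one step is recovered before the
    next and the losses do not accumulate. *)
Lemma claimQ_of_claimX b : claimX b -> claimQ b.
Proof.
move=> hX D; have [N1 h1] := error_le_half; have [N2 h2] := hX D.+2.
exists (maxn (maxn N1 N2) 2) => N; rewrite !geq_max => /andP[/andP[/h1 half /h2 {}hX] N2'] x z x1 hz hb.
have N0 : (0 < N)%N by exact: ltnW.
have e1 k : nrm2 (ebase R k : 'cV[R[i]]_N) <= 1 by rewrite nrm2_ebase.
have sE := small_bigU (fun k : 'I_N => hX (ebase R k) z (e1 k) hz hb).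
apply: small_sub (smallU (hX x z x1 hz hb) sE).
  move=> w /= hq; case: (pselect (N%:R `^ (61 * dl) * psi_ N z <= cabs (Xst (H w) z x))) => [|nx]; first by left.
  case: (pselect (exists k, N%:R `^ (61 * dl) * psi_ N z <= cabs (Xst (H w) z (ebase R k)))) => [|ne]; first by right.
  have hx := half z hz.
  have X1 : cabs (Xst (H w) z x) <= 1 by have := nx; move/negP; rewrite -ltNge; move=> nx'; lra.
  have dd : cabs (1 + (z + mst (H w) z) * mst (H w) z) <= 2^-1.
    apply: self_consistent_le => // k.
    have : ~ (N%:R `^ (61 * dl) * psi_ N z <= cabs (Xst (H w) z (ebase R k))) by move=> h; apply: ne; exists k.
    by move/negP; rewrite -ltNge; move=> h; lra.
  have Z0 : 0 <= Z by have := T0; lra.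
  have := qf_of_Xst Z0 (dom_cabs N0 hz) x1 dd X1.
  by rewrite leNgt hq.
rewrite card_ord; have N2R : (2 : R) <= N%:R by rewrite ler_nat.
have a1 : N%:R * N%:R ^- D.+2 <= N%:R ^- D.+1 :> R by rewrite absorb_inv.
have a2 : N%:R ^- D.+2 <= N%:R ^- D.+1 :> R.
  by rewrite lef_pV2 ?posrE ?exprn_gt0 ?ltr0n// ler_weXn2l// ler1n.
apply: (@le_trans _ _ (2 * N%:R ^- D.+1)); last exact: absorb_inv.
have g (r1 r2 r3 : R) : r1 <= r3 -> r2 <= r3 -> r2 + r1 <= 2 * r3 by lra.
exact: g a1 a2.
Qed.

Lemma claimX_iter n : claimX (- (n.+1%:R * dl)).
Proof.
elim: n => [|n IH].
  have := claimX_of_claimQ hW dl0 hdl ze1 T0 (lexx 0) (claimQ_base hW ze T0).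
  by rewrite sub0r mul1r.
have nb : - (n.+1%:R * dl) <= 0 by rewrite oppr_le0 mulr_ge0// ltW.
have := claimX_of_claimQ hW dl0 hdl ze1 T0 nb (claimQ_of_claimX IH).
by have -> : - (n.+1%:R * dl) - dl = - (n.+2%:R * dl) by rewrite -[n.+2%:R]natr1; ring.
Qed.

Lemma local_law (D : nat) : exists N1, forall N, (N1 <= N)%N ->
  forall (x : 'cV[R[i]]_N) z, nrm2 x <= 1 -> dom ze T N z ->
  small (P N) (N%:R ^- D) [set w | N%:R `^ (61 * dl) * psi_ N z <= cabs (Xst (H w) z x)].
Proof.
(* After this fixed number of steps the exponent is at most -1, below that of the domain. *)
have [N1 h] := claimX_iter (Num.truncn dl^-1) D.
exists (maxn N1 1) => N; rewrite geq_max => /andP[N1N N0] x z x1 hz; apply: (h N) => //.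
case: hz => _ hz _; apply: le_trans hz; rewrite ler_powR ?ler1n//.
have : 1 <= (Num.truncn dl^-1).+1%:R * dl by rewrite -ler_pdivrMr// div1r ltW// truncnS_gt.
by have := hdl; have := dl0; lra.
Qed.

(** The resolvent identity followed by the Ward identity, with all quantities bounded by powers of
    N. *)
Lemma qf_lipschitz N (A : 'M[R[i]]_N) z z' x : hermitian A -> (0 < N)%N ->
  1 <= N%:R * complex.Im z -> 1 <= N%:R * complex.Im z' -> nrm2 x <= 1 ->
  cabs (qf A z x x - qf A z' x x) <= cabs (z - z') * N%:R ^+ 2.
Proof.
move=> hA N0 i1 i2 x1; have N0R : (0 : R) < N%:R by rewrite ltr0n.
have z0 : 0 < complex.Im z by rewrite -(pmulr_rgt0 _ N0R); apply: lt_le_trans i1.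
have z0' : 0 < complex.Im z' by rewrite -(pmulr_rgt0 _ N0R); apply: lt_le_trans i2.
have nz : complex.Im z != 0 by rewrite gt_eqF.
have nz' : complex.Im z' != 0 by rewrite gt_eqF.
have e : qf A z x x - qf A z' x x = (z - z') * dotc (adjmx (res A z) *m x) (res A z' *m x).
  by rewrite -dotc_adj /qf -dotcBr -mulmxBl (res_sub_z hA nz nz') -scalemxAl dotcZr mulmxA.
rewrite e; apply: cabs_ler_pM => //; apply: le_trans (dotc_cauchy_schwarz _ _) _.
have b (a y : R) : 0 <= a -> 0 < y -> 1 <= N%:R * y -> y * a <= N%:R -> Num.sqrt a <= N%:R.
  move=> a0 y0 y1 ya; rewrite -[leRHS](ger0_norm (ltW N0R)) -sqrtr_sqr ler_sqrt ?sqr_ge0//.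
  by rewrite -(ler_pM2l y0) (le_trans ya)// expr2 mulrCA mulrA -[leLHS]mul1r ler_wpM2r// ltW.
rewrite expr2; apply: ler_pM; rewrite ?sqrtr_ge0//; [apply: (b _ _ (nrm2_ge0 _) z0 i1)|apply: (b _ _ (nrm2_ge0 _) z0' i2)].
  by rewrite -ward_l//; apply: le_trans (Im_qf_le _ _ _) _; apply: qf_crude.
by rewrite -ward_r//; apply: le_trans (Im_qf_le _ _ _) _; apply: qf_crude.
Qed.

Lemma Xst_lipschitz N (A : 'M[R[i]]_N) z z' x : hermitian A -> (0 < N)%N ->
  1 <= N%:R * complex.Im z -> 1 <= N%:R * complex.Im z' -> cabs z' <= N%:R -> nrm2 x <= 1 ->
  cabs (Xst A z x - Xst A z' x) <= cabs (z - z') * (4 * N%:R ^+ 3).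
Proof.
move=> hA N0 i1 i2 zN x1; set s := cabs (z - z'); have N0R : (0 : R) < N%:R by rewrite ltr0n.
have s0 : 0 <= s := cabs_ge0 _.
have N1 : (1 : R) <= N%:R by rewrite ler1n.
have qq := qf_lipschitz hA N0 i1 i2 x1.
have mm : cabs (mst A z - mst A z') <= s * N%:R ^+ 2.
  rewrite /mst -mulrBl cabs_div_nat ler_pdivrMr// -sumrB.
  apply: le_trans (cabs_sum _ _ _) _.
  have -> : s * N%:R ^+ 2 * N%:R = \sum_(k < N) (s * N%:R ^+ 2) by rewrite sumr_const card_ord mulr_natr.
  by apply: ler_sum => k _; apply: qf_lipschitz => //; rewrite nrm2_ebase.
have -> : Xst A z x - Xst A z' x = ((z - z') + (mst A z - mst A z')) * qf A z x x
    + (z' + mst A z') * (qf A z x x - qf A z' x x).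
  by rewrite /Xst; move: (mst A z) (mst A z') (qf A z x x) (qf A z' x x) (_%:C) => a b c e f; ring.
apply: (@le_trans _ _ ((s + s * N%:R ^+ 2) * N%:R + (N%:R + N%:R) * (s * N%:R ^+ 2))).
  apply: cabs_lerD; apply: cabs_ler_pM => //; [exact: cabs_lerD|exact: qf_crude|].
  by apply: cabs_lerD => //; exact: mst_crude.
have -> : (s + s * N%:R ^+ 2) * N%:R + (N%:R + N%:R) * (s * N%:R ^+ 2) = s * (N%:R + 3 * N%:R ^+ 3) by ring.
apply: ler_wpM2l => //; have : N%:R <= N%:R ^+ 3 :> R by rewrite exprS ler_peMr ?exprn_ege1.
by move: (N%:R ^+ 3) => a; lra.
Qed.

Lemma transfer_le (r1 r2 r3 r4 r5 r6 r7 : R) : r5 <= r4 -> r4 <= r3 -> r3 <= r1 -> r2 <= r1 ->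
  2 * r1 < r6 -> r6 <= r7 + r5 -> r2 <= r7.
Proof. by move=> *; lra. Qed.

Lemma dist_le_mesh (x y e : R) : y <= x -> x <= y + e -> `|x - y| <= e.
Proof. by move=> *; rewrite ler_norml; apply/andP; split; lra. Qed.

(* Union bound over a net of mesh N^-6. *)
Lemma uniform_law (v : forall N, 'cV[R[i]]_N) : (forall N, (0 < N)%N -> nrm2 (v N) = 1) ->
  forall D : nat, exists N1, forall N, (N1 <= N)%N ->
  small (P N) (N%:R ^- D) [set w | exists k : option 'I_N, exists z : R[i],
    [/\ `|complex.Re z| <= 3, N%:R `^ (-1 + ze) <= complex.Im z, complex.Im z <= T &
      2 * (N%:R `^ (61 * dl) * psi_ N z) < cabs (Xst (H w) z (if k is Some j then ebase R j else v N))]].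
Proof.
(* 16 = 7 + 7 + 2: N^7 grid values in each coordinate and N + 1 <= N^2 vectors. *)
move=> hv D; have [N1 h1] := local_law (D + 16); have [N2 h2] := ev_nat (T + 10).
exists (maxn (maxn N1 N2) 1) => N; rewrite !geq_max => /andP[/andP[/h1 law /h2 NT] N0].
have t0 := T0; have ze2 := ze1; have hdl' := hdl; have dl0' := dl0.
have N0R : (0 : R) < N%:R by rewrite ltr0n.
have N1R : (1 : R) <= N%:R by rewrite ler1n.
pose xk (k : option 'I_N) := if k is Some j then ebase R j else v N.
have xk1 k : nrm2 (xk k) <= 1 by case: k => [j|]; rewrite /xk ?nrm2_ebase// hv.
(* The grid has side M h = N, larger than the domain. *)
pose M := (N ^ 7)%N; pose h : R := N%:R ^- 6.
have h0 : 0 < h by rewrite invr_gt0 exprn_gt0.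
have h1' : h <= 1 by rewrite invf_le1 ?exprn_gt0// exprn_ege1.
pose zz (a b : nat) : R[i] := Complex (-3 + a%:R * h) (b%:R * h).
pose I := (('I_M * 'I_M) * option 'I_N)%type.
pose bad (c : I) := [set w | dom ze T N (zz c.1.1 c.1.2) /\
  N%:R `^ (61 * dl) * psi_ N (zz c.1.1 c.1.2) <= cabs (Xst (H w) (zz c.1.1 c.1.2) (xk c.2))].
have sb c : small (P N) (N%:R ^- (D + 16)) (bad c).
  case: (pselect (dom ze T N (zz c.1.1 c.1.2))) => hd.
    by apply: small_sub (law (xk c.2) _ (xk1 c.2) hd) => // w [].
  apply: small_sub (small0 (P N)); last by rewrite invr_ge0 exprn_ge0.
  by move=> w [].
apply: small_sub (small_bigU sb).
  move=> w /= [k [z [z1 z2 z3 zX]]].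
  have ih : h^-1 = N%:R ^+ 6 by rewrite invrK.
  have i0 : 0 < complex.Im z by apply: lt_le_trans z2; rewrite powR_gt0.
  have /andP[z1l z1u] : - 3 <= complex.Re z <= 3 by rewrite -ler_norml.
  (* The imaginary part is rounded up: the grid point stays above the lower edge of the domain and
     has a smaller psi. It may pass T by at most h <= 1, which is why [dom] extends to T + 1. *)
  pose a := Num.truncn ((complex.Re z + 3) / h); pose b := (Num.truncn (complex.Im z / h)).+1.
  have /andP[al au] : a%:R <= (complex.Re z + 3) / h < a.+1%:R.
    by apply: truncn_itv; rewrite divr_ge0 ?(ltW h0)//; lra.
  have /andP[bl bu] : b.-1%:R <= complex.Im z / h < b%:R.
    by apply: truncn_itv; rewrite divr_ge0 ?(ltW h0)// ltW.
  rewrite ler_pdivlMr// in al; rewrite ltr_pdivrMr// in au.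
  rewrite ler_pdivlMr// in bl; rewrite ltr_pdivrMr// in bu.
  rewrite -[a.+1%:R]natr1 mulrDl mul1r in au.
  have ah : 0 <= a%:R * h := mulr_ge0 (ler0n _ _) (ltW h0).
  have bS : b%:R = b.-1%:R + 1 :> R by rewrite natr1.
  have bl' : b%:R * h <= complex.Im z + h by rewrite bS mulrDl mul1r; lra.
  have a1 : -3 + a%:R * h <= complex.Re z by rewrite addrC lerBlDr.
  have a2 : complex.Re z < -3 + a%:R * h + h by rewrite -addrA addrC ltrBrDr.
  have h7 : N%:R = (M%:R : R) * h by rewrite /M natrX /h exprSr mulrAC mulfV ?mul1r// expf_neq0// gt_eqF.
  have aM : (a < M)%N.
    rewrite -(ltr_nat R) -(ltr_pM2r h0) -h7; lra.
  have bM : (b < M)%N.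
    rewrite -(ltr_nat R) -(ltr_pM2r h0) -h7; lra.
  have hd : dom ze T N (zz a b).
    split; rewrite /zz /=.
    - by rewrite ler_norml; apply/andP; split; lra.
    - by apply: le_trans z2 _; exact: ltW.
    - lra.
  have hd0 : dom ze T N z by split => //; lra.
  exists ((Ordinal aM, Ordinal bM), k); split => //=.
  have zN : cabs (zz a b) <= N%:R by apply: le_trans (dom_cabs N0 hd) _; lra.
  have ze0 : 0 <= ze by lra.
  have Ni u : dom ze T N u -> 1 <= N%:R * complex.Im u.
    by move=> hu; apply: le_trans (dom_Nim N0 hu); apply: powR_ge1.
  have lip := Xst_lipschitz (wigner_herm (hW N) w) N0 (Ni _ hd0) (Ni _ hd) zN (xk1 k).
  have s2 : cabs (z - zz a b) <= 2 * h.
    apply: le_trans (cabs_le_ReIm _) _; rewrite cReD cImD cReN cImN /zz /=.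
    have -> : 2 * h = h + h by ring.
    apply: lerD; last by rewrite distrC; apply: dist_le_mesh; [exact: ltW|exact: bl'].
    apply: dist_le_mesh; [exact: a1|exact: ltW].
  have lip2 : cabs (Xst (H w) z (xk k) - Xst (H w) (zz a b) (xk k)) <= 8 * N%:R ^- 3.
    apply: le_trans lip _; apply: (@le_trans _ _ (2 * h * (4 * N%:R ^+ 3))).
      by rewrite ler_wpM2r// mulr_ge0// exprn_ge0.
    by apply: le_of_eq; rewrite /h; field; rewrite gt_eqF.
  (* The discretization error is below psi and is covered by the factor 2 in the statement. *)
  have psi8 : 8 * N%:R ^- 3 <= psi_ N z.
    apply: le_trans (psi_ge N0 _ hd0); last by lra.
    have -> : N%:R^-1 = N%:R ^+ 2 * N%:R ^- 3 :> R by field; rewrite gt_eqF.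
    rewrite ler_wpM2r ?invr_ge0 ?exprn_ge0//; nra.
  have psiz : psi_ N (zz a b) <= psi_ N z.
    rewrite -(@ler_pXn2r _ 2)// ?nnegrE ?psi_ge0// (psi_sq N0 hd) (psi_sq N0 hd0).
    rewrite lef_pV2 ?posrE ?mulr_gt0 ?(dom_im N0 hd)// ler_wpM2l// ltW//.
  have L1 : 1 <= N%:R `^ (61 * dl) :> R by apply: powR_ge1 => //; lra.
  have p1 : psi_ N z <= N%:R `^ (61 * dl) * psi_ N z by rewrite ler_peMl ?psi_ge0.
  have p2 : N%:R `^ (61 * dl) * psi_ N (zz a b) <= N%:R `^ (61 * dl) * psi_ N z.
    by rewrite ler_wpM2l// powR_ge0.
  have := cabs_sub_le (Xst (H w) z (xk k)) (Xst (H w) (zz a b) (xk k)).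
  exact: transfer_le lip2 psi8 p1 p2 zX.
have MR : M%:R = N%:R ^+ 7 :> R by rewrite natrX.
clearbody M.
rewrite !card_prod !card_ord card_option card_ord !natrM MR -[N.+1%:R]natr1.
have -> : N%:R ^- (D + 16) = N%:R ^- D * N%:R ^- 16 :> R by rewrite exprD invfM.
have N2R : N%:R + 1 <= N%:R ^+ 2 :> R by nra.
apply: (@le_trans _ _ (N%:R ^+ 7 * N%:R ^+ 7 * N%:R ^+ 2 * (N%:R ^- D * N%:R ^- 16))).
  by apply: ler_wpM2r; [rewrite mulr_ge0 ?invr_ge0 ?exprn_ge0|apply: ler_wpM2l; [rewrite mulr_ge0 ?exprn_ge0|]].
rewrite -!exprD mulrCA mulfV ?mulr1// expf_neq0// gt_eqF//.
Qed.

End LocalLaw.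

(** * Eigenvalues of the perturbed matrix *)

Section Eigenvalues.
Local Open Scope complex_scope.
Variables (R : realType) (N : nat).
Implicit Types (A : 'M[R[i]]_N) (v x w : 'cV[R[i]]_N) (z : R[i]).

(** [eigenvalue] speaks of row vectors; the adjoint x of such a row is a left eigenvector and can be
    paired with any w. *)
Lemma eigen_pairing A v (t : R) z : eigenvalue (Gt A v t) z -> exists2 x, x != 0 &
  forall w, dotc x (A *m w) + (t%:C * 'i) * dotc v w * dotc x v = z * dotc x w.
Proof.
move=> /eigenvalueP[u uG u0]; exists (adjmx u).
  by apply: contra u0 => /eqP e; rewrite -[u]adjmxK e; apply/eqP/matrixP => i j; rewrite !mxE conjc0.
move=> w; have dE (y : 'cV[R[i]]_N) : (u *m y) ord0 ord0 = dotc (adjmx u) y.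
  by rewrite mxE; apply: eq_bigr => k _; rewrite mxE conjcK.
have vE : adjmx v *m w = (dotc v w)%:M.
  by apply/matrixP => i j; rewrite !ord1 !mxE /= mulr1n; apply: eq_bigr => k _; rewrite mxE.
have GE : Gt A v t *m w = A *m w + (t%:C * 'i * dotc v w) *: v.
  by rewrite /Gt mulmxDl -scalemxAl -mulmxA vE mul_mx_scalar scalerA.
rewrite -dotcZr -dotcDr -GE -dE -dE mulmxA uG -scalemxAl mxE //.
Qed.

Lemma dotc_herm_real A x : hermitian A -> complex.Im (dotc x (A *m x)) = 0.
Proof.
move=> hA; have e : conjc (dotc x (A *m x)) = dotc x (A *m x).
  by rewrite dotc_conj dotc_adj adjmx_herm.
have := congr1 (@complex.Im R) e; rewrite cImJ => h.
by move: h; move: (complex.Im _) => y h; lra.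
Qed.

(** Pairing with w = x, the real part gives Re z |x|^2 = <x, A x> and the imaginary part Im z |x|^2
    = t |<v, x>|^2. A norm below 3 then bounds Re z. *)
Lemma eigen_location A v (t : R) z : hermitian A -> nrm2 v = 1 -> 0 < t ->
  (forall u, nrm2 u = 1 -> nrm2 (A *m u) < 9) -> eigenvalue (Gt A v t) z ->
  [/\ `|complex.Re z| < 3, 0 <= complex.Im z, complex.Im z <= t &
      0 < complex.Im z -> qf A z v v = 'i / t%:C].
Proof.
move=> hA v1 t0 nA /eigen_pairing[x x0 hx].
have X0 : 0 < nrm2 x.
  by rewrite lt_neqAle nrm2_ge0 andbT eq_sym; apply: contra x0 => /eqP /nrm2_eq0 ->.
have bb : dotc v x * dotc x v = (cabs (dotc x v) ^+ 2)%:C.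
  by rewrite -(dotc_conj x v) mulrC cabs_mulJ.
have e := hx x; rewrite -mulrA bb dotcxx in e.
have eR : complex.Re (dotc x (A *m x)) = complex.Re z * nrm2 x.
  by have := congr1 (@complex.Re R) e; rewrite cReD !(cReM, cImM) /= !(mul0r, mulr0, mulr1, subr0, addr0, add0r, oppr0).
have eI : t * cabs (dotc x v) ^+ 2 = complex.Im z * nrm2 x.
  have := congr1 (@complex.Im R) e; rewrite cImD !(cReM, cImM) (dotc_herm_real _ hA) /=.
  by rewrite !(mul0r, mulr0, mulr1, subr0, addr0, add0r, oppr0).
have b1 : cabs (dotc x v) ^+ 2 <= nrm2 x.
  have := dotc_cauchy_schwarz x v; rewrite v1 sqrtr1 mulr1 => h.
  rewrite -[leRHS](sqr_sqrtr (ltW X0)).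
  by apply: lerXn2r h; rewrite nnegrE ?cabs_ge0 ?sqrtr_ge0.
have nAx : nrm2 (A *m x) < 9 * nrm2 x.
  pose c := (Num.sqrt (nrm2 x))^-1; have s0 : 0 < Num.sqrt (nrm2 x) by rewrite sqrtr_gt0.
  have c2 : cabs c%:C ^+ 2 = (nrm2 x)^-1.
    by rewrite cabs_real ger0_norm ?invr_ge0 ?sqrtr_ge0// exprVn sqr_sqrtr// ltW.
  have := nA (c%:C *: x); rewrite -scalemxAr !nrm2Z c2 mulVf ?gt_eqF// => /(_ erefl).
  by rewrite mulrC ltr_pdivrMr.
split.
- have := dotc_cauchy_schwarz x (A *m x) => h.
  have h1 : `|complex.Re z| * nrm2 x <= Num.sqrt (nrm2 x) * Num.sqrt (nrm2 (A *m x)).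
    apply: le_trans h; rewrite -[X in _ * X](ger0_norm (ltW X0)) -normrM -eR; exact: Re_le_cabs.
  have h2 : Num.sqrt (nrm2 x) * Num.sqrt (nrm2 (A *m x)) < 3 * nrm2 x.
    rewrite -sqrtrM ?(ltW X0)//; have n3 : 0 <= 3 * nrm2 x by rewrite mulr_ge0// ltW.
    rewrite -[ltRHS](ger0_norm n3) -sqrtr_sqr ltr_sqrt ?exprn_gt0 ?mulr_gt0//.
    have -> : (3 * nrm2 x) ^+ 2 = nrm2 x * (9 * nrm2 x) by ring.
    by rewrite ltr_pM2l.
  by rewrite -(ltr_pM2r X0); exact: le_lt_trans h1 h2.
- by rewrite -(pmulr_lge0 _ X0) -eI mulr_ge0 ?(ltW t0)// sqr_ge0.
- by rewrite -(ler_pM2r X0) -eI ler_wpM2l ?(ltW t0).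
move=> i0; have nz : complex.Im z != 0 by rewrite gt_eqF.
have b0 : dotc x v != 0.
  apply/eqP => b0; move: eI; rewrite b0 cabs0 expr0n mulr0 => /esym/eqP.
  by rewrite mulf_eq0 !gt_eqF.
have tC : t%:C != 0 :> R[i] by apply/eqP => /(congr1 (@complex.Re R)) /= /eqP; rewrite gt_eqF.
have ii : 'i * 'i = -1 :> R[i] by rewrite -expr2 sqr_i.
(* Pairing with w = G v, where A G v = v + z G v, leaves (1 + i t <v, G v>) <x, v> = 0; and <x, v>
   is not 0 because Im z > 0. *)
have := hx (res A z *m v); rewrite -/(qf A z v v).
have -> : A *m (res A z *m v) = v + z *: (res A z *m v).
  have := mul_res hA nz => /(congr1 (fun M => M *m v)); rewrite mul1mx -mulmxA mulmxBl mul_scalar_mx => e1.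
  by apply/eqP; rewrite -subr_eq e1.
rewrite dotcDr dotcZr addrAC => /eqP; rewrite -subr_eq0 addrK.
have -> : dotc x v + t%:C * 'i * qf A z v v * dotc x v = (1 + t%:C * 'i * qf A z v v) * dotc x v.
  by rewrite mulrDl mul1r.
rewrite mulf_eq0 (negbTE b0) orbF => /eqP h.
apply: (mulfI tC); rewrite mulrCA divff// mulr1.
have -> : t%:C * qf A z v v = - 'i * (t%:C * 'i * qf A z v v).
  by rewrite -[LHS]mul1r -[1]opprK -ii; move: ('i : R[i]) (t%:C) (qf A z v v) => I a b; ring.
have -> : t%:C * 'i * qf A z v v = -1 by apply/eqP; rewrite -subr_eq0 opprK addrC h.
by rewrite mulrN1 opprK.
Qed.

(** Elimination of m: the value of g turns the definition of X into z + m = I t (1 - X), which is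
    substituted into 1 + (z + m) m. Exact, so no root has to be selected. *)
Lemma quadratic_identity (C : comNzRingType) (I t ti z m X g : C) : I * I = -1 -> t * ti = 1 -> g = I * ti ->
  X = 1 + (z + m) * g ->
  I * t * (z - I * (t - ti)) = t ^+ 2 * (2 * X - X ^+ 2) - (1 + (z + m) * m) + I * t * z * X.
Proof.
move=> ii tti gE XE.
have y : z + m = I * t * (1 - X).
  rewrite XE gE; have -> : I * t * (1 - (1 + (z + m) * (I * ti))) = - (I * I) * (t * ti) * (z + m) by ring.
  by rewrite ii tti opprK !mul1r.
have -> : m = I * t * (1 - X) - z by rewrite -y addrAC subrr add0r.
have -> : z + (I * t * (1 - X) - z) = I * t * (1 - X) by rewrite addrC subrK.
have -> : I * t * (z - I * (t - ti)) = I * t * z - (I * I) * (t ^+ 2 - t * ti) by ring.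
have -> : t ^+ 2 * (2 * X - X ^+ 2) - (1 + I * t * (1 - X) * (I * t * (1 - X) - z)) + I * t * z * X =
  t ^+ 2 * (2 * X - X ^+ 2) - (1 + (I * I) * t ^+ 2 * (1 - X) ^+ 2) + I * t * z by ring.
by rewrite ii tti; ring.
Qed.

(** Division by t is harmless: 1/t is the modulus of the form at v, which is bounded once the X's
    are small. Eigenvalues in this range thus exclude small t. *)
Lemma eigen_close A v (t T Z xi : R) z : (0 < N)%N -> nrm2 v = 1 -> 0 < t -> t < T -> 0 <= Z -> cabs z <= Z ->
  qf A z v v = 'i / t%:C -> xi <= 2^-1 -> cabs (Xst A z v) <= xi ->
  (forall k, cabs (Xst A z (ebase R k)) <= xi) ->
  cabs (z - 'i * (tstar t)%:C) <= xi * (3 * T + 4 * (Z + 2) + Z).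
Proof.
move=> N0 v1 t0 tT Z0 zZ gE xih hX hk.
have hd := self_consistent_le N0 hk.
have xi0 : 0 <= xi := le_trans (cabs_ge0 _) hX.
have tC : t%:C != 0 :> R[i] by apply/eqP => /(congr1 (@complex.Re R)) /= /eqP; rewrite gt_eqF.
have ii : 'i * 'i = -1 :> R[i] by rewrite -expr2 sqr_i.
have q : t^-1 <= 4 * (Z + 2).
  have := qf_of_Xst Z0 zZ (_ : nrm2 v <= 1) (le_trans hd xih) (le_trans hX _).
  rewrite v1 lexx gE cabsM cabs_i mul1r cabsV cabs_real ger0_norm ?(ltW t0)//; apply => //.
  by apply: le_trans xih _; lra.
have XE : Xst A z v = 1 + (z + mst A z) * qf A z v v by rewrite /Xst v1 rmorph1.
have ts : (tstar t)%:C = t%:C - (t%:C)^-1 by rewrite /tstar rmorphB fmorphV.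
have id := quadratic_identity ii (divff tC) gE XE; rewrite -ts in id.
set X := Xst A z v in hX id; set dd := 1 + _ in hd id.
have lhs : cabs ('i * t%:C * (z - 'i * (tstar t)%:C)) = t * cabs (z - 'i * (tstar t)%:C).
  by rewrite (cabsM ('i * _)) cabsM cabs_i mul1r cabs_real ger0_norm// ltW.
have X1 : cabs X <= 1 by apply: le_trans hX _; apply: le_trans xih _; lra.
have b : t * cabs (z - 'i * (tstar t)%:C) <= t ^+ 2 * (3 * xi) + xi + t * Z * xi.
  rewrite -lhs id; apply: cabs_lerD; first apply: cabs_lerB => //.
    apply: cabs_ler_pM; first by rewrite cabsX cabs_real ger0_norm// ltW.
    have -> : 3 * xi = 2 * xi + 1 * xi by ring.
    apply: cabs_lerB; first by apply: cabs_ler_pM => //; rewrite cabs_nat.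
    by rewrite expr2; apply: cabs_ler_pM.
  apply: cabs_ler_pM => //; apply: cabs_ler_pM => //.
  by rewrite cabsM cabs_i mul1r cabs_real ger0_norm// ltW.
rewrite -(ler_pM2l t0); apply: le_trans b _.
have -> : t ^+ 2 * (3 * xi) + xi + t * Z * xi = t * (xi * (3 * t + t^-1 + Z)).
  by field; rewrite gt_eqF.
apply: ler_wpM2l; first exact: ltW.
by apply: ler_wpM2l => //; lra.
Qed.

End Eigenvalues.

Lemma common_exponent (R : realFieldType) (a b : R) : 0 < a -> 0 < b ->
  exists dl, [/\ 0 < dl, 244 * dl <= a & 244 * dl <= b].
Proof.
move=> a0 b0; case: (leP a b) => ab.
  by exists (a / 244); split; lra.
by exists (b / 244); split; lra.
Qed.

Unset Implicit Arguments.

Theorem theorem2p2 (R : realType) (d : measure_display)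
    (Omega : nat -> measurableType d) (P : forall N, probability (Omega N) R)
    (Cp : nat -> R)
    (H : forall N, Omega N -> 'M[R[i]]_N)
    (v : forall N, 'cV[R[i]]_N) (T : R) :
  2 <= T ->
  (forall N, wigner (P N) Cp (H N)) ->
  (forall N, (0 < N)%N -> \sum_(k < N) cabs (v N k ord0) ^+ 2 = 1) ->
  forall eps zeta : R, 0 < eps -> 0 < zeta ->
  forall D : R, 0 < D ->
  exists N0 : nat, forall N : nat, (N0 <= N)%N ->
    exists A : set (Omega N), measurable A /\
      [set w | exists t : R, 0 < t /\ t < T /\
          exists z : R[i], eigenvalue (Gt (H N w) (v N) t) z /\
             ~ (setE N T t eps z \/ setR N zeta z)] `<=` A /\
      (P N A < (N%:R `^ (- D))%:E)%E.
Proof.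
move=> T2 hW hv eps zeta eps0 zeta0 D D0.
(* The local law is proved for exponents up to 1/2; a smaller exponent only enlarges its domain. *)
pose ze := Num.min zeta 2^-1.
have ze0 : 0 < ze by rewrite lt_min zeta0 invr_gt0 ltr0n.
have [dl [dl0 hdl hde]] := common_exponent ze0 eps0.
have e122 : eps / 4 + 122 * dl <= eps by lra.
have TT1 : T <= T + 1 by rewrite lerDl.
have ze1 : ze <= 2^-1 by rewrite ge_min lexx orbT.
have T0 : 0 <= T by lra.
(* One power of N beyond D makes the final inequality strict; another, in m + 1, absorbs the factor
   2 of the two bad events. *)
pose m := (Num.truncn (D + 1)).+1; have Dm : D + 1 <= m%:R by apply: ltW; exact: truncnS_gt.
have hv1 N : (0 < N)%N -> nrm2 (v N) = 1 by exact: hv.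
have [N1 h1] := uniform_law hW dl0 hdl ze1 T0 hv1 m.+1.
have [N2 h2] := norm_whp hW m.+1.
have [N3 h3] := error_le_half T dl0 hdl.
pose Z := T + 4; pose C := 3 * T + 4 * (Z + 2) + Z.
have e4 : 0 < eps / 4 by rewrite divr_gt0.
(* 4 C^2 is the constant in the squared error; the added 1 makes the bound strict. *)
have [N4 h4] := ev_ge (4 * C ^+ 2 + 1) e4.
exists (maxn (maxn (maxn N1 N2) (maxn N3 N4)) 2) => N.
rewrite !geq_max => /andP[/andP[/andP[/h1 law /h2 norm] /andP[/h3 half /h4 hN]] N2'].
have N0 : (0 < N)%N by exact: ltnW.
have N0R : (0 : R) < N%:R by rewrite ltr0n.
have N1R : (1 : R) <= N%:R by rewrite ler1n.
have [A [mA BA PA]] := smallU law norm.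
exists A; split => //; split; last first.
  have fA : P N A \is a fin_num by rewrite fin_num_measure.
  rewrite -(fineK fA) lte_fin; apply: le_lt_trans PA _.
  apply: (@le_lt_trans _ _ (N%:R ^- m)).
    have -> : N%:R ^- m.+1 + N%:R ^- m.+1 = 2 * N%:R ^- m.+1 :> R by rewrite (mulr_natl _ 2) mulr2n.
    by apply: absorb_inv => //; rewrite ler_nat.
  apply: (@le_lt_trans _ _ (N%:R `^ (- D) * N%:R^-1)).
    by rewrite -[N%:R^-1]powR_inv1// -powR_natD// -powR_nat -powRN ler_powR//; lra.
  by rewrite ltr_pdivrMr// ltr_pMr ?powR_gt0// ltr1n.
move=> w [t [t0 [tT [z [ez nz]]]]]; apply: BA.
case: (pselect (exists u, nrm2 u = 1 /\ 9 <= nrm2 (@H N w *m u))) => [|nn]; first by right.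
left; apply: contrapT => nlaw; apply: nz.
have hA := wigner_herm (hW N) w.
have nA u : nrm2 u = 1 -> nrm2 (@H N w *m u) < 9.
  by move=> u1; rewrite ltNge; apply/negP => h; apply: nn; exists u.
have [z1 z2 z3 gE] := eigen_location hA (hv1 N N0) t0 nA ez.
case: (ltP (complex.Im z) (N%:R `^ (-1 + zeta))) => zi; first by right.
left; have i0 : 0 < complex.Im z by apply: lt_le_trans zi; rewrite powR_gt0.
have zi' : N%:R `^ (-1 + ze) <= complex.Im z.
  by apply: le_trans zi; rewrite ler_powR// lerD2l ge_min lexx.
have zT : complex.Im z <= T := le_trans z3 (ltW tT).
have hd : dom ze T N z by split; [exact: ltW|exact: zi'|exact: le_trans zT TT1].
pose xi := 2 * (N%:R `^ (61 * dl) * psi_ N z).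
have hk k : cabs (Xst (@H N w) z (if k is Some j then ebase R j else v N)) <= xi.
  rewrite leNgt; apply/negP => h; apply: nlaw; exists k, z; split => //; exact: ltW.
have xih : xi <= 2^-1 by have := half z hd; rewrite /xi; lra.
have Z0 : 0 <= Z by rewrite /Z; lra.
have cl := eigen_close N0 (hv1 N N0) t0 tT Z0 (dom_cabs N0 hd) (gE i0) xih (hk None) (fun k => hk (Some k)).
rewrite -/C in cl; split => //; last by split => //; split => //; exact: le_lt_trans z3 tT.
have -> : complex.Re z ^+ 2 + (complex.Im z - tstar t) ^+ 2 = cabs (z - 'i%C * (tstar t)%:C%C) ^+ 2.
  by rewrite cabs_sqr; congr (_ ^+ 2 + _ ^+ 2); rewrite !(cReD, cReN, cReM, cImD, cImN, cImM) /=; ring.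
have xi0 : 0 <= xi := le_trans (cabs_ge0 _) (hk None).
apply: (@le_lt_trans _ _ ((xi * C) ^+ 2)).
  apply: lerXn2r cl; rewrite nnegrE ?cabs_ge0//.
  by rewrite mulr_ge0// /C !addr_ge0 ?mulr_ge0// addr_ge0.
(* Squaring turns psi into 1/(N Im z), the shape of the radius; the powers of N left over fit into
   N^eps since 122 dl <= eps / 2. *)
have -> : (xi * C) ^+ 2 = 4 * C ^+ 2 * N%:R `^ (122 * dl) * (N%:R * complex.Im z)^-1.
  rewrite -(psi_sq N0 hd) /xi !exprMn powR_nat_exp.
  have -> : 61 * dl * 2%:R = 122 * dl by ring.
  by move: (N%:R `^ (122 * dl)) (psi_ N z) => a b; clearbody C; ring.
rewrite ltr_pM2r ?invr_gt0 ?mulr_gt0//.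
apply: (@lt_le_trans _ _ (N%:R `^ (eps / 4) * N%:R `^ (122 * dl))).
  by rewrite ltr_pM2r ?powR_gt0//; apply: lt_le_trans hN; rewrite ltrDl.
by rewrite -powR_natD// ler_powR.
Qed.
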